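(* Let $\mathcal{D}\subset \mathbb{C}\cup\{\infty\}=\partial H^3$ be an arbitrary open disk in the ideal boundary of hyperbolic $3$-space. Then there exists a weakly complete flat front $f=\mathcal{L}\mathcal{L}^*\colon \mathbb{D}_1\to H^3$ (with $\mathcal{L}\colon\mathbb{D}_1\to \mathrm{SL}(2,\mathbb{C})$ a holomorphic Legendrian immersion) whose pair of hyperbolic Gauss maps $G_+,G_-$ both satisfy $G_\pm(\mathbb{D}_1)\subset \mathcal{D}$.
   Context: $\mathbb{D}_1=\{z\in\mathbb{C}: |z|<1\}$. Hyperbolic $3$-space is realized as $H^3=\mathrm{SL}(2,\mathbb{C})/\mathrm{SU}(2)=\{aa^*: a\in \mathrm{SL}(2,\mathbb{C})\}$, $a^*={}^t\bar a$, with ideal boundary identified with $\mathbb{C}\cup\{\infty\}$ via the Poincaré upper half-space model. A holomorphic immersion $\mathcal{L}\colon \mathbb{D}_1\to\mathrm{SL}(2,\mathbb{C})$ is called Legendrian if it is Legendrian for the complex contact form $x_{11}dx_{22}-x_{21}dx_{12}$; equivalently $\mathcal{L}^{-1}d\mathcal{L}=\begin{pmatrix}0&\theta\\ \omega&0\end{pmatrix}$ for holomorphic $1$-forms $\omega,\theta$ on $\mathbb{D}_1$. The map $f=\mathcal{L}\mathcal{L}^*\colon\mathbb{D}_1\to H^3$ is then a flat front (flat surface with admissible singularities), and $\mathcal{L}$ is its holomorphic lift. The front $f$ is weakly complete if the metric $ds^2_{\mathcal L}=|\omega|^2+|\theta|^2$ is a complete Riemannian metric on $\mathbb{D}_1$.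 Writing $\mathcal{L}=\begin{pmatrix}A&B\\C&D\end{pmatrix}$, the hyperbolic Gauss maps of $f$ are $G_+=A/C$ and $G_-=B/D$ (meromorphic functions into $\mathbb{C}\cup\{\infty\}$). *)

(* Defs.v *)
From Stdlib Require Import Reals.
Open Scope R_scope.

Definition Cx : Type := (R * R)%type.
Definition Cre (z : Cx) : R := fst z.
Definition Cim (z : Cx) : R := snd z.
Definition C0 : Cx := (0, 0).
Definition C1 : Cx := (1, 0).
Definition Cadd (z w : Cx) : Cx := (fst z + fst w, snd z + snd w).
Definition Copp (z : Cx) : Cx := (- fst z, - snd z).
Definition Csub (z w : Cx) : Cx := Cadd z (Copp w).
Definition Cmul (z w : Cx) : Cx :=
  (fst z * fst w - snd z * snd w, fst z * snd w + snd z * fst w).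
Definition Cconj (z : Cx) : Cx := (fst z, - snd z).
Definition Cnorm2 (z : Cx) : R := fst z * fst z + snd z * snd z.
Definition Cabs (z : Cx) : R := sqrt (Cnorm2 z).
Definition Cinv (z : Cx) : Cx := (fst z / Cnorm2 z, - snd z / Cnorm2 z).
Definition Cdiv (z w : Cx) : Cx := Cmul z (Cinv w).

Definition in_D1 (z : Cx) : Prop := Cabs z < 1.

Definition has_cderiv (f : Cx -> Cx) (z l : Cx) : Prop :=
  forall eps : R, 0 < eps -> exists delta : R, 0 < delta /\
    forall h : Cx, 0 < Cabs h < delta ->
      Cabs (Csub (Csub (f (Cadd z h)) (f z)) (Cmul l h)) <= eps * Cabs h.

Definition holo_D1_with (f f' : Cx -> Cx) : Prop :=
  forall z, in_D1 z -> has_cderiv f z (f' z).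

(** * Riemann sphere C ∪ {∞}: [None] is ∞. *)
Definition CP1 : Type := option Cx.

Inductive open_disk_CP1 : (CP1 -> Prop) -> Prop :=
| disk_inside (c : Cx) (r : R) : 0 < r ->
    open_disk_CP1 (fun p => match p with
                            | Some z => Cabs (Csub z c) < r
                            | None => False end)
| disk_outside (c : Cx) (r : R) : 0 < r ->
    open_disk_CP1 (fun p => match p with
                            | Some z => r < Cabs (Csub z c)
                            | None => True end)
| disk_halfplane (c u : Cx) : u <> C0 ->
    open_disk_CP1 (fun p => match p with
                            | Some z => 0 < Cre (Cmul (Csub z c) (Cconj u))
                            | None => False end).

(** The quotient a / c as a point of C ∪ {∞} (used when (a,c) <> (0,0)). *)
Definition ratio_CP1 (a c : Cx) : CP1 :=
  if Req_EM_T (Cnorm2 c) 0 then None else Some (Cdiv a c).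

(** * Holomorphic Legendrian immersions D_1 -> SL(2,C)
    L = [[A, B], [C, D]], with derivatives A', B', C', D'.
    L^{-1} = [[D, -B], [-C, A]], so
    L^{-1} L' = [[D A' - B C', D B' - B D'], [A C' - C A', A D' - C B']]. *)
Definition omega_of (A C A' C' : Cx -> Cx) (z : Cx) : Cx :=
  Csub (Cmul (A z) (C' z)) (Cmul (C z) (A' z)).
Definition theta_of (B D B' D' : Cx -> Cx) (z : Cx) : Cx :=
  Csub (Cmul (D z) (B' z)) (Cmul (B z) (D' z)).

Definition holo_legendrian_immersion
  (A B C D A' B' C' D' : Cx -> Cx) : Prop :=
  holo_D1_with A A' /\ holo_D1_with B B' /\
  holo_D1_with C C' /\ holo_D1_with D D' /\
  (forall z, in_D1 z ->
     Csub (Cmul (A z) (D z)) (Cmul (B z) (C z)) = C1) /\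
  (* Legendrian: diagonal entries of L^{-1} dL vanish *)
  (forall z, in_D1 z ->
     Csub (Cmul (D z) (A' z)) (Cmul (B z) (C' z)) = C0) /\
  (forall z, in_D1 z ->
     Csub (Cmul (A z) (D' z)) (Cmul (C z) (B' z)) = C0) /\
  (forall z, in_D1 z ->
     ~ (A' z = C0 /\ B' z = C0 /\ C' z = C0 /\ D' z = C0)).

Definition C1_curve_D1 (x y x' y' : R -> R) : Prop :=
  forall t, 0 <= t < 1 ->
    in_D1 (x t, y t) /\
    derivable_pt_lim x t (x' t) /\ derivable_pt_lim y t (y' t) /\
    continuity_pt x' t /\ continuity_pt y' t.

Definition divergent_curve (x y : R -> R) : Prop :=
  forall r, r < 1 -> exists t0, 0 <= t0 < 1 /\
    forall t, t0 <= t < 1 -> r < Cabs (x t, y t).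

Definition length_density (rho : Cx -> R) (x y x' y' : R -> R) (t : R) : R :=
  rho (x t, y t) * sqrt (x' t * x' t + y' t * y' t).

Definition complete_conformal_metric_D1 (rho : Cx -> R) : Prop :=
  (forall z, in_D1 z -> 0 < rho z) /\
  forall x y x' y' : R -> R,
    C1_curve_D1 x y x' y' -> divergent_curve x y ->
    forall M : R, exists t0, 0 <= t0 < 1 /\
      forall t (pr : Riemann_integrable (length_density rho x y x' y') 0 t),
        t0 <= t < 1 -> M <= RiemannInt pr.

Definition weakly_complete (A B C D A' B' C' D' : Cx -> Cx) : Prop :=
  complete_conformal_metric_D1 (fun z =>
    sqrt (Cnorm2 (omega_of A C A' C' z) + Cnorm2 (theta_of B D B' D' z))).

(* Main.v *)
Require Import Defs.
From Stdlib Require Import Reals Lra Lia ClassicalEpsilon.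
From Coquelicot Require Import Coquelicot.
Open Scope R_scope.
Open Scope C_scope.

(** Away from D = 0 a Legendrian curve in SL(2,C) has the form
      L = [[(1 + b v) e^-w, b e^w], [v e^-w, e^w]]   with   dw = v db,
    so that G_- = b, G_+ = b + 1/v, omega = e^{-2w} (dv - v^2 db),
    theta = e^{2w} db, and by AM-GM the metric dominates sqrt (2 |b' (v' - v^2 b')|),
    which does not involve w.  By left multiplication it suffices to treat the
    half-plane Re > 0.  With beta = Re b and s = 1 + 2 beta v, both Gauss maps lie in
    the half-plane when beta > 0 and |s| > 1; |s| is a function of the hyperbolic
    distance between G_+ and G_-.  The perturbation
      b -= 2 zeta beta conj(s),   v += 2 zeta (gamma s - v^2 beta conj(s)),
    with gamma = Re v + beta |v|^2, changes |s|^2 only to second order in zeta.  Taking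
    zeta = eps_k z^{n_k} with sum eps_k = oo, sum eps_k^2 < oo and n_k growing fast,
    conjugates can be traded for negative powers of z near the unit circle, the perturbation
    becomes polynomial up to a negligible error, and each step makes crossing a thin annulus
    near the circle cost a length of order eps_k, while keeping |s|^2 bounded and away from 1. *)

(** On a circle zeta takes every phase, so |s|^2 must be stationary along the chosen direction times
    any complex number. Where beta > 0 and s is nonzero this is one complex linear equation for (db,
    dv), with a solution unique up to a factor: db = -beta conj(s), dv = Re v + 2 beta |v|^2, the
    latter being [dir2] in another form. Along it dv - v^2 db is gamma s, so the product that bounds
    the metric is governed by beta gamma |s|^2 = |s|^2 (|s|^2 - 1) / 4. This depends on |s| alone: a
    stage may make b, v and their derivatives as large, and beta as small, as it likes without
    spoiling a gain of order eps_k. What does depend on those sizes is absorbed by the frequency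
    n_k, chosen after them. A second obstacle is the immersion condition: (b', v') must not vanish
    anywhere, neither at a stage nor in the limit. Each stage therefore carries a positive lower
    bound of the speed on the closed disc, and tolerances are chosen so small that all later changes
    together cannot exhaust it. *)

(** * Complex derivatives *)

Definition is_cderive (f : C -> C) (z l : C) : Prop :=
  @is_derive C_AbsRing (AbsRing_NormedModule C_AbsRing) f z l.

Lemma is_cderiveP (f : C -> C) (z l : C) :
  is_cderive f z l <->
  forall eps : R, (0 < eps) -> exists delta : R, (0 < delta) /\
    forall h : C, (Cmod h < delta) ->
      (Cmod (f (z + h) - f z - l * h) <= eps * Cmod h).
Proof.
split.
- intros [_ H] eps Heps.
  destruct (H z (fun P HP => HP) (mkposreal eps Heps)) as [d Hd].
  exists d; split; [apply cond_pos|].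
  intros h Hh.
  assert (E : z + h - z = h) by ring.
  specialize (Hd (z + h)).
  unfold ball, minus, plus, opp, scal, norm in Hd; simpl in Hd.
  unfold AbsRing_ball, minus, plus, opp, abs, mult in Hd; simpl in Hd.
  change (Cmod (z + h - z) < d -> Cmod (f (z + h) - f z - (z + h - z) * l)
     <= eps * Cmod (z + h - z)) in Hd.
  rewrite E in Hd. rewrite (Cmult_comm l h). exact (Hd Hh).
- intros H. split; [apply is_linear_scal_l|].
  intros x Hx.
  assert (Ex : z = x).
  { apply (is_filter_lim_locally_unique (V := AbsRing_NormedModule C_AbsRing)).
    exact Hx. }
  subst x.
  intros eps. destruct (H eps (cond_pos eps)) as [d [Hd0 Hd]].
  exists (mkposreal d Hd0). intros y Hy.
  change (Cmod (y - z) < d) in Hy.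
  change (Cmod (f y - f z - (y - z) * l) <= eps * Cmod (y - z)).
  specialize (Hd _ Hy).
  assert (E : z + ((y : C) - z) = y) by (simpl in y; change C in y; ring).
  rewrite E in Hd.
  rewrite (Cmult_comm _ l). exact Hd.
Qed.

Lemma is_cderive_ext (f g : C -> C) (z l : C) :
  (forall u, f u = g u) -> is_cderive f z l -> is_cderive g z l.
Proof. exact (is_derive_ext (V := AbsRing_NormedModule C_AbsRing) f g z l). Qed.

Lemma is_cderive_eq (f : C -> C) (z l m : C) :
  is_cderive f z l -> l = m -> is_cderive f z m.
Proof. now intros H <-. Qed.

Lemma is_cderive_const (c z : C) : is_cderive (fun _ => c) z 0.
Proof. exact (is_derive_const (V := AbsRing_NormedModule C_AbsRing) c z). Qed.

Lemma is_cderive_id (z : C) : is_cderive (fun u => u) z 1.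
Proof. exact (is_derive_id (K := C_AbsRing) z). Qed.

Lemma is_cderive_plus (f g : C -> C) (z l m : C) :
  is_cderive f z l -> is_cderive g z m ->
  is_cderive (fun u => f u + g u) z (l + m).
Proof. exact (is_derive_plus (V := AbsRing_NormedModule C_AbsRing) f g z l m). Qed.

Lemma is_cderive_mult (f g : C -> C) (z l m : C) :
  is_cderive f z l -> is_cderive g z m ->
  is_cderive (fun u => f u * g u) z (l * g z + f z * m).
Proof.
intros Hf Hg.
exact (is_derive_mult (K := C_AbsRing) f g z l m Hf Hg Cmult_comm).
Qed.

Lemma is_cderive_scal (c : C) (f : C -> C) (z l : C) :
  is_cderive f z l -> is_cderive (fun u => c * f u) z (c * l).
Proof.
intros H. eapply is_cderive_eq.
- apply is_cderive_mult; [apply is_cderive_const|exact H].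
- cbv beta; ring.
Qed.

Lemma is_cderive_comp (f g : C -> C) (z l m : C) :
  is_cderive f (g z) l -> is_cderive g z m ->
  is_cderive (fun u => f (g u)) z (m * l).
Proof. exact (is_derive_comp (V := AbsRing_NormedModule C_AbsRing) f g z l m). Qed.

(** * Polynomials with their derivatives *)

(** The derivative is a second index, so it can be bounded by the same lemmas as the function. Both
    are given in the syntactic form of the constructors, hence pointwise equations such as the one
    in [polynomial_pow]. *)
Inductive polynomial : (C -> C) -> (C -> C) -> Prop :=
| polynomial_const (c : C) : polynomial (fun _ => c) (fun _ => 0)
| polynomial_id : polynomial (fun z => z) (fun _ => 1)
| polynomial_plus f f1 g g1 : polynomial f f1 -> polynomial g g1 ->
    polynomial (fun z => f z + g z) (fun z => f1 z + g1 z)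
| polynomial_mult f f1 g g1 : polynomial f f1 -> polynomial g g1 ->
    polynomial (fun z => f z * g z) (fun z => f1 z * g z + f z * g1 z).

Lemma polynomial_is_cderive f f1 : polynomial f f1 -> forall z, is_cderive f z (f1 z).
Proof.
induction 1; intros z.
- apply is_cderive_const.
- apply is_cderive_id.
- now apply is_cderive_plus.
- now apply is_cderive_mult.
Qed.

Lemma polynomial_derive f f1 : polynomial f f1 -> exists f2, polynomial f1 f2.
Proof.
induction 1 as [c| |f f1 g g1 Hf [f2 IHf] Hg [g2 IHg]
               |f f1 g g1 Hf [f2 IHf] Hg [g2 IHg]].
- eexists; apply polynomial_const.
- eexists; apply polynomial_const.
- eexists; apply polynomial_plus; eassumption.
- eexists; apply polynomial_plus; apply polynomial_mult; eassumption.
Qed.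

Lemma polynomial_scal c f f1 : polynomial f f1 ->
  polynomial (fun z => c * f z) (fun z => 0 * f z + c * f1 z).
Proof. intros H; apply (polynomial_mult (fun _ => c) (fun _ => 0)); [constructor|exact H]. Qed.

Lemma polynomial_pow n :
  exists f1, polynomial (fun z => z ^ n) f1 /\ forall z, f1 z = INR n * z ^ pred n.
Proof.
induction n as [|n [f1 [Hf E]]].
- exists (fun _ => 0); split; [apply (polynomial_const 1)|].
  intros z; simpl; ring.
- exists (fun z => 1 * z ^ n + z * f1 z); split.
  + apply (polynomial_mult (fun z => z) (fun _ => 1)); [constructor|exact Hf].
  + intros z. rewrite E, S_INR, RtoC_plus. destruct n; simpl; ring.
Qed.

Definition bounded_disc (f : C -> C) (M : R) : Prop :=
  forall z, (Cmod z <= 1) -> (Cmod (f z) <= M).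

Lemma Cmod_plus_le a b x y :
  (Cmod a <= x -> Cmod b <= y -> Cmod (a + b) <= x + y).
Proof. intros; eapply Rle_trans; [apply Cmod_triangle|lra]. Qed.

Lemma Cmod_minus_le a b x y :
  (Cmod a <= x -> Cmod b <= y -> Cmod (a - b) <= x + y).
Proof. intros; apply Cmod_plus_le; [|rewrite Cmod_opp]; assumption. Qed.

Lemma Cmod_mult_le a b x y :
  (Cmod a <= x -> Cmod b <= y -> Cmod (a * b) <= x * y).
Proof.
intros; rewrite Cmod_mult; apply Rmult_le_compat; auto using Cmod_ge_0.
Qed.

Lemma Cmod_minus_ge a b : (Cmod a - Cmod b <= Cmod (a - b)).
Proof.
assert (H := Cmod_triangle (a - b) b).
replace (a - b + b) with a in H by ring. lra.
Qed.

Lemma Cmod_plus_ge a b : (Cmod a - Cmod b <= Cmod (a + b)).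
Proof.
assert (H := Cmod_minus_ge a (- b)). rewrite Cmod_opp in H.
now replace (a - - b) with (a + b) in H by ring.
Qed.

Lemma bounded_disc_nonneg f M : bounded_disc f M -> (0 <= M).
Proof.
intros H; apply Rle_trans with (Cmod (f 0)); [apply Cmod_ge_0|].
apply H; rewrite Cmod_0; lra.
Qed.

Lemma polynomial_bounded f f1 : polynomial f f1 -> exists M, bounded_disc f M.
Proof.
induction 1 as [c| |f f1 g g1 Hf [M IHf] Hg [N IHg]
               |f f1 g g1 Hf [M IHf] Hg [N IHg]].
- exists (Cmod c); intros z _; lra.
- exists 1%R; now intros z.
- exists (M + N)%R; intros z Hz; apply Cmod_plus_le; auto.
- exists (M * N)%R; intros z Hz; apply Cmod_mult_le; auto.
Qed.

(* The moments [z^m f] are needed for the closure under multiplication by [z]. *)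
Definition moments_integrable (f : C -> C) : Prop :=
  forall m, exists F, forall z, is_cderive F z (z ^ m * f z).

(** Primitives do not pass to products, so the induction runs on multiplication operators: [f] acts
    on every [h] with integrable moments, and a product acts as a composition. *)
Lemma polynomial_mult_moments f f1 : polynomial f f1 ->
  forall h, moments_integrable h -> moments_integrable (fun z => f z * h z).
Proof.
induction 1 as [c| |f f1 g g1 Hf IHf Hg IHg|f f1 g g1 Hf IHf Hg IHg];
  intros h Hh m.
- destruct (Hh m) as [F HF]. exists (fun z => c * F z); intros z.
  eapply is_cderive_eq; [apply is_cderive_scal, HF|ring].
- destruct (Hh (S m)) as [F HF]. exists F; intros z.
  eapply is_cderive_eq; [apply HF|simpl; ring].
- destruct (IHf _ Hh m) as [F HF], (IHg _ Hh m) as [G HG].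
  exists (fun z => F z + G z); intros z.
  eapply is_cderive_eq; [apply is_cderive_plus; [apply HF|apply HG]|ring].
- destruct (IHf _ (IHg _ Hh) m) as [F HF].
  exists F; intros z. eapply is_cderive_eq; [apply HF|ring].
Qed.

Lemma moments_integrable_1 : moments_integrable (fun _ => 1).
Proof.
intros m. exists (fun z => / INR (S m) * z ^ S m); intros z.
destruct (polynomial_pow (S m)) as [g [Hg E]].
eapply is_cderive_eq.
- apply is_cderive_scal, (polynomial_is_cderive _ _ Hg).
- rewrite E; simpl pred. field.
  intros K. apply (not_0_INR (S m)); [discriminate|].
  now apply (f_equal fst) in K.
Qed.

Lemma polynomial_primitive f f1 : polynomial f f1 ->
  exists F : C -> C, F 0 = 0 /\ forall z, is_cderive F z (f z).
Proof.
intros H.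
destruct (polynomial_mult_moments _ _ H _ moments_integrable_1 O) as [F HF].
exists (fun z => F z + - F 0); split; [ring|]; intros z.
eapply is_cderive_eq.
- apply is_cderive_plus; [apply HF|apply is_cderive_const].
- simpl; ring.
Qed.

(** * Mean value inequality and limits *)

Lemma Re_le_Cmod c : (Re c <= Cmod c).
Proof. assert (H := re_le_Cmod c). apply Rabs_le_between in H. lra. Qed.

Lemma Cmod_sqr c : (Cmod c * Cmod c = Re c * Re c + Im c * Im c)%R.
Proof. assert (H := Cmod2_alt c). simpl in H. lra. Qed.

Lemma Re_conj_self c : (Re (Cconj c * c) = Cmod c * Cmod c)%R.
Proof. rewrite Cmod_sqr. destruct c; unfold Re, Im; simpl. ring. Qed.

(* Real mean value theorem applied to t |-> Re (conj u * f (z + t h)), u the increment. *)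
Lemma mean_value_inequality f f1 (rho M : R) z h :
  (forall u, (Cmod u < rho) -> is_cderive f u (f1 u)) ->
  (forall u, (Cmod u < rho) -> (Cmod (f1 u) <= M)) ->
  (Cmod z < rho) -> (Cmod (z + h) < rho) ->
  (Cmod (f (z + h) - f z) <= M * Cmod h).
Proof.
intros Hd HM Hz Hzh.
set (u := f (z + h) - f z).
set (phi := fun t : R => Re (Cconj u * f (z + t * h))).
assert (Hin : forall t, (0 <= t <= 1) -> (Cmod (z + t * h) < rho)).
{ intros t Ht. replace (z + t * h) with ((1 - t)%R * z + t * (z + h)).
  2:{ rewrite RtoC_minus; ring. }
  eapply Rle_lt_trans; [apply Cmod_triangle|].
  rewrite !Cmod_mult, !Cmod_R, !Rabs_right by lra.
  destruct (Req_dec t 0) as [->|]; [lra|].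
  assert ((1 - t) * Cmod z <= (1 - t) * rho) by (apply Rmult_le_compat_l; lra).
  assert (t * Cmod (z + h) < t * rho) by (apply Rmult_lt_compat_l; lra).
  lra. }
assert (Hphi : forall t, (0 <= t <= 1) ->
  derivable_pt_lim phi t (Re (Cconj u * (f1 (z + t * h) * h)))).
{ intros t Ht eps Heps.
  destruct (proj1 (is_cderiveP _ _ _) (Hd _ (Hin t Ht))
    (eps / 2 / (Cmod u * Cmod h + 1))%R) as [d [Hd0 Hdd]].
  { assert (0 <= Cmod u * Cmod h) by (apply Rmult_le_pos; apply Cmod_ge_0).
    apply Rdiv_lt_0_compat; lra. }
  assert (Hp : (0 < d / (Cmod h + 1))).
  { apply Rdiv_lt_0_compat; [lra|]. assert (X := Cmod_ge_0 h); lra. }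
  exists (mkposreal _ Hp). intros k Hk Hkd. simpl in Hkd.
  assert (Hkh : (Cmod (k * h) < d)).
  { rewrite Cmod_mult, Cmod_R.
    assert (X := Cmod_ge_0 h).
    apply Rle_lt_trans with (Rabs k * (Cmod h + 1))%R.
    - apply Rmult_le_compat_l; [apply Rabs_pos|lra].
    - apply Rmult_lt_reg_r with (/ (Cmod h + 1))%R; [apply Rinv_0_lt_compat; lra|].
      rewrite Rmult_assoc, Rinv_r by lra. lra. }
  specialize (Hdd _ Hkh).
  set (w := f (z + t * h + k * h) - f (z + t * h) - f1 (z + t * h) * (k * h)) in Hdd.
  assert (E : ((phi (t + k) - phi t) / k - Re (Cconj u * (f1 (z + t * h) * h))%C
     = Re (Cconj u * w)%C / k)%R).
  { unfold phi. rewrite RtoC_plus.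
    replace (z + (t + k) * h) with (z + t * h + k * h) by ring.
    replace (Cconj u * w) with (Cconj u * f (z + t * h + k * h)
      + - (Cconj u * f (z + t * h)) + - (k * (Cconj u * (f1 (z + t * h) * h))))
      by (unfold w; ring).
    rewrite !re_plus, !re_opp, re_scal_l. now field. }
  rewrite E. unfold Rdiv. rewrite Rabs_mult, Rabs_inv.
  assert (Hk0 : (0 < Rabs k)) by now apply Rabs_pos_lt.
  apply Rmult_lt_reg_r with (Rabs k); [exact Hk0|].
  rewrite Rmult_assoc, Rinv_l, Rmult_1_r by lra.
  eapply Rle_lt_trans; [apply re_le_Cmod|].
  rewrite Cmod_mult, Cmod_conj.
  rewrite Cmod_mult, Cmod_R in Hdd.
  assert (X := Cmod_ge_0 u). assert (Y := Cmod_ge_0 h).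
  eapply Rle_lt_trans; [apply Rmult_le_compat_l; [exact X|exact Hdd]|].
  assert (XY : (0 <= Cmod u * Cmod h)) by now apply Rmult_le_pos.
  replace (Cmod u * (eps / 2 / (Cmod u * Cmod h + 1) * (Rabs k * Cmod h)))%R
    with (eps * Rabs k * ((Cmod u * Cmod h) / (2 * (Cmod u * Cmod h + 1))))%R
    by (field; lra).
  rewrite <- (Rmult_1_r (eps * Rabs k)) at 2.
  apply Rmult_lt_compat_l; [now apply Rmult_lt_0_compat|].
  apply Rmult_lt_reg_r with (2 * (Cmod u * Cmod h + 1))%R; [lra|].
  unfold Rdiv. rewrite Rmult_assoc, Rinv_l by lra. lra. }
destruct (MVT_cor2 phi _ 0 1 Rlt_0_1 Hphi) as [c [Hc Hc01]].
assert (E1 : phi 1%R = Re (Cconj u * f (z + h))).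
{ unfold phi. do 3 f_equal. ring. }
assert (E0 : phi 0%R = Re (Cconj u * f z)).
{ unfold phi. do 3 f_equal. ring. }
assert (E : (Cmod u * Cmod u)%R = Re (Cconj u * (f1 (z + c * h) * h))).
{ rewrite <- Re_conj_self. unfold u at 2.
  replace (Cconj u * (f (z + h) - f z)) with
    (Cconj u * f (z + h) + - (Cconj u * f z)) by ring.
  rewrite re_plus, re_opp, <- E1, <- E0. lra. }
destruct (Rle_lt_or_eq_dec 0 (Cmod u) (Cmod_ge_0 u)) as [Hu|Hu].
- apply Rmult_le_reg_l with (Cmod u); [exact Hu|]. rewrite E.
  eapply Rle_trans; [apply Re_le_Cmod|].
  rewrite !Cmod_mult, Cmod_conj.
  apply Rmult_le_compat_l; [lra|].
  apply Rmult_le_compat_r; [apply Cmod_ge_0|].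
  apply HM, Hin; lra.
- rewrite <- Hu. apply Rmult_le_pos; [|apply Cmod_ge_0].
  eapply Rle_trans; [apply Cmod_ge_0|apply (HM z Hz)].
Qed.

Lemma Cmod_le_Re_Im c : (Cmod c <= Rabs (Re c) + Rabs (Im c))%R.
Proof.
assert (X := Rabs_pos (Re c)). assert (Y := Rabs_pos (Im c)).
rewrite <- (Rabs_right (Rabs (Re c) + Rabs (Im c))) by lra.
rewrite <- (Rabs_right (Cmod c)) by (apply Rle_ge, Cmod_ge_0).
apply Rsqr_le_abs_0. unfold Rsqr. rewrite Cmod_sqr.
assert (A : (Re c * Re c = Rabs (Re c) * Rabs (Re c))%R)
  by (rewrite <- Rabs_mult, Rabs_right; nra).
assert (B : (Im c * Im c = Rabs (Im c) * Rabs (Im c))%R)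
  by (rewrite <- Rabs_mult, Rabs_right; nra).
nra.
Qed.

Lemma Im_le_Cmod c : Rabs (Im c) <= Cmod c.
Proof.
eapply Rle_trans; [apply Rmax_r|apply Rmax_Cmod].
Qed.

Section Limits.

Variables (Rad t : nat -> R).
Hypothesis Rad_mono : forall j, Rad j <= Rad (S j).
Hypothesis Rad_cover : forall r, r < 1 -> exists j, r < Rad j.
Hypothesis t_half : forall j, 0 <= t (S j) <= t j / 2.
Hypothesis t_start : 0 <= t O <= 1.

Lemma Rad_le i j : (i <= j)%nat -> Rad i <= Rad j.
Proof. induction 1; [lra|eapply Rle_trans; eauto]. Qed.

Lemma t_pos j : 0 <= t j.
Proof. destruct j; [lra|apply t_half]. Qed.

Lemma t_small eps : 0 < eps -> exists j0, forall j, (j0 <= j)%nat -> 2 * t j <= eps.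
Proof.
intros He.
assert (H : forall j, t j <= (/ 2) ^ j).
{ induction j; simpl; [lra|]. assert (X := t_half j). lra. }
destruct (pow_lt_1_zero (/ 2) ltac:(rewrite Rabs_right; lra) (eps / 2) ltac:(lra))
  as [j0 Hj].
exists j0. intros j Hjj. specialize (Hj j Hjj). specialize (H j).
rewrite Rabs_right in Hj by (apply Rle_ge, pow_le; lra). lra.
Qed.

Lemma locally_uniform_limit (f : nat -> C -> C) :
  (forall j z, Cmod z <= Rad j -> Cmod (f (S j) z - f j z) <= t j) ->
  exists g : C -> C, forall j z, Cmod z <= Rad j -> Cmod (g z - f j z) <= 2 * t j.
Proof.
intros Hf.
(* The subtracted term makes the induction close: halving gives [t n <= 2 * t n - 2 * t (S n)], so
   the increments telescope. *)
assert (H : forall i j z, Cmod z <= Rad j ->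
  Cmod (f (i + j)%nat z - f j z) <= 2 * t j - 2 * t (i + j)%nat).
{ induction i; intros j z Hz; simpl.
  - replace (f j z - f j z) with (RtoC 0) by ring. rewrite Cmod_0. lra.
  - replace (f (S (i + j)) z - f j z) with
      ((f (S (i + j)) z - f (i + j)%nat z) + (f (i + j)%nat z - f j z)) by ring.
    eapply Rle_trans; [apply Cmod_triangle|].
    specialize (IHi j z Hz).
    assert (X := Hf (i + j)%nat z).
    assert (Y := Rad_le j (i + j) ltac:(lia)).
    assert (Z := t_half (i + j)). specialize (X ltac:(lra)). lra. }
assert (H' : forall i j z, (j <= i)%nat -> Cmod z <= Rad j ->
  Cmod (f i z - f j z) <= 2 * t j).
{ intros i j z Hij Hz. replace i with ((i - j) + j)%nat by lia.
  eapply Rle_trans; [apply H, Hz|].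
  assert (X := t_pos (i - j + j)). lra. }
assert (Hlim : forall (p : C -> R), (forall a b : C, p (a - b) = (p a - p b)%R) ->
  (forall a, Rabs (p a) <= Cmod a) -> forall j z, Cmod z <= Rad j ->
  is_lim_seq (fun n => p (f n z)) (real (Lim_seq (fun n => p (f n z))))).
{ intros p Hp1 Hp2 j z Hz. apply Lim_seq_correct'.
  apply ex_lim_seq_cauchy_corr. intros eps.
  destruct (t_small (eps / 3)) as [j0 Hj0]; [assert (X := cond_pos eps); lra|].
  exists (max j j0). intros n m Hn Hm.
  set (k := max j j0) in *.
  assert (Hk : Cmod z <= Rad k).
  { eapply Rle_trans; [exact Hz|apply Rad_le; lia]. }
  rewrite <- Hp1. eapply Rle_lt_trans; [apply Hp2|].
  replace (f n z - f m z) with ((f n z - f k z) - (f m z - f k z)) by ring.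
  eapply Rle_lt_trans.
  - apply Cmod_minus_le; apply H'; [exact Hn|exact Hk|exact Hm|exact Hk].
  - specialize (Hj0 k ltac:(lia)). assert (X := cond_pos eps). lra. }
(* Outside all the discs of radius [Rad j] the value of [Lim_seq] is arbitrary; nothing is claimed
   there. *)
exists (fun z => (real (Lim_seq (fun n => Re (f n z))), real (Lim_seq (fun n => Im (f n z))))).
intros j z Hz.
assert (L1 := Hlim Re ltac:(intros [] []; reflexivity) re_le_Cmod j z Hz).
assert (L2 := Hlim Im ltac:(intros [] []; reflexivity) Im_le_Cmod j z Hz).
set (g := (_, _) : C).
apply Rnot_lt_le; intros Hlt.
set (e := (Cmod (g - f j z) - 2 * t j)%R).
assert (He : (0 < e / 3)%R) by (unfold e; lra).
apply is_lim_seq_spec in L1. apply is_lim_seq_spec in L2.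
destruct (L1 (mkposreal _ He)) as [n1 Hn1]. destruct (L2 (mkposreal _ He)) as [n2 Hn2].
simpl in Hn1, Hn2.
set (n := max j (max n1 n2)).
specialize (Hn1 n ltac:(lia)). specialize (Hn2 n ltac:(lia)).
assert (X := H' n j z ltac:(lia) Hz).
assert (Y : Cmod (f n z - g) <= Rabs (Re (f n z) - Re g)%R + Rabs (Im (f n z) - Im g)%R)
  by apply Cmod_le_Re_Im.
simpl in Y.
assert (Z : Cmod (g - f j z) <= Cmod (f n z - g) + Cmod (f n z - f j z)).
{ rewrite <- (Cmod_opp (f n z - g)).
  replace (g - f j z) with (- (f n z - g) + (f n z - f j z)) by ring.
  apply Cmod_triangle. }
unfold e in *. lra.
Qed.

(** Termwise differentiation without Cauchy's formula: the mean value inequality bounds the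
    increments of [f i - f j] by the distance of the derivatives, and the bound passes to [g - f j]
    as i tends to infinity with j fixed. *)
Lemma is_cderive_limit (f f1 : nat -> C -> C) (g g1 : C -> C) :
  (forall j z, is_cderive (f j) z (f1 j z)) ->
  (forall j z, Cmod z <= Rad j -> Cmod (g z - f j z) <= 2 * t j) ->
  (forall j z, Cmod z <= Rad j -> Cmod (g1 z - f1 j z) <= 2 * t j) ->
  forall z, Cmod z < 1 -> is_cderive g z (g1 z).
Proof.
intros Hd Hg Hg1 z Hz. apply is_cderiveP. intros eps He.
destruct (Rad_cover _ Hz) as [j1 Hj1].
destruct (t_small (eps / 4)) as [j0 Hj0]; [lra|].
set (j := max j0 j1).
assert (Hr : Cmod z < Rad j).
{ eapply Rlt_le_trans; [exact Hj1|apply Rad_le; lia]. }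
assert (Ht := Hj0 j ltac:(lia)).
destruct (proj1 (is_cderiveP _ _ _) (Hd j z) (eps / 4)%R ltac:(lra)) as [d [Hd0 Hdd]].
exists (Rmin d (Rad j - Cmod z)). split; [apply Rmin_glb_lt; lra|].
intros h Hh.
assert (Hhd : Cmod h < d) by (eapply Rlt_le_trans; [exact Hh|apply Rmin_l]).
assert (Hhr : Cmod h < Rad j - Cmod z) by (eapply Rlt_le_trans; [exact Hh|apply Rmin_r]).
assert (Hzh : Cmod (z + h) < Rad j) by (assert (X := Cmod_triangle z h); lra).
specialize (Hdd h Hhd).
assert (Key : Cmod ((g (z + h) - f j (z + h)) - (g z - f j z)) <= eps / 2 * Cmod h).
{ apply Rnot_lt_le; intros Hlt.
  set (e := (Cmod (g (z + h) - f j (z + h) - (g z - f j z))%C - eps / 2 * Cmod h)%R).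
  destruct (t_small (e / 3)) as [i0 Hi0]; [unfold e; lra|].
  set (i := max i0 j). specialize (Hi0 i ltac:(lia)).
  assert (Hri : Rad j <= Rad i) by (apply Rad_le; lia).
  assert (M : Cmod ((f i (z + h) + - f j (z + h)) - (f i z + - f j z)) <= eps / 2 * Cmod h).
  { apply (mean_value_inequality (fun u => f i u + - f j u)
      (fun u => f1 i u + - (1) * f1 j u) (Rad j)); [| |lra|lra].
    - intros u _. apply is_cderive_plus; [apply Hd|].
      apply is_cderive_ext with (fun u => - (1) * f j u); [intros; ring|].
      apply is_cderive_scal, Hd.
    - intros u Hu.
      replace (f1 i u + - (1) * f1 j u) with ((g1 u - f1 j u) - (g1 u - f1 i u)) by ring.
      eapply Rle_trans.
      + apply Cmod_minus_le; apply Hg1; lra.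
      + specialize (Hj0 i ltac:(lia)). lra. }
  assert (A := Hg i (z + h) ltac:(lra)). assert (B := Hg i z ltac:(lra)).
  assert (X : Cmod (g (z + h) - f j (z + h) - (g z - f j z)) <=
    Cmod (f i (z + h) + - f j (z + h) - (f i z + - f j z)) + (2 * t i + 2 * t i)).
  { replace (g (z + h) - f j (z + h) - (g z - f j z)) with
      ((f i (z + h) + - f j (z + h) - (f i z + - f j z)) +
       ((g (z + h) - f i (z + h)) - (g z - f i z))) by ring.
    apply Cmod_plus_le; [lra|]. now apply Cmod_minus_le. }
  unfold e in *. lra. }
replace (g (z + h) - g z - g1 z * h) with
  ((g (z + h) - f j (z + h) - (g z - f j z)) +
   ((f j (z + h) - f j z - f1 j z * h) - (g1 z - f1 j z) * h)) by ring.
eapply Rle_trans.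
- apply Cmod_plus_le; [exact Key|apply Cmod_minus_le; [exact Hdd|]].
  apply Cmod_mult_le; [apply Hg1; lra|apply Rle_refl].
- assert (X := Cmod_ge_0 h). nra.
Qed.

End Limits.

(** * The complex exponential *)

Definition cexp (z : C) : C := (exp (Re z) * cos (Im z), exp (Re z) * sin (Im z))%R.

Lemma cexp_plus z w : cexp (z + w) = cexp z * cexp w.
Proof.
destruct z as [x y], w as [x' y']. unfold cexp, Re, Im, Cplus, Cmult; simpl.
rewrite exp_plus, cos_plus, sin_plus. f_equal; ring.
Qed.

Lemma cexp_0 : cexp 0 = 1.
Proof.
unfold cexp; simpl. rewrite exp_0, cos_0, sin_0.
unfold RtoC. f_equal; ring.
Qed.

Lemma cexp_opp_l z : cexp (- z) * cexp z = 1.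
Proof.
rewrite <- cexp_plus. replace (- z + z) with (RtoC 0) by ring. apply cexp_0.
Qed.

Lemma derive_at_0_bound (f : R -> R) (l e : R) : derivable_pt_lim f 0 l -> 0 < e ->
  exists d, 0 < d /\ forall x, Rabs x < d -> Rabs (f x - f 0%R - l * x)%R <= e * Rabs x.
Proof.
intros H He. destruct (H e He) as [d Hd]. exists d; split; [apply cond_pos|].
intros x Hx. destruct (Req_dec x 0) as [->|Hx0].
- rewrite Rabs_R0. replace (f 0 - f 0 - l * 0)%R with 0%R by ring. rewrite Rabs_R0. lra.
- specialize (Hd x Hx0 Hx). rewrite Rplus_0_l in Hd.
  replace (f x - f 0 - l * x)%R with (((f x - f 0) / x - l) * x)%R by now field.
  rewrite Rabs_mult. apply Rmult_le_compat_r; [apply Rabs_pos|lra].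
Qed.

Lemma is_cderive_cexp_0 : is_cderive cexp 0 1.
Proof.
apply is_cderiveP. intros eps Heps.
(* Nine: with m the modulus of h, the real part of the error is at most 4 e m and the imaginary part
   at most 5 e m. *)
set (e := Rmin (eps / 9) 1).
assert (He : 0 < e) by (apply Rmin_glb_lt; lra).
assert (He1 : e <= eps / 9) by apply Rmin_l.
assert (He2 : e <= 1) by apply Rmin_r.
destruct (derive_at_0_bound exp _ e (derivable_pt_lim_exp 0) He) as [d1 [Hd1 H1]].
destruct (derive_at_0_bound cos _ e (derivable_pt_lim_cos 0) He) as [d2 [Hd2 H2]].
destruct (derive_at_0_bound sin _ e (derivable_pt_lim_sin 0) He) as [d3 [Hd3 H3]].
rewrite exp_0 in H1. rewrite sin_0, cos_0 in H2. rewrite sin_0, cos_0 in H3.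
exists (Rmin (Rmin d1 d2) (Rmin d3 e)).
split; [repeat apply Rmin_glb_lt; lra|].
intros h Hh.
assert (Cmod h < d1 /\ Cmod h < d2 /\ Cmod h < d3 /\ Cmod h < e) as [A1 [A2 [A3 A4]]].
{ repeat split; eapply Rlt_le_trans; try exact Hh.
  - eapply Rle_trans; apply Rmin_l.
  - eapply Rle_trans; [apply Rmin_l|apply Rmin_r].
  - eapply Rle_trans; [apply Rmin_r|apply Rmin_l].
  - eapply Rle_trans; apply Rmin_r. }
replace (0 + h) with h by ring. rewrite cexp_0.
destruct h as [x y].
assert (Bx := re_le_Cmod (x, y)). assert (By := Im_le_Cmod (x, y)).
simpl in Bx, By. set (m := Cmod (x, y)) in *.
specialize (H1 x ltac:(lra)). specialize (H2 y ltac:(lra)). specialize (H3 y ltac:(lra)).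
eapply Rle_trans; [apply Cmod_le_Re_Im|]. simpl.
replace (exp x * cos y + - (1) + - (1 * x - 0 * y))%R with
  (exp x * (cos y - 1 - - 0 * y) + (exp x - 1 - 1 * x))%R by ring.
replace (exp x * sin y + - 0 + - (1 * y + 0 * x))%R with
  (exp x * (sin y - 0 - 1 * y) + (exp x - 1) * y)%R by ring.
assert (E1 : Rabs (exp x - 1)%R <= 2 * m).
{ replace (exp x - 1)%R with ((exp x - 1 - 1 * x) + x)%R by ring.
  eapply Rle_trans; [apply Rabs_triang|].
  assert (e * Rabs x <= 1 * Rabs x) by (apply Rmult_le_compat_r; [apply Rabs_pos|lra]).
  lra. }
assert (E2 : Rabs (exp x) <= 3).
{ replace (exp x) with ((exp x - 1) + 1)%R by ring.
  eapply Rle_trans; [apply Rabs_triang|]. rewrite Rabs_R1. lra. }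
assert (Hm : 0 <= m) by apply Cmod_ge_0.
assert (F1 : e * Rabs x <= e * m) by (apply Rmult_le_compat_l; lra).
assert (F2 : e * Rabs y <= e * m) by (apply Rmult_le_compat_l; lra).
assert (G1 : Rabs (exp x * (cos y - 1 - - 0 * y))%R <= 3 * (e * m)).
{ rewrite Rabs_mult. apply Rmult_le_compat; try apply Rabs_pos; lra. }
assert (G2 : Rabs (exp x * (sin y - 0 - 1 * y))%R <= 3 * (e * m)).
{ rewrite Rabs_mult. apply Rmult_le_compat; try apply Rabs_pos; lra. }
assert (G3 : Rabs ((exp x - 1) * y)%R <= 2 * m * m).
{ rewrite Rabs_mult. apply Rmult_le_compat; try apply Rabs_pos; lra. }
assert (G4 : m * m <= e * m) by (apply Rmult_le_compat_r; lra).
assert (G5 : e * m <= eps / 9 * m) by (apply Rmult_le_compat_r; lra).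
assert (T1 := Rabs_triang (exp x * (cos y - 1 - - 0 * y)) (exp x - 1 - 1 * x)).
assert (T2 := Rabs_triang (exp x * (sin y - 0 - 1 * y)) ((exp x - 1) * y)).
lra.
Qed.

Lemma is_cderive_cexp z : is_cderive cexp z (cexp z).
Proof.
apply is_cderive_ext with (fun u => cexp z * cexp (u + - z)).
{ intros u. rewrite <- cexp_plus. f_equal; ring. }
eapply is_cderive_eq.
- apply is_cderive_scal, (is_cderive_comp cexp (fun u => u + - z)).
  + replace (z + - z) with (RtoC 0) by ring. apply is_cderive_cexp_0.
  + apply is_cderive_plus; [apply is_cderive_id|apply is_cderive_const].
- ring.
Qed.

(** * Approximating high-frequency multiples of functions of z and conj z *)

(* On the unit circle z^n * conj z = z^(n-1), and inside the disc the
   discrepancy lives at distance about 1/n from the circle; so z^n F is close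
   to a polynomial in C^1 sense for every polynomial F in z and conj z. *)
Definition osc_approx (F : C -> C) (K : R) (N : nat) : Prop :=
  forall n, exists Q Q1, polynomial Q Q1 /\ forall z, Cmod z <= 1 ->
    Cmod (Q z - z ^ (n + N + 1) * F z) <= K * (1 - Cmod z) * Cmod z ^ n /\
    Cmod (Q1 z - INR n * z ^ (n + N) * F z)
      <= K * Cmod z ^ n * (1 + INR n * (1 - Cmod z)).

Definition approximable (F : C -> C) : Prop :=
  (exists M, bounded_disc F M) /\ exists K N, 0 <= K /\ osc_approx F K N.

Lemma pow_range r n : 0 <= r <= 1 -> 0 <= r ^ n <= 1.
Proof.
intros H; split; [apply pow_le; lra|].
rewrite <- (pow1 n); apply pow_incr; lra.
Qed.

Lemma Cmod_pow_le z m n : Cmod z <= 1 -> (n <= m)%nat -> Cmod (z ^ m) <= Cmod z ^ n.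
Proof.
intros Hz Hmn. rewrite Cmod_pow. replace m with (n + (m - n))%nat by lia.
rewrite pow_add. assert (H := pow_range (Cmod z) n (conj (Cmod_ge_0 z) Hz)).
assert (H' := pow_range (Cmod z) (m - n) (conj (Cmod_ge_0 z) Hz)).
rewrite <- (Rmult_1_r (Cmod z ^ n)) at 2. apply Rmult_le_compat_l; lra.
Qed.

Lemma Rpow_le_pow r m n : 0 <= r <= 1 -> (n <= m)%nat -> r ^ m <= r ^ n.
Proof.
intros Hr Hmn. replace m with (n + (m - n))%nat by lia. rewrite pow_add.
assert (H := pow_range r n Hr). assert (H' := pow_range r (m - n) Hr).
rewrite <- (Rmult_1_r (r ^ n)) at 2. apply Rmult_le_compat_l; lra.
Qed.

Lemma Cmod_INR n : Cmod (INR n) = INR n.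
Proof. rewrite Cmod_R, Rabs_right; [easy|]. apply Rle_ge, pos_INR. Qed.

(** Two functions come with different offsets N, and this brings them to a common one. The witness
    at n + d is reused at n; replacing the coefficient n + d by n in the derivative costs the term
    [INR d * M]. *)
Lemma osc_approx_weaken F M K N d : bounded_disc F M -> 0 <= K ->
  osc_approx F K N -> osc_approx F (K * (1 + INR d) + INR d * M) (N + d).
Proof.
intros HM HK H n. destruct (H (n + d)%nat) as [Q [Q1 [HQ E]]].
assert (HM0 := bounded_disc_nonneg _ _ HM).
exists Q, Q1; split; [exact HQ|]. intros z Hz.
destruct (E z Hz) as [E1 E2]. specialize (HM z Hz).
replace (n + d + N + 1)%nat with (n + (N + d) + 1)%nat in E1 by lia.
replace (n + d + N)%nat with (n + (N + d))%nat in E2 by lia.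
set (r := Cmod z) in *. assert (Hr : 0 <= r) by apply Cmod_ge_0.
assert (Hp := pow_range r n ltac:(lra)).
assert (Hp' : r ^ (n + d) <= r ^ n) by (apply Rpow_le_pow; [lra|lia]).
assert (Hp0 := pow_range r (n + d) ltac:(lra)).
assert (Hd := pos_INR d). assert (Hn := pos_INR n).
split.
- eapply Rle_trans; [exact E1|].
  apply Rmult_le_compat; [apply Rmult_le_pos; lra|lra| |exact Hp'].
  apply Rmult_le_compat_r; [lra|nra].
- rewrite plus_INR, RtoC_plus in E2.
  replace (Q1 z - INR n * z ^ (n + (N + d)) * F z) with
    ((Q1 z - (INR n + INR d) * z ^ (n + (N + d)) * F z) +
     INR d * (z ^ (n + (N + d)) * F z)) by ring.
  eapply Rle_trans.
  + apply Cmod_plus_le; [exact E2|].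
    apply Cmod_mult_le; [rewrite Cmod_INR; apply Rle_refl|].
    apply Cmod_mult_le; [apply Cmod_pow_le with (n := n); [exact Hz|lia]|exact HM].
  + fold r.
    assert (A : K * r ^ (n + d) * (1 + (INR n + INR d) * (1 - r)) <=
                K * r ^ n * ((1 + INR d) * (1 + INR n * (1 - r)))).
    { apply Rmult_le_compat.
      - apply Rmult_le_pos; lra.
      - assert (0 <= (INR n + INR d) * (1 - r)) by (apply Rmult_le_pos; lra). lra.
      - apply Rmult_le_compat_l; lra.
      - assert (0 <= INR n * (1 - r)) by (apply Rmult_le_pos; lra). nra. }
    assert (B : INR d * (r ^ n * M) <= INR d * M * r ^ n * (1 + INR n * (1 - r))).
    { assert (0 <= INR n * (1 - r)) by (apply Rmult_le_pos; lra).
      assert (0 <= INR d * M * r ^ n) by (repeat apply Rmult_le_pos; lra). nra. }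
    nra.
Qed.

Lemma approximable_ext F G : (forall z, F z = G z) -> approximable F -> approximable G.
Proof.
intros E [[M HM] [K [N [HK H]]]]. split.
- exists M; intros z Hz; rewrite <- E; auto.
- exists K, N; split; [exact HK|]. intros n. destruct (H n) as [Q [Q1 [HQ X]]].
  exists Q, Q1; split; [exact HQ|]. intros z; rewrite <- E; apply X.
Qed.

Lemma approximable_1 : approximable (fun _ => 1).
Proof.
split.
- exists 1%R; intros z _; rewrite Cmod_1; lra.
- exists 1%R, O; split; [lra|]. intros n.
  destruct (polynomial_pow (n + 0 + 1)) as [f1 [Hf E]].
  exists (fun z => z ^ (n + 0 + 1)), f1; split; [exact Hf|]. intros z Hz.
  assert (Hp := pow_range (Cmod z) n (conj (Cmod_ge_0 z) Hz)).
  assert (H0 : 0 <= INR n * (1 - Cmod z)) by (apply Rmult_le_pos; [apply pos_INR|lra]).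
  split.
  + replace (z ^ (n + 0 + 1) - z ^ (n + 0 + 1) * 1) with (RtoC 0) by ring.
    rewrite Cmod_0. apply Rmult_le_pos; lra.
  + rewrite E. replace (pred (n + 0 + 1)) with n by lia.
    replace (n + 0)%nat with n by lia.
    rewrite plus_INR, RtoC_plus; simpl (INR 1).
    replace ((INR n + 1) * z ^ n - INR n * z ^ n * 1) with (z ^ n) by ring.
    rewrite Cmod_pow. nra.
Qed.

(** Approximants of two functions cannot simply be multiplied, since each carries its own power z^n.
    Closure under products is obtained instead from functions that may be multiplied onto any
    approximable one. *)
Definition multiplier (G : C -> C) : Prop :=
  forall F, approximable F -> approximable (fun z => G z * F z).

Lemma multiplier_approximable G : multiplier G -> approximable G.
Proof.
intros H. apply approximable_ext with (fun z => G z * 1); [intros; ring|].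
apply H, approximable_1.
Qed.

Lemma multiplier_mult G H : multiplier G -> multiplier H ->
  multiplier (fun z => G z * H z).
Proof.
intros HG HH F HF.
apply approximable_ext with (fun z => G z * (H z * F z)); [intros; ring|auto].
Qed.

Lemma multiplier_plus G H : multiplier G -> multiplier H ->
  multiplier (fun z => G z + H z).
Proof.
intros HG HH F HF.
destruct (HG F HF) as [[M1 HM1] [K1 [N1 [HK1 A1]]]].
destruct (HH F HF) as [[M2 HM2] [K2 [N2 [HK2 A2]]]].
split.
- exists (M1 + M2)%R; intros z Hz.
  replace ((G z + H z) * F z) with (G z * F z + H z * F z) by ring.
  apply Cmod_plus_le; auto.
- assert (B1 := osc_approx_weaken _ _ _ _ N2 HM1 HK1 A1).
  assert (B2 := osc_approx_weaken _ _ _ _ N1 HM2 HK2 A2).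
  rewrite (Nat.add_comm N2) in B2.
  assert (P1 := bounded_disc_nonneg _ _ HM1). assert (P2 := bounded_disc_nonneg _ _ HM2).
  assert (I1 := pos_INR N1). assert (I2 := pos_INR N2).
  set (L1 := (K1 * (1 + INR N2) + INR N2 * M1)%R) in *.
  set (L2 := (K2 * (1 + INR N1) + INR N1 * M2)%R) in *.
  exists (L1 + L2)%R, (N1 + N2)%nat. split; [unfold L1, L2; nra|]. intros n.
  destruct (B1 n) as [Q [Q1 [HQ X]]]. destruct (B2 n) as [Q' [Q1' [HQ' X']]].
  exists (fun z => Q z + Q' z), (fun z => Q1 z + Q1' z).
  split; [now apply polynomial_plus|]. intros z Hz.
  destruct (X z Hz) as [Y1 Y2]. destruct (X' z Hz) as [Y1' Y2']. split.
  + replace (Q z + Q' z - z ^ (n + (N1 + N2) + 1) * ((G z + H z) * F z)) with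
      ((Q z - z ^ (n + (N1 + N2) + 1) * (G z * F z)) +
       (Q' z - z ^ (n + (N1 + N2) + 1) * (H z * F z))) by ring.
    eapply Rle_trans; [apply Cmod_plus_le; [exact Y1|exact Y1']|]. lra.
  + replace (Q1 z + Q1' z - INR n * z ^ (n + (N1 + N2)) * ((G z + H z) * F z)) with
      ((Q1 z - INR n * z ^ (n + (N1 + N2)) * (G z * F z)) +
       (Q1' z - INR n * z ^ (n + (N1 + N2)) * (H z * F z))) by ring.
    eapply Rle_trans; [apply Cmod_plus_le; [exact Y2|exact Y2']|]. lra.
Qed.

(** The product rule adds [Q * p1], which has no factor n and is absorbed in the error term of order
    |z|^n. *)
Lemma multiplier_poly p p1 : polynomial p p1 -> multiplier p.
Proof.
intros Hp F [[M HM] [K [N [HK H]]]].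
destruct (polynomial_bounded _ _ Hp) as [A HA].
destruct (polynomial_derive _ _ Hp) as [p2 Hp2].
destruct (polynomial_bounded _ _ Hp2) as [A1 HA1].
assert (PM := bounded_disc_nonneg _ _ HM). assert (PA := bounded_disc_nonneg _ _ HA).
assert (PA1 := bounded_disc_nonneg _ _ HA1).
split.
- exists (A * M)%R; intros z Hz; apply Cmod_mult_le; auto.
- exists (K * A + (K + M) * A1)%R, N; split; [nra|]. intros n.
  destruct (H n) as [Q [Q1 [HQ X]]].
  exists (fun z => Q z * p z), (fun z => Q1 z * p z + Q z * p1 z).
  split; [now apply polynomial_mult|]. intros z Hz. destruct (X z Hz) as [Y1 Y2].
  specialize (HM z Hz). specialize (HA z Hz). specialize (HA1 z Hz).
  set (r := Cmod z) in *. assert (Hr : 0 <= r) by apply Cmod_ge_0.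
  assert (Hpw := pow_range r n ltac:(lra)).
  assert (Hn0 : 0 <= INR n * (1 - r)) by (apply Rmult_le_pos; [apply pos_INR|lra]).
  split.
  + replace (Q z * p z - z ^ (n + N + 1) * (p z * F z)) with
      ((Q z - z ^ (n + N + 1) * F z) * p z) by ring.
    eapply Rle_trans; [apply Cmod_mult_le; [exact Y1|exact HA]|].
    assert (0 <= (1 - r) * r ^ n) by (apply Rmult_le_pos; lra).
    assert (0 <= (K + M) * A1) by nra. nra.
  + replace (Q1 z * p z + Q z * p1 z - INR n * z ^ (n + N) * (p z * F z)) with
      ((Q1 z - INR n * z ^ (n + N) * F z) * p z +
       ((Q z - z ^ (n + N + 1) * F z) + z ^ (n + N + 1) * F z) * p1 z) by ring.
    eapply Rle_trans.
    * apply Cmod_plus_le; [apply Cmod_mult_le; [exact Y2|exact HA]|].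
      apply Cmod_mult_le; [|exact HA1].
      apply Cmod_plus_le; [exact Y1|].
      apply Cmod_mult_le; [apply Cmod_pow_le with (n := n); [exact Hz|lia]|exact HM].
    * fold r.
      assert (E : (K * (1 - r) * r ^ n + r ^ n * M) * A1
        <= (K + M) * A1 * (r ^ n * (1 + INR n * (1 - r)))).
      { assert (K * (1 - r) * r ^ n + r ^ n * M <= (K + M) * r ^ n).
        { assert (0 <= K * r ^ n) by nra. nra. }
        assert (0 <= (K + M) * r ^ n) by (apply Rmult_le_pos; lra).
        assert ((K + M) * r ^ n <= (K + M) * r ^ n * (1 + INR n * (1 - r))) by nra.
        nra. }
      lra.
Qed.

Lemma multiplier_const c : multiplier (fun _ => c).
Proof. apply multiplier_poly with (fun _ => 0); constructor. Qed.

(** The same polynomial serves with the offset increased by one, because z conj(z) = |z|^2 and 1 -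
    |z|^2 <= 2 (1 - |z|). *)
Lemma multiplier_conj_id : multiplier Cconj.
Proof.
intros F [[M HM] [K [N [HK H]]]].
assert (PM := bounded_disc_nonneg _ _ HM).
split.
- exists (1 * M)%R; intros z Hz; apply Cmod_mult_le; auto; now rewrite Cmod_conj.
- exists (K + 2 * M)%R, (S N); split; [lra|]. intros n.
  destruct (H n) as [Q [Q1 [HQ X]]]. exists Q, Q1; split; [exact HQ|].
  intros z Hz. destruct (X z Hz) as [Y1 Y2]. specialize (HM z Hz).
  replace (n + S N + 1)%nat with (S (n + N + 1)) by lia.
  replace (n + S N)%nat with (S (n + N)) by lia.
  assert (E : z * Cconj z = (Cmod z ^ 2)%R) by now rewrite Cmod2_conj.
  assert (D : Cmod (1 - (Cmod z ^ 2)%R) <= 2 * (1 - Cmod z)).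
  { rewrite <- RtoC_minus, Cmod_R. assert (X0 := Cmod_ge_0 z).
    rewrite Rabs_right by nra. nra. }
  set (r := Cmod z) in *. assert (Hr : 0 <= r) by apply Cmod_ge_0.
  assert (Hpw := pow_range r n ltac:(lra)).
  split.
  + replace (Q z - z ^ S (n + N + 1) * (Cconj z * F z)) with
      ((Q z - z ^ (n + N + 1) * F z) + z ^ (n + N + 1) * ((1 - (r ^ 2)%R) * F z))
      by (rewrite <- E; simpl; ring).
    eapply Rle_trans.
    * apply Cmod_plus_le; [exact Y1|].
      apply Cmod_mult_le; [apply Cmod_pow_le with (n := n); [exact Hz|lia]|].
      apply Cmod_mult_le; [exact D|exact HM].
    * fold r. lra.
  + replace (Q1 z - INR n * z ^ S (n + N) * (Cconj z * F z)) with
      ((Q1 z - INR n * z ^ (n + N) * F z) +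
        INR n * (z ^ (n + N) * ((1 - (r ^ 2)%R) * F z)))
      by (rewrite <- E; simpl; ring).
    eapply Rle_trans.
    * apply Cmod_plus_le; [exact Y2|].
      apply Cmod_mult_le; [rewrite Cmod_INR; apply Rle_refl|].
      apply Cmod_mult_le; [apply Cmod_pow_le with (n := n); [exact Hz|lia]|].
      apply Cmod_mult_le; [exact D|exact HM].
    * fold r. assert (0 <= M * r ^ n) by nra. nra.
Qed.

Lemma multiplier_ext F G : (forall z, F z = G z) -> multiplier F -> multiplier G.
Proof.
intros E H A HA. apply approximable_ext with (fun z => F z * A z); [|auto].
intros; now rewrite E.
Qed.

Lemma multiplier_conj_poly p p1 : polynomial p p1 -> multiplier (fun z => Cconj (p z)).
Proof.
induction 1 as [c| |f f1 g g1 Hf IHf Hg IHg|f f1 g g1 Hf IHf Hg IHg].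
- apply multiplier_const.
- apply multiplier_conj_id.
- eapply multiplier_ext; [|apply (multiplier_plus _ _ IHf IHg)].
  intros; now rewrite Cplus_conj.
- eapply multiplier_ext; [|apply (multiplier_mult _ _ IHf IHg)].
  intros; now rewrite Cmult_conj.
Qed.

(** (1 - r) times the sum of r^i over i < m is 1 - r^m, and each of these m powers is at least
    r^m. *)
Lemma INR_one_minus_pow r m : 0 <= r <= 1 -> INR m * (1 - r) * r ^ m <= 1.
Proof.
intros Hr. assert (H : INR m * (1 - r) * r ^ m <= 1 - r ^ m).
{ induction m as [|m IH].
  - simpl; lra.
  - rewrite S_INR. change (r ^ S m)%R with (r * r ^ m)%R.
    assert (Hp := pow_range r m Hr). set (x := (r ^ m)%R) in *. clearbody x.
    assert (r * (INR m * (1 - r) * x) <= r * (1 - x))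
      by (apply Rmult_le_compat_l; lra).
    assert (r * x <= 1) by nra.
    assert ((1 - r) * (r * x) <= (1 - r) * 1) by (apply Rmult_le_compat_l; lra).
    lra. }
assert (Hp := pow_range r m Hr). lra.
Qed.

(** The frequency is 2m because |z|^(2m) is spent in two halves: one factor |z|^m beats m (1 - |z|),
    the other remains as decay inside the disc. Errors are then O(1/m) for the values, uniformly,
    and O(|z|^m) for the derivatives, with one exponent for both functions. *)
Lemma osc_approx_pair F G : approximable F -> approximable G ->
  exists K N, 0 <= K /\ forall m, (1 <= m)%nat ->
  exists Q Q1 P P1, polynomial Q Q1 /\ polynomial P P1 /\ forall z, Cmod z <= 1 ->
    Cmod (Q z - z ^ (2 * m + N + 1) * F z) <= K / INR m /\
    Cmod (P z - z ^ (2 * m + N + 1) * G z) <= K / INR m /\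
    Cmod (Q1 z - INR (2 * m) * z ^ (2 * m + N) * F z) <= K * Cmod z ^ m /\
    Cmod (P1 z - INR (2 * m) * z ^ (2 * m + N) * G z) <= K * Cmod z ^ m.
Proof.
intros [[M1 HM1] [K1 [N1 [HK1 A1]]]] [[M2 HM2] [K2 [N2 [HK2 A2]]]].
assert (B1 := osc_approx_weaken _ _ _ _ N2 HM1 HK1 A1).
assert (B2 := osc_approx_weaken _ _ _ _ N1 HM2 HK2 A2).
rewrite (Nat.add_comm N2) in B2.
assert (P1 := bounded_disc_nonneg _ _ HM1). assert (P2 := bounded_disc_nonneg _ _ HM2).
assert (I1 := pos_INR N1). assert (I2 := pos_INR N2).
set (L1 := (K1 * (1 + INR N2) + INR N2 * M1)%R) in *.
set (L2 := (K2 * (1 + INR N1) + INR N1 * M2)%R) in *.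
assert (PL1 : 0 <= L1) by (unfold L1; nra).
assert (PL2 : 0 <= L2) by (unfold L2; nra).
set (N := (N1 + N2)%nat) in *.
assert (Key : forall m r, (1 <= m)%nat -> 0 <= r <= 1 -> forall L, 0 <= L ->
  L * (1 - r) * r ^ (2 * m) <= L / INR m /\
  L * r ^ (2 * m) * (1 + INR (2 * m) * (1 - r)) <= 3 * L * r ^ m).
{ intros m r Hm Hr L HL.
  assert (Hmm : 1 <= INR m) by now apply (le_INR 1).
  replace (2 * m)%nat with (m + m)%nat by lia. rewrite pow_add, plus_INR.
  assert (Hp := pow_range r m Hr). assert (X := INR_one_minus_pow r m Hr). split.
  - apply Rmult_le_reg_r with (INR m); [lra|].
    unfold Rdiv. rewrite Rmult_assoc, (Rmult_assoc L (/ _)), Rinv_l by lra.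
    assert (Y : INR m * (1 - r) * r ^ m * r ^ m <= 1 * 1).
    { apply Rmult_le_compat; try lra. repeat apply Rmult_le_pos; lra. }
    assert (L * (INR m * (1 - r) * r ^ m * r ^ m) <= L * (1 * 1))
      by (apply Rmult_le_compat_l; lra).
    lra.
  - assert (Y : r ^ m * (1 + (INR m + INR m) * (1 - r)) <= 3) by nra.
    assert (0 <= L * r ^ m) by (apply Rmult_le_pos; lra).
    replace (L * (r ^ m * r ^ m) * (1 + (INR m + INR m) * (1 - r)))%R with
      (L * r ^ m * (r ^ m * (1 + (INR m + INR m) * (1 - r))))%R by ring.
    nra. }
exists (3 * (L1 + L2))%R, N. split; [lra|]. intros m Hm.
destruct (B1 (2 * m)%nat) as [Q [Q1 [HQ X]]].
destruct (B2 (2 * m)%nat) as [P [P1' [HP Y]]].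
exists Q, Q1, P, P1'. repeat (split; [assumption|]). intros z Hz.
assert (Hr := conj (Cmod_ge_0 z) Hz).
destruct (X z Hz) as [X1 X2]. destruct (Y z Hz) as [Y1 Y2].
assert (Hmm : 1 <= INR m) by now apply (le_INR 1).
assert (Hi : 0 < / INR m) by (apply Rinv_0_lt_compat; lra).
assert (Hp := pow_range (Cmod z) m Hr).
destruct (Key m _ Hm Hr L1 PL1) as [U1 U2].
destruct (Key m _ Hm Hr L2 PL2) as [V1 V2].
unfold Rdiv in *.
assert (0 <= L1 * / INR m) by (apply Rmult_le_pos; lra).
assert (0 <= L2 * / INR m) by (apply Rmult_le_pos; lra).
assert (0 <= L1 * Cmod z ^ m) by (apply Rmult_le_pos; lra).
assert (0 <= L2 * Cmod z ^ m) by (apply Rmult_le_pos; lra).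
repeat split; eapply Rle_trans; try eassumption;
  eapply Rle_trans; try eassumption; lra.
Qed.

(** * The first-order conserved quantity *)

Definition spar (b v : C) : C := 1 + 2 * Re b * v.
(** For nonzero v this is |v|^2 Re G_+, where G_+ = b + 1/v. *)
Definition gam (b v : C) : R := (Re v + Re b * (Re v * Re v + Im v * Im v))%R.
Definition dir1 (b v : C) : C := Re b * Cconj (spar b v).
(** This is the real number Re v + 2 Re b |v|^2. The form chosen exhibits
    [dir2 + v^2 dir1 = gam * spar], the direction in which dv - v^2 db moves. *)
Definition dir2 (b v : C) : C := gam b v * spar b v - v * v * dir1 b v.

Definition sq (b v : C) : R := (Cmod (spar b v) * Cmod (spar b v))%R.

Lemma gam_sq b v : (4 * (Re b * gam b v) = sq b v - 1)%R.
Proof.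
unfold sq. rewrite Cmod_sqr. destruct b as [b0 b1], v as [x y].
unfold gam, spar; simpl. ring.
Qed.

Lemma dir2_spar b v :
  2 * Re b * dir2 b v = RtoC (sq b v - Re (spar b v))%R.
Proof.
unfold sq. rewrite Cmod_sqr. destruct b as [b0 b1], v as [x y].
unfold dir2, dir1, gam, spar, RtoC, Cminus, Cplus, Copp, Cmult, Cconj, Re, Im; simpl.
f_equal; ring.
Qed.

(** By [dir2_spar] this is the increment of v multiplied by 2 Re b. *)
Definition stepY (b v zeta : C) : C := 2 * zeta * (sq b v - Re (spar b v))%R.
Definition tau (b v zeta : C) : R := Re (zeta * Cconj (spar b v)).
(** The part of the change of s that is real-linear in zeta; [spar_step] gives the exact change. *)
Definition stepU (b v zeta : C) : C :=
  stepY b v zeta - 2 * tau b v zeta * (spar b v - 1).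

(** First-order conservation of |s|^2: paired with s, the two terms give [2 * tau * (sq - Re s)]
    with opposite signs. *)
Lemma stepU_orth b v zeta : Re (Cconj (spar b v) * stepU b v zeta) = 0%R.
Proof.
unfold stepU, stepY, tau, sq. rewrite Cmod_sqr. set (s := spar b v).
destruct s as [p q], zeta as [x y]. simpl. ring.
Qed.

Lemma spar_step b v zeta :
  spar (b - 2 * zeta * dir1 b v) (v + 2 * zeta * dir2 b v) =
  spar b v + stepU b v zeta - 2 * tau b v zeta * stepY b v zeta.
Proof.
assert (E : RtoC (Re (b - 2 * zeta * dir1 b v)) = Re b * (1 - 2 * tau b v zeta)).
{ unfold dir1, tau. set (s := spar b v). destruct b as [b0 b1], s as [p q], zeta as [x y].
  unfold RtoC, Cminus, Cplus, Copp, Cmult, Cconj, Re; simpl. f_equal; ring. }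
unfold spar at 1. rewrite E. unfold stepU, stepY. rewrite <- dir2_spar.
unfold spar. ring.
Qed.

Lemma Re_step b v zeta :
  (Re (b - 2 * zeta * dir1 b v) = Re b * (1 - 2 * tau b v zeta))%R.
Proof.
unfold dir1, tau. set (s := spar b v). destruct b as [b0 b1], s as [p q], zeta as [x y].
simpl. ring.
Qed.

Lemma sq_bounds b v : 2 <= sq b v <= 4 -> 7 / 5 <= Cmod (spar b v) <= 2.
Proof. unfold sq. assert (X := Cmod_ge_0 (spar b v)). nra. Qed.

Lemma tau_bound b v zeta e : sq b v <= 4 -> Cmod zeta <= e -> Rabs (tau b v zeta) <= 2 * e.
Proof.
intros H He. unfold tau. eapply Rle_trans; [apply re_le_Cmod|].
rewrite Cmod_mult, Cmod_conj. unfold sq in H.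
assert (X := Cmod_ge_0 (spar b v)). assert (Y := Cmod_ge_0 zeta).
assert (Cmod (spar b v) <= 2) by nra. nra.
Qed.

Lemma stepY_bound b v zeta e : sq b v <= 4 -> Cmod zeta <= e ->
  Cmod (stepY b v zeta) <= 12 * e.
Proof.
intros H He. unfold stepY.
assert (X := Cmod_ge_0 (spar b v)). assert (Y := Cmod_ge_0 zeta).
assert (S2 : Cmod (spar b v) <= 2) by (unfold sq in H; nra).
assert (R1 := re_le_Cmod (spar b v)).
assert (R2 : Rabs (sq b v - Re (spar b v))%R <= 6).
{ apply Rabs_le_between in R1. apply Rabs_le. unfold sq in *. nra. }
rewrite !Cmod_mult, !Cmod_R, (Rabs_right 2) by lra.
assert (Z := Rabs_pos (sq b v - Re (spar b v))). nra.
Qed.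

Lemma stepU_bound b v zeta e : sq b v <= 4 -> Cmod zeta <= e ->
  Cmod (stepU b v zeta) <= 24 * e.
Proof.
intros H He. unfold stepU.
assert (T := tau_bound _ _ _ _ H He).
assert (X := Cmod_ge_0 (spar b v)).
assert (S2 : Cmod (spar b v) <= 2) by (unfold sq in H; nra).
eapply Rle_trans.
- apply Cmod_minus_le; [apply stepY_bound with (1 := H) (2 := He)|].
  apply Cmod_mult_le with (x := (2 * (2 * e))%R) (y := 3%R).
  + rewrite Cmod_mult, !Cmod_R, (Rabs_right 2) by lra. lra.
  + eapply Rle_trans; [apply Cmod_minus_le with (x := 2%R) (y := 1%R)|lra]; [lra|].
    rewrite Cmod_1; lra.
- lra.
Qed.

Lemma Cmod_sqr_plus a c :
  (Cmod (a + c) * Cmod (a + c) = Cmod a * Cmod a + 2 * Re (Cconj a * c)%C + Cmod c * Cmod c)%R.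
Proof.
rewrite !Cmod_sqr. destruct a, c; simpl. ring.
Qed.

(** By [stepU_orth] only quadratic terms survive: at most 4 * 48 e^2 from the pairing with s, and
    (25 e)^2 from the square of the increment. *)
Lemma sq_step_ideal b v zeta e : sq b v <= 4 -> Cmod zeta <= e -> e <= 1 / 1000 ->
  Rabs (sq (b - 2 * zeta * dir1 b v) (v + 2 * zeta * dir2 b v) - sq b v)%R
    <= 1000 * (e * e).
Proof.
intros H He He1. unfold sq at 1. rewrite spar_step.
assert (HU := stepU_bound _ _ _ _ H He). assert (HY := stepY_bound _ _ _ _ H He).
assert (HT := tau_bound _ _ _ _ H He).
assert (O := stepU_orth b v zeta).
assert (S0 := Cmod_ge_0 (spar b v)).
assert (S2 : Cmod (spar b v) <= 2) by (unfold sq in H; nra).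
set (s := spar b v) in *. set (U := stepU b v zeta) in *. set (Y := stepY b v zeta) in *.
set (t := tau b v zeta) in *.
assert (Ez := Cmod_ge_0 zeta).
assert (W : Cmod (2 * t * Y) <= 48 * (e * e)).
{ rewrite !Cmod_mult, !Cmod_R, (Rabs_right 2) by lra.
  assert (A := Rabs_pos t). assert (B := Cmod_ge_0 Y). nra. }
replace (s + U - 2 * t * Y) with (s + (U - 2 * t * Y)) by ring.
rewrite Cmod_sqr_plus.
replace (Cconj s * (U - 2 * t * Y)) with (Cconj s * U + - (Cconj s * (2 * t * Y))) by ring.
rewrite re_plus, re_opp, O.
assert (P : Rabs (Re (Cconj s * (2 * t * Y))) <= 2 * (48 * (e * e))).
{ eapply Rle_trans; [apply re_le_Cmod|]. apply Cmod_mult_le; [|exact W].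
  now rewrite Cmod_conj. }
assert (V : Cmod (U - 2 * t * Y) <= 25 * e).
{ eapply Rle_trans; [apply Cmod_minus_le; [exact HU|exact W]|]. nra. }
assert (V0 := Cmod_ge_0 (U - 2 * t * Y)).
apply Rabs_le_between in P. apply Rabs_le.
unfold sq. fold s. nra.
Qed.

Lemma Re_step_ge b v zeta e : 0 <= Re b -> sq b v <= 4 -> Cmod zeta <= e -> e <= 1 / 1000 ->
  Re b / 2 <= Re (b - 2 * zeta * dir1 b v).
Proof.
intros Hb H He He1. rewrite Re_step.
assert (T := tau_bound _ _ _ _ H He). apply Rabs_le_between in T. nra.
Qed.

(** For small errors, such as that of the polynomial approximation. The constant involves the size M
    of b and v, which is harmless because [eta] is made small after M is known. *)
Lemma sq_perturb b v e1 e2 (M eta : R) : 1 <= M -> Cmod b <= 2 * M -> Cmod v <= 2 * M ->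
  sq b v <= 9 -> Cmod e1 <= eta -> Cmod e2 <= eta -> 10 * M * eta <= 1 ->
  Rabs (sq (b + e1) (v + e2) - sq b v)%R <= 70 * M * eta.
Proof.
intros HM Hb Hv Hs H1 H2 He.
assert (E : spar (b + e1) (v + e2) = spar b v + 2 * (Re b * e2 + Re e1 * (v + e2))).
{ unfold spar. rewrite re_plus, RtoC_plus. ring. }
unfold sq at 1. rewrite E. set (s := spar b v) in *.
set (d := 2 * (Re b * e2 + Re e1 * (v + e2))).
assert (P0 := Cmod_ge_0 e1).
assert (Hd : Cmod d <= 10 * M * eta).
{ unfold d. eapply Rle_trans.
  - apply Cmod_mult_le; [rewrite Cmod_R, Rabs_right by lra; apply Rle_refl|].
    apply Cmod_plus_le; apply Cmod_mult_le.
    + rewrite Cmod_R. eapply Rle_trans; [apply re_le_Cmod|exact Hb].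
    + exact H2.
    + rewrite Cmod_R. eapply Rle_trans; [apply re_le_Cmod|exact H1].
    + apply Cmod_plus_le; [exact Hv|exact H2].
  - nra. }
rewrite Cmod_sqr_plus. unfold sq. fold s.
assert (S0 := Cmod_ge_0 s). assert (D0 := Cmod_ge_0 d).
assert (S3 : Cmod s <= 3) by (unfold sq in Hs; fold s in Hs; nra).
assert (P : Rabs (Re (Cconj s * d)) <= 3 * Cmod d).
{ eapply Rle_trans; [apply re_le_Cmod|]. apply Cmod_mult_le; [now rewrite Cmod_conj|lra]. }
apply Rabs_le_between in P. apply Rabs_le. nra.
Qed.

(** Re b times the increment of v is half of [stepY], hence is bounded without any bound on b or
    v. *)
Lemma dir2_lipschitz b v zeta e : sq b v <= 4 -> Cmod zeta <= e ->
  Cmod (Re b * (2 * zeta * dir2 b v)) <= 6 * e.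
Proof.
intros H He.
replace (Re b * (2 * zeta * dir2 b v)) with (/ 2 * stepY b v zeta).
2:{ unfold stepY. rewrite <- dir2_spar. field. }
assert (X := stepY_bound _ _ _ _ H He).
rewrite Cmod_mult, Cmod_inv, Cmod_R, Rabs_right; [lra|lra|].
intros K; apply (f_equal fst) in K; simpl in K; lra.
Qed.

(* b and v are not kept bounded by the construction, hence the need for a uniform bound. *)
Lemma dir_product_ge b v v' : 0 <= Re b -> 2 <= sq b v <= 4 ->
  Cmod (Re b * (v' - v)) <= 1 / 100 ->
  1 / 4 <= Cmod (dir1 b v * (dir2 b v + v' * v' * dir1 b v)).
Proof.
intros Hb Hs Hd.
assert (B := sq_bounds _ _ Hs).
assert (G := gam_sq b v).
set (s := spar b v) in *.
(* For v' = v the second summand vanishes and the modulus is Re b * gam * |s|^2, at least 1/2 by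
   [gam_sq]. *)
replace (dir1 b v * (dir2 b v + v' * v' * dir1 b v)) with
  (Cconj s * ((Re b * gam b v)%R * s +
     (Re b * (v' - v)) * (Re b * (v' - v) + 2 * Re b * v) * Cconj s)).
2:{ unfold dir2, dir1. fold s. rewrite RtoC_mult. ring. }
rewrite Cmod_mult, Cmod_conj.
assert (W : 2 * Re b * v = s - 1) by (unfold s, spar; ring).
rewrite W.
assert (K : Cmod ((Re b * (v' - v)) * (Re b * (v' - v) + (s - 1)) * Cconj s)
   <= 1 / 100 * (1 / 100 + (2 + 1)) * 2).
{ apply Cmod_mult_le; [|rewrite Cmod_conj; lra]. apply Cmod_mult_le; [exact Hd|].
  apply Cmod_plus_le; [exact Hd|]. apply Cmod_minus_le; [lra|].
  rewrite Cmod_1; lra. }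
assert (L := Cmod_plus_ge ((Re b * gam b v)%R * s)
  ((Re b * (v' - v)) * (Re b * (v' - v) + (s - 1)) * Cconj s)).
rewrite (Cmod_mult (RtoC _) s), Cmod_R, Rabs_right in L by nra.
nra.
Qed.

(** Real parts are (p + conj p) / 2, so both directions are polynomials in z and conj z. *)
Lemma dir_multipliers b b1 v v1 : polynomial b b1 -> polynomial v v1 ->
  multiplier (fun z => dir1 (b z) (v z)) /\ multiplier (fun z => dir2 (b z) (v z)).
Proof.
intros Hb Hv.
assert (H2 : RtoC 2 <> 0) by (intros K; apply (f_equal fst) in K; simpl in K; lra).
assert (ReM : forall p p1, polynomial p p1 -> multiplier (fun z => RtoC (Re (p z)))).
{ intros p p1 Hp.
  apply multiplier_ext with (fun z => / 2 * (p z + Cconj (p z))).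
  - intros z. rewrite re_alt. now field.
  - apply multiplier_mult; [apply multiplier_const|].
    apply multiplier_plus; [now apply multiplier_poly with p1|].
    now apply multiplier_conj_poly with p1. }
assert (V := multiplier_poly _ _ Hv).
assert (Vc := multiplier_conj_poly _ _ Hv).
assert (B := ReM _ _ Hb). assert (RV := ReM _ _ Hv).
assert (S : multiplier (fun z => spar (b z) (v z))).
{ unfold spar. apply multiplier_plus; [apply multiplier_const|].
  apply multiplier_mult; [|exact V].
  apply multiplier_mult; [apply multiplier_const|exact B]. }
assert (D : multiplier (fun z => dir1 (b z) (v z))).
{ apply multiplier_ext with (fun z => Re (b z) * (1 + 2 * Re (b z) * Cconj (v z))).
  - intros z. unfold dir1, spar. rewrite Cplus_conj, !Cmult_conj.
    f_equal. unfold Cconj at 2 3 4; simpl. rewrite !Ropp_0.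
    reflexivity.
  - apply multiplier_mult; [exact B|].
    apply multiplier_plus; [apply multiplier_const|].
    apply multiplier_mult; [|exact Vc].
    apply multiplier_mult; [apply multiplier_const|exact B]. }
split; [exact D|]. unfold dir2.
apply multiplier_ext with (fun z =>
  (Re (v z) + Re (b z) * (v z * Cconj (v z))) * spar (b z) (v z)
   + (- (1)) * (v z * v z * dir1 (b z) (v z))).
- intros z. unfold gam. rewrite RtoC_plus, RtoC_mult.
  replace (RtoC (Re (v z) * Re (v z) + Im (v z) * Im (v z))%R) with (v z * Cconj (v z)).
  + ring.
  + destruct (v z) as [x y]. unfold Cmult, Cconj, RtoC; simpl. f_equal; ring.
- apply multiplier_plus; apply multiplier_mult.
  + apply multiplier_plus; [exact RV|]. apply multiplier_mult; [exact B|].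
    now apply multiplier_mult.
  + exact S.
  + apply multiplier_const.
  + apply multiplier_mult; [now apply multiplier_mult|exact D].
Qed.

(** * The inductive step *)

Lemma large_INR (c : R) : exists n0, forall m, (n0 <= m)%nat -> c <= INR m.
Proof.
destruct (nfloor_ex (Rmax c 0) (Rmax_r _ _)) as [n [_ Hn]].
exists (S n). intros m Hm. apply le_INR in Hm. rewrite S_INR in Hm.
assert (X := Rmax_l c 0). lra.
Qed.

(** Write r = s^2: one factor s^m absorbs the linear growth by [INR_one_minus_pow], the other tends
    to 0. *)
Lemma INR_pow_small r x : 0 <= r < 1 -> 0 < x ->
  exists n0, forall m, (n0 <= m)%nat -> (INR m + 1) * r ^ m <= x.
Proof.
intros Hr Hx.
set (s := sqrt r).
assert (Hs : 0 <= s < 1).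
{ split; [apply sqrt_pos|]. rewrite <- sqrt_1. apply sqrt_lt_1; lra. }
assert (E : r = (s * s)%R) by (unfold s; rewrite sqrt_sqrt; lra).
destruct (pow_lt_1_zero s ltac:(rewrite Rabs_right; lra) (x * (1 - s) / 2)) as [n0 H0].
{ apply Rdiv_lt_0_compat; [apply Rmult_lt_0_compat; lra|lra]. }
exists n0. intros m Hm. specialize (H0 m Hm).
rewrite Rabs_right in H0 by (apply Rle_ge, pow_le; lra).
assert (Hp := pow_range s m ltac:(lra)).
assert (Y := INR_one_minus_pow s m ltac:(lra)).
rewrite E, Rpow_mult_distr.
assert (Z : (1 - s) * ((INR m + 1) * (s ^ m * s ^ m)) <= 2 * s ^ m).
{ assert (INR m * (1 - s) * s ^ m * s ^ m <= 1 * s ^ m) by (apply Rmult_le_compat_r; lra).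
  assert ((1 - s) * s ^ m <= 1) by nra.
  assert ((1 - s) * s ^ m * s ^ m <= 1 * s ^ m) by (apply Rmult_le_compat_r; lra).
  lra. }
apply Rmult_le_reg_l with (1 - s)%R; lra.
Qed.

Lemma bernoulli_half r n : (0 < n)%nat -> 1 - / (2 * INR n) <= r <= 1 -> / 2 <= r ^ n.
Proof.
intros Hn [H1 H2].
assert (Hn1 : 1 <= INR n) by now apply (le_INR 1).
assert (Hi : / (2 * INR n) <= / 2).
{ apply Rinv_le_contravar; lra. }
assert (Hr : 0 <= r) by lra.
assert (B : 1 - INR n * (1 - r) <= r ^ n).
{ clear - Hr H2. induction n as [|n IH]; [simpl; lra|].
  rewrite S_INR. change (r ^ S n)%R with (r * r ^ n)%R.
  assert (P := pos_INR n).
  assert (0 <= INR n * (1 - r) * (1 - r)) by (repeat apply Rmult_le_pos; lra).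
  nra. }
assert (C0 : INR n * (1 - r) <= INR n * / (2 * INR n)) by (apply Rmult_le_compat_l; lra).
replace (INR n * / (2 * INR n))%R with (/ 2)%R in C0 by (field; lra). lra.
Qed.

(** The estimates of the step want |s|^2 in [2, 4], which holds for e <= 1. The lower bound of Re b
    belongs to a single stage and may shrink at every step. *)
Definition spar_controlled (e : R) (b v : C -> C) : Prop :=
  exists b0, 0 < b0 /\ forall z, Cmod z <= 1 ->
    b0 <= Re (b z) /\ Rabs (sq (b z) (v z) - 3)%R <= e.

Definition speed_pos (b1 v1 : C -> C) : Prop :=
  exists mu, 0 < mu /\ forall z, Cmod z <= 1 -> mu <= Cmod (b1 z) + Cmod (v1 z).

(** The last clause serves [transversal_step]: there the derivative of v changes by a large amount
    near the circle, and the speed must be bounded below by that of b alone. *)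
Definition good_pair (e : R) (b b1 v v1 : C -> C) : Prop :=
  polynomial b b1 /\ polynomial v v1 /\ spar_controlled e b v /\ speed_pos b1 v1 /\
  exists d mu, 0 < d /\ 0 < mu /\
    forall z, 1 - d <= Cmod z <= 1 -> mu <= Cmod (b1 z).

Lemma polynomial_bounds b b1 : polynomial b b1 ->
  exists M, 0 <= M /\ bounded_disc b M /\ bounded_disc b1 M.
Proof.
intros H. destruct (polynomial_bounded _ _ H) as [M HM].
destruct (polynomial_derive _ _ H) as [b2 H2]. destruct (polynomial_bounded _ _ H2) as [M' HM'].
assert (P := bounded_disc_nonneg _ _ HM). assert (P' := bounded_disc_nonneg _ _ HM').
exists (M + M')%R. repeat split; [lra| |]; intros z Hz;
  [specialize (HM z Hz)|specialize (HM' z Hz)]; lra.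
Qed.

(* Makes v' dominate b' near the circle, so that the main step, whose direction
   is almost parallel to that of the previous one, cannot cancel (b', v'). *)
Lemma transversal_step e e' b b1 v v1 (Rad t L : R) :
  good_pair e b b1 v v1 -> 0 <= e < e' -> e' <= 1 -> Rad < 1 -> 0 < t -> 0 <= L ->
  exists w w1, polynomial w w1 /\ spar_controlled e' b w /\ speed_pos b1 w1 /\
    (forall z, Cmod z <= 1 -> Cmod (w z - v z) <= t) /\
    (forall z, Cmod z <= Rad -> Cmod (w1 z - v1 z) <= t) /\
    exists d, 0 < d <= / 2 /\
      forall z, 1 - d <= Cmod z <= 1 -> L * Cmod (b1 z) + 1 <= Cmod (w1 z).
Proof.
intros [Pb [Pv [[b0 [Hb0 Hs]] [[mu [Hmu Hsp]] [d [mu' [Hd [Hmu' Hd']]]]]]]] He He' HR Ht HL.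
destruct (polynomial_bounds _ _ Pb) as [Mb [PMb [HMb HMb1]]].
destruct (polynomial_bounds _ _ Pv) as [Mv [PMv [HMv HMv1]]].
set (M := (1 + Mb + Mv)%R).
assert (HM1 : 1 <= M) by (unfold M; lra).
set (eta := Rmin t (Rmin (/ (10 * M)) ((e' - e) / (70 * M)))).
assert (Heta : 0 < eta).
{ unfold eta. repeat apply Rmin_glb_lt; [lra| |].
  - apply Rinv_0_lt_compat; lra.
  - apply Rdiv_lt_0_compat; lra. }
assert (Heta1 : eta <= t) by apply Rmin_l.
assert (Heta2 : 10 * M * eta <= 1).
{ assert (X : eta <= / (10 * M)) by (eapply Rle_trans; [apply Rmin_r|apply Rmin_l]).
  apply Rmult_le_compat_l with (r := (10 * M)%R) in X; [|lra].
  rewrite Rinv_r in X by lra. exact X. }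
assert (Heta3 : 70 * M * eta <= e' - e).
{ assert (X : eta <= (e' - e) / (70 * M)) by (eapply Rle_trans; [apply Rmin_r|apply Rmin_r]).
  apply Rmult_le_compat_l with (r := (70 * M)%R) in X; [|lra].
  replace (70 * M * ((e' - e) / (70 * M)))%R with (e' - e)%R in X by (field; lra). exact X. }
clearbody eta.
set (R' := Rmax 0 (Rmax Rad (1 - d))).
assert (HR' : 0 <= R' < 1).
{ split; [apply Rmax_l|]. repeat apply Rmax_lub_lt; lra. }
assert (HR1 : Rad <= R') by (eapply Rle_trans; [apply Rmax_l|apply Rmax_r]).
assert (HR2 : 1 - d <= R') by (eapply Rle_trans; [apply Rmax_r|apply Rmax_r]).
(* The derivative of [eta * z ^ S n] has modulus eta (n + 1) |z|^n. A large n makes it small for |z|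
   <= R' and large near the circle, while the function itself stays below [eta]. *)
destruct (INR_pow_small R' (Rmin t (mu / 2) / eta) HR') as [n1 Hn1].
{ apply Rdiv_lt_0_compat; [apply Rmin_glb_lt; lra|lra]. }
destruct (large_INR (2 * ((L + 1) * M + 1) / eta)) as [n2 Hn2].
set (n := max n1 n2). specialize (Hn1 n ltac:(lia)). specialize (Hn2 n ltac:(lia)).
assert (Hn0 := pos_INR n).
assert (Sm : eta * ((INR n + 1) * R' ^ n) <= Rmin t (mu / 2)).
{ apply Rmult_le_compat_l with (r := eta) in Hn1; [|lra].
  replace (eta * (Rmin t (mu / 2) / eta))%R with (Rmin t (mu / 2)) in Hn1 by (field; lra).
  exact Hn1. }
assert (Lg : 2 * ((L + 1) * M + 1) <= eta * INR n).
{ apply Rmult_le_compat_l with (r := eta) in Hn2; [|lra].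
  replace (eta * (2 * ((L + 1) * M + 1) / eta))%R with (2 * ((L + 1) * M + 1))%R in Hn2
    by (field; lra).
  exact Hn2. }
destruct (polynomial_pow (S n)) as [p1 [Hp Ep]].
exists (fun z => v z + eta * z ^ S n), (fun z => v1 z + (0 * z ^ S n + eta * p1 z)).
assert (Ed : forall z, v1 z + (0 * z ^ S n + eta * p1 z) - v1 z = eta * ((INR n + 1) * z ^ n)).
{ intros z. rewrite Ep, S_INR, RtoC_plus. simpl pred. ring. }
assert (Nd : forall z, Cmod (eta * ((INR n + 1) * z ^ n)) = (eta * ((INR n + 1) * Cmod z ^ n))%R).
{ intros z. rewrite <- RtoC_plus, !Cmod_mult, !Cmod_R, Cmod_pow, !Rabs_right by lra. ring. }
assert (Nsmall : forall z, Cmod z <= R' ->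
  Cmod (v1 z + (0 * z ^ S n + eta * p1 z) - v1 z) <= Rmin t (mu / 2)).
{ intros z Hz. rewrite Ed, Nd. eapply Rle_trans; [|exact Sm].
  apply Rmult_le_compat_l; [lra|]. apply Rmult_le_compat_l; [lra|].
  apply pow_incr. split; [apply Cmod_ge_0|exact Hz]. }
assert (Vsm : forall z, Cmod z <= 1 -> Cmod (eta * z ^ S n) <= eta).
{ intros z Hz. rewrite Cmod_mult, Cmod_R, Rabs_right, Cmod_pow by lra.
  assert (X := pow_range (Cmod z) (S n) (conj (Cmod_ge_0 z) Hz)). nra. }
split; [|split; [|split; [|split; [|split]]]].
- apply polynomial_plus; [exact Pv|]. now apply polynomial_scal.
- exists b0; split; [exact Hb0|]. intros z Hz. destruct (Hs z Hz) as [S1 S2].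
  split; [exact S1|].
  assert (X := sq_perturb (b z) (v z) 0 (eta * z ^ S n) M eta).
  replace (b z + 0) with (b z) in X by ring.
  specialize (HMb z Hz). specialize (HMv z Hz).
  assert (Y := Rabs_le_between (sq (b z) (v z) - 3) e). apply Y in S2.
  specialize (X HM1 ltac:(unfold M in *; lra) ltac:(unfold M in *; lra) ltac:(lra)
    ltac:(rewrite Cmod_0; lra) (Vsm z Hz) Heta2).
  apply Rabs_le_between in X. apply Rabs_le. lra.
- exists (Rmin (mu / 2) mu'). split; [apply Rmin_glb_lt; lra|].
  intros z Hz. destruct (Rle_lt_dec (1 - d) (Cmod z)) as [Hzd|Hzd].
  + eapply Rle_trans; [apply Rmin_r|]. eapply Rle_trans; [apply (Hd' z (conj Hzd Hz))|].
    assert (X := Cmod_ge_0 (v1 z + (0 * z ^ S n + eta * p1 z))). lra.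
  + eapply Rle_trans; [apply Rmin_l|].
    assert (X := Nsmall z ltac:(lra)). assert (Y := Rmin_r t (mu / 2)).
    assert (Z := Cmod_minus_ge (v1 z) (v1 z - (v1 z + (0 * z ^ S n + eta * p1 z)))).
    replace (v1 z - (v1 z - (v1 z + (0 * z ^ S n + eta * p1 z)))) with
      (v1 z + (0 * z ^ S n + eta * p1 z)) in Z by ring.
    rewrite <- (Cmod_opp (v1 z - _)) in Z.
    replace (- (v1 z - (v1 z + (0 * z ^ S n + eta * p1 z)))) with
      (v1 z + (0 * z ^ S n + eta * p1 z) - v1 z) in Z by ring.
    specialize (Hsp z Hz). lra.
- intros z Hz. replace (v z + eta * z ^ S n - v z) with (eta * z ^ S n) by ring.
  specialize (Vsm z Hz). lra.
- intros z Hz. eapply Rle_trans; [apply Nsmall; lra|apply Rmin_l].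
- exists (/ (2 * INR (S n)))%R.
  assert (HSn : 1 <= INR (S n)) by (rewrite S_INR; lra).
  split.
  { split; [apply Rinv_0_lt_compat; lra|]. apply Rinv_le_contravar; lra. }
  intros z Hz.
  assert (B := bernoulli_half (Cmod z) (S n) ltac:(lia) Hz).
  assert (B' : / 2 <= Cmod z ^ n).
  { eapply Rle_trans; [exact B|]. apply Rpow_le_pow; [|lia].
    split; [apply Cmod_ge_0|lra]. }
  specialize (HMb1 z (proj2 Hz)). specialize (HMv1 z (proj2 Hz)).
  assert (Z := Cmod_plus_ge (eta * ((INR n + 1) * z ^ n)) (v1 z)).
  replace (eta * ((INR n + 1) * z ^ n) + v1 z) with
      (v1 z + (0 * z ^ S n + eta * p1 z)) in Z by (rewrite <- Ed; ring).
  rewrite Nd in Z.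
  assert (W : eta * INR n * / 2 <= eta * ((INR n + 1) * Cmod z ^ n)).
  { assert (U1 : eta * INR n * / 2 <= eta * INR n * Cmod z ^ n)
      by (apply Rmult_le_compat_l; [apply Rmult_le_pos; lra|exact B']).
    assert (U2 : 0 <= eta * Cmod z ^ n) by (apply Rmult_le_pos; lra).
    lra. }
  assert (V : L * Cmod (b1 z) <= L * M) by (apply Rmult_le_compat_l; unfold M; lra).
  unfold M in *. lra.
Qed.

Lemma Cmod_near_le a c x y : Cmod (a - c) <= x -> Cmod c <= y -> Cmod a <= x + y.
Proof.
intros H1 H2. replace a with ((a - c) + c) by ring. now apply Cmod_plus_le.
Qed.

Lemma Cmod_near_ge a c x : Cmod (a - c) <= x -> Cmod c - x <= Cmod a.
Proof.
intros H. assert (Z := Cmod_minus_ge c (c - a)).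
replace (c - (c - a)) with a in Z by ring.
rewrite <- (Cmod_opp (c - a)) in Z.
replace (- (c - a)) with (a - c) in Z by ring. lra.
Qed.

Lemma approximate_step_values b v b' v' zeta eps M eta :
  1 <= M -> Cmod b <= M -> Cmod v <= M -> Cmod (dir1 b v) <= M -> Cmod (dir2 b v) <= M ->
  0 <= Re b -> sq b v <= 4 -> Cmod zeta <= eps -> eps <= 1 / 1000 ->
  Cmod (b' - (b - 2 * zeta * dir1 b v)) <= eta ->
  Cmod (v' - (v + 2 * zeta * dir2 b v)) <= eta -> 1000 * M * eta <= 1 ->
  Re b / 2 - eta <= Re b' /\
  Rabs (sq b' v' - sq b v)%R <= 1000 * (eps * eps) + 70 * M * eta /\
  Cmod (Re b * (v' - v)) <= 1 / 100.
Proof.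
intros HM Hb Hv HF HG Hb0 Hs Hz He H1 H2 Heta.
set (bi := b - 2 * zeta * dir1 b v) in *. set (vi := v + 2 * zeta * dir2 b v) in *.
assert (Ez := Cmod_ge_0 zeta).
assert (Z2 : Cmod (2 * zeta) <= 1).
{ rewrite Cmod_mult, Cmod_R, Rabs_right by lra. lra. }
split; [|split].
- assert (X := Re_step_ge b v zeta eps Hb0 Hs Hz He). fold bi in X.
  assert (Y := re_le_Cmod (b' - bi)). apply Rabs_le_between in Y.
  unfold Cminus in Y. rewrite re_plus, re_opp in Y. unfold Cminus in H1. lra.
- assert (X := sq_step_ideal b v zeta eps Hs Hz He). fold bi vi in X.
  assert (Hee : eps * eps <= 1 / 1000 * (1 / 1000)) by nra.
  assert (X' := X). apply Rabs_le_between in X'.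
  assert (Y := sq_perturb bi vi (b' - bi) (v' - vi) M eta HM).
  replace (bi + (b' - bi)) with b' in Y by ring.
  replace (vi + (v' - vi)) with v' in Y by ring.
  assert (Bi : Cmod bi <= 2 * M).
  { unfold bi. eapply Rle_trans; [apply Cmod_minus_le; [exact Hb|]|].
    - apply Cmod_mult_le; [exact Z2|exact HF].
    - lra. }
  assert (Vi : Cmod vi <= 2 * M).
  { unfold vi. eapply Rle_trans; [apply Cmod_plus_le; [exact Hv|]|].
    - apply Cmod_mult_le; [exact Z2|exact HG].
    - lra. }
  assert (P := Cmod_ge_0 (b' - bi)).
  assert (PM : 0 <= M * eta) by (apply Rmult_le_pos; lra).
  specialize (Y Bi Vi ltac:(lra) H1 H2 ltac:(lra)).
  apply Rabs_le_between in Y. apply Rabs_le. lra.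
- replace (Re b * (v' - v)) with (Re b * (2 * zeta * dir2 b v) + Re b * (v' - vi))
    by (unfold vi; ring).
  eapply Rle_trans.
  + apply Cmod_plus_le; [apply dir2_lipschitz; [exact Hs|exact Hz]|].
    apply Cmod_mult_le; [|exact H2].
    rewrite Cmod_R. eapply Rle_trans; [apply re_le_Cmod|exact Hb].
  + lra.
Qed.

(** With b1' close to -X F and v1' close to X G, the product is -X^2 F (G + v'^2 F) up to terms at
    most linear in X; in the application |X| grows with the frequency. *)
Lemma approximate_step_product F G X b1' v' v1' M V Cc :
  Cmod F <= M -> Cmod G <= M -> Cmod v' <= V ->
  Cmod (b1' + X * F) <= Cc -> Cmod (v1' - X * G) <= Cc ->
  1 / 4 <= Cmod (F * (G + v' * v' * F)) ->
  Cmod X * Cmod X * (1 / 4)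
    - Cmod X * (M * (Cc + V * V * Cc) + Cc * (M + V * V * M)) - Cc * (Cc + V * V * Cc)
  <= Cmod (b1' * (v1' - v' * v' * b1')).
Proof.
intros HF HG HV H1 H2 Hp.
set (E1 := b1' + X * F) in *. set (E2 := v1' - X * G) in *.
set (E3 := E2 - v' * v' * E1). set (H := G + v' * v' * F).
assert (HE3 : Cmod E3 <= Cc + V * V * Cc).
{ apply Cmod_minus_le; [exact H2|]. apply Cmod_mult_le; [|exact H1].
  now apply Cmod_mult_le. }
assert (HH : Cmod H <= M + V * V * M).
{ apply Cmod_plus_le; [exact HG|]. apply Cmod_mult_le; [|exact HF].
  now apply Cmod_mult_le. }
replace (b1' * (v1' - v' * v' * b1')) with
  (- (X * X * (F * H)) - (X * (F * E3) - E1 * (X * H) - E1 * E3))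
  by (unfold E3, E2, E1, H; ring).
eapply Rle_trans; [|apply Cmod_minus_ge].
rewrite Cmod_opp, (Cmod_mult (X * X)), (Cmod_mult X X). fold H in Hp.
assert (S : Cmod (X * (F * E3) - E1 * (X * H) - E1 * E3) <=
  Cmod X * (M * (Cc + V * V * Cc)) + Cc * (Cmod X * (M + V * V * M)) + Cc * (Cc + V * V * Cc)).
{ apply Cmod_minus_le; [apply Cmod_minus_le|].
  - apply Cmod_mult_le; [apply Rle_refl|now apply Cmod_mult_le].
  - apply Cmod_mult_le; [exact H1|]. apply Cmod_mult_le; [apply Rle_refl|exact HH].
  - now apply Cmod_mult_le. }
assert (P : Cmod X * Cmod X * (1 / 4) <= Cmod X * Cmod X * Cmod (F * H)).
{ apply Rmult_le_compat_l; [|exact Hp]. apply Rmult_le_pos; apply Cmod_ge_0. }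
lra.
Qed.

Lemma eventually_le_INR_mult (a c : R) : 0 < a ->
  exists n0, forall m, (n0 <= m)%nat -> c <= a * INR m.
Proof.
intros Ha. destruct (large_INR (c / a)) as [n0 H]. exists n0. intros m Hm.
specialize (H m Hm). apply Rmult_le_compat_l with (r := a) in H; [|lra].
replace (a * (c / a))%R with c in H by (field; lra). exact H.
Qed.

(** The perturbation with zeta = eps z^(2m+N+1). Of its derivative only the part from z^(2m) is
    displayed, with coefficient 2 * eps * 2m; the remaining powers of z and the derivatives of the
    directions are in the error. *)
Lemma step_approximation eps b b1 v v1 : polynomial b b1 -> polynomial v v1 ->
  0 < eps <= 1 / 1000 ->
  exists K N, 0 <= K /\ forall m, (1 <= m)%nat -> exists b' b1' v' v1',
  polynomial b' b1' /\ polynomial v' v1' /\ forall z, Cmod z <= 1 ->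
  Cmod (b' z - (b z - 2 * (eps * z ^ (2 * m + N + 1)) * dir1 (b z) (v z))) <= K / INR m /\
  Cmod (v' z - (v z + 2 * (eps * z ^ (2 * m + N + 1)) * dir2 (b z) (v z))) <= K / INR m /\
  Cmod (b1' z - (b1 z - (4 * eps * INR m)%R * z ^ (2 * m + N) * dir1 (b z) (v z)))
    <= K * Cmod z ^ m /\
  Cmod (v1' z - (v1 z + (4 * eps * INR m)%R * z ^ (2 * m + N) * dir2 (b z) (v z)))
    <= K * Cmod z ^ m.
Proof.
intros Pb Pv He.
destruct (dir_multipliers _ _ _ _ Pb Pv) as [T1 T2].
destruct (osc_approx_pair _ _ (multiplier_approximable _ T1) (multiplier_approximable _ T2))
  as [K [N [HK H]]].
exists K, N. split; [exact HK|]. intros m Hm.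
destruct (H m Hm) as [Q [Q1 [P [P1 [HQ [HP X]]]]]].
exists (fun z => b z + (- (2 * eps)%R) * Q z),
  (fun z => b1 z + (0 * Q z + (- (2 * eps)%R) * Q1 z)),
  (fun z => v z + (2 * eps)%R * P z), (fun z => v1 z + (0 * P z + (2 * eps)%R * P1 z)).
split; [apply polynomial_plus; [exact Pb|now apply polynomial_scal]|].
split; [apply polynomial_plus; [exact Pv|now apply polynomial_scal]|].
intros z Hz. destruct (X z Hz) as [X1 [X2 [X3 X4]]].
assert (E2 : Cmod (RtoC (2 * eps)%R) <= 1) by (rewrite Cmod_R, Rabs_right; lra).
assert (E2' : Cmod (- RtoC (2 * eps)%R) <= 1) by now rewrite Cmod_opp.
assert (Sc : forall c u x, Cmod c <= 1 -> Cmod u <= x -> Cmod (c * u) <= x).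
{ intros c u x Hc Hu. rewrite <- (Rmult_1_l x). now apply Cmod_mult_le. }
assert (I2 : RtoC (INR (2 * m)) = 2 * INR m).
{ rewrite mult_INR, RtoC_mult. reflexivity. }
rewrite I2 in X3, X4. rewrite !RtoC_mult in *.
repeat split.
- refine (eq_ind _ (fun u => Cmod u <= _) (Sc _ _ _ E2' X1) _ _). ring.
- refine (eq_ind _ (fun u => Cmod u <= _) (Sc _ _ _ E2 X2) _ _). ring.
- refine (eq_ind _ (fun u => Cmod u <= _) (Sc _ _ _ E2' X3) _ _).
  replace (RtoC 4) with (2 * 2) by (rewrite <- RtoC_mult; f_equal; lra). ring.
- refine (eq_ind _ (fun u => Cmod u <= _) (Sc _ _ _ E2 X4) _ _).
  replace (RtoC 4) with (2 * 2) by (rewrite <- RtoC_mult; f_equal; lra). ring.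
Qed.

(** In the parametrization by b, v, w this is omega * theta: the exponentials of w cancel. *)
Definition gauss_speed_product (b1 v v1 : C -> C) (z : C) : C :=
  b1 z * (v1 z - v z * v z * b1 z).

(** One oscillation of frequency about 2m. Once b and v, hence M, b0, K and N, are fixed, each
    requirement is an inequality that holds for all large m. *)
Lemma main_step e e' eps b b1 v v1 (Rad t L : R) :
  polynomial b b1 -> polynomial v v1 -> spar_controlled e b v -> speed_pos b1 v1 ->
  (forall z, Cmod z <= 1 -> Cmod (dir2 (b z) (v z)) <= L * Cmod (dir1 (b z) (v z))) ->
  (exists d, 0 < d <= / 2 /\
      forall z, 1 - d <= Cmod z <= 1 -> L * Cmod (b1 z) + 1 <= Cmod (v1 z)) ->
  0 < eps <= 1 / 1000 -> e + 1000 * (eps * eps) < e' -> e' <= 1 -> Rad < 1 -> 0 < t ->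
  exists b' b1' v' v1', good_pair e' b' b1' v' v1' /\
    (forall z, Cmod z <= Rad -> Cmod (b' z - b z) <= t /\ Cmod (b1' z - b1 z) <= t /\
       Cmod (v' z - v z) <= t /\ Cmod (v1' z - v1 z) <= t) /\
    exists A R1 R2, Rad < R1 /\ / 2 <= R1 /\ R1 < R2 /\ R2 < 1 /\ 0 < A /\
      eps / 32 <= A * (R2 - R1) /\
      forall z, R1 <= Cmod z <= R2 -> A * A <= Cmod (gauss_speed_product b1' v' v1' z).
Proof.
intros Pb Pv [b0 [Hb0 Hs]] [mu [Hmu Hsp]] HL [d [Hd Hdom]] Heps Hee He1 HRad Ht.
destruct (step_approximation _ _ _ _ _ Pb Pv Heps) as [K [N [HK Happ]]].
destruct (dir_multipliers _ _ _ _ Pb Pv) as [T1 T2].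
destruct (multiplier_approximable _ T1) as [[M1 HM1] _].
destruct (multiplier_approximable _ T2) as [[M2 HM2] _].
destruct (polynomial_bounds _ _ Pb) as [Mb [PMb [HMb HMb1]]].
destruct (polynomial_bounds _ _ Pv) as [Mv [PMv [HMv HMv1]]].
assert (PM1 := bounded_disc_nonneg _ _ HM1). assert (PM2 := bounded_disc_nonneg _ _ HM2).
set (M := (1 + Mb + Mv + M1 + M2)%R).
assert (HM : 1 <= M) by (unfold M; lra).
assert (Bd : forall z, Cmod z <= 1 -> Cmod (b z) <= M /\ Cmod (b1 z) <= M /\
  Cmod (v z) <= M /\ Cmod (v1 z) <= M /\
  Cmod (dir1 (b z) (v z)) <= M /\ Cmod (dir2 (b z) (v z)) <= M).
{ intros z Hz. unfold M.
  specialize (HMb z Hz). specialize (HMb1 z Hz). specialize (HMv z Hz).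
  specialize (HMv1 z Hz). specialize (HM1 z Hz). specialize (HM2 z Hz).
  cbv beta in *. repeat split; lra. }
clearbody M. clear M1 M2 Mb Mv HM1 HM2 HMb HMb1 HMv HMv1 PMb PMv PM1 PM2 T1 T2.
assert (He2 : 0 <= eps * eps) by (apply Rmult_le_pos; lra).
assert (Dir : forall z, Cmod z <= 1 -> b0 <= Cmod (dir1 (b z) (v z))).
{ intros z Hz. destruct (Hs z Hz) as [S1 S2]. apply Rabs_le_between in S2.
  assert (B := sq_bounds (b z) (v z) ltac:(lra)).
  unfold dir1. rewrite Cmod_mult, Cmod_conj, Cmod_R, Rabs_right by lra. nra. }
(* With mu / 4, the two derivatives together lose at most half of the speed mu on |z| <= 1 - d. *)
set (t' := Rmin t (mu / 4)).
assert (Ht' : 0 < t') by (apply Rmin_glb_lt; lra).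
assert (Ht1 : t' <= t) by apply Rmin_l. assert (Ht2 : t' <= mu / 4) by apply Rmin_r.
clearbody t'.
set (R' := Rmax 0 (Rmax Rad (1 - d))).
assert (HR' : 0 <= R' < 1).
{ split; [apply Rmax_l|]. repeat apply Rmax_lub_lt; lra. }
assert (HR1 : Rad <= R') by (eapply Rle_trans; [apply Rmax_l|apply Rmax_r]).
assert (HR2 : 1 - d <= R') by (eapply Rle_trans; [apply Rmax_r|apply Rmax_r]).
clearbody R'.
(* A threshold for |z|^m when |z| > 1 - d. Below it the error K |z|^m of the derivatives is small
   against b0, and a combination blind to the new direction still sees the old velocity; above it
   the oscillation, at least of order eps m sg^2 2^(-N), dominates. *)
set (sg := (b0 / (4 * M * (K + 1)))%R).
assert (Hsg : 0 < sg).
{ apply Rdiv_lt_0_compat; [lra|]. apply Rmult_lt_0_compat; lra. }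
assert (Hsg1 : 4 * M * K * sg <= b0).
{ unfold sg. replace (4 * M * K * (b0 / (4 * M * (K + 1))))%R with
    (b0 * (K / (K + 1)))%R by (field; lra).
  assert (K / (K + 1) <= 1).
  { apply Rmult_le_reg_r with (K + 1)%R; [lra|]. unfold Rdiv.
    rewrite Rmult_assoc, Rinv_l; lra. }
  nra. }
clearbody sg.
set (V := (2 * M + 1)%R). set (Cc := (M + K)%R).
set (K1 := (M * (Cc + V * V * Cc) + Cc * (M + V * V * M))%R).
set (K2 := (Cc * (Cc + V * V * Cc))%R).
destruct (INR_pow_small R' (t' / (2 * (K + 4 * M))) HR') as [n1 Hn1].
{ apply Rdiv_lt_0_compat; lra. }
destruct (eventually_le_INR_mult 1 (1000 * M * K) Rlt_0_1) as [n2 Hn2].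
destruct (eventually_le_INR_mult (e' - e - 1000 * (eps * eps)) (70 * M * K) ltac:(lra)) as [n3 Hn3].
destruct (eventually_le_INR_mult (b0 / 4) K ltac:(lra)) as [n4 Hn4].
destruct (eventually_le_INR_mult (t' / 2) K ltac:(lra)) as [n5 Hn5].
assert (HN2 : 0 < (/ 2) ^ N) by (apply pow_lt; lra).
destruct (eventually_le_INR_mult (4 * eps * (sg * sg * (/ 2) ^ N) * b0) (M + K + 1)) as [n6 Hn6].
{ repeat apply Rmult_lt_0_compat; lra. }
destruct (eventually_le_INR_mult (2 * eps * b0) (M + K + 1)) as [n7 Hn7].
{ repeat apply Rmult_lt_0_compat; lra. }
destruct (eventually_le_INR_mult (2 * eps) (8 * (Rabs K1 + Rabs K2) + 1) ltac:(lra)) as [n8 Hn8].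
destruct (eventually_le_INR_mult (1 - Rad) 1 ltac:(lra)) as [n9 Hn9].
set (m := (1 + (n1 + n2 + n3 + n4 + n5) + (n6 + n7 + n8 + n9) + (N + 1))%nat).
specialize (Hn1 m ltac:(lia)). specialize (Hn2 m ltac:(lia)). specialize (Hn3 m ltac:(lia)).
specialize (Hn4 m ltac:(lia)). specialize (Hn5 m ltac:(lia)). specialize (Hn6 m ltac:(lia)).
specialize (Hn7 m ltac:(lia)). specialize (Hn8 m ltac:(lia)). specialize (Hn9 m ltac:(lia)).
assert (HmN : (N + 1 <= m)%nat) by lia. assert (Hm1 : (1 <= m)%nat) by lia.
clearbody m. clear n1 n2 n3 n4 n5 n6 n7 n8 n9.
assert (Im : 1 <= INR m) by now apply (le_INR 1).
assert (Div : forall c a, c <= a * INR m -> c / INR m <= a).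
{ intros c a H. apply Rmult_le_reg_r with (INR m); [lra|].
  unfold Rdiv. rewrite Rmult_assoc, Rinv_l; lra. }
set (eta := (K / INR m)%R).
assert (Eta0 : 0 <= eta).
{ apply Rmult_le_pos; [lra|]. apply Rlt_le, Rinv_0_lt_compat; lra. }
assert (Eta1 : 1000 * M * eta <= 1).
{ unfold eta. apply Div in Hn2. unfold Rdiv in *. lra. }
assert (Eta2 : 70 * M * eta <= e' - e - 1000 * (eps * eps)).
{ unfold eta. apply Div in Hn3. unfold Rdiv in *. lra. }
assert (Eta3 : eta <= b0 / 4) by now apply Div.
assert (Eta4 : eta <= t' / 2) by now apply Div.
destruct (Happ m Hm1) as [b' [b1' [v' [v1' [Pb' [Pv' App]]]]]]. fold eta in App.
clearbody eta. clear Happ Hn2 Hn3 Hn4 Hn5.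
set (f := (2 * m + N + 1)%nat) in *.
assert (X2 : forall z, Cmod z <= 1 -> Cmod (eps * z ^ f) <= eps).
{ intros z Hz. rewrite Cmod_mult, Cmod_R, Rabs_right, Cmod_pow by lra.
  assert (X := pow_range (Cmod z) f (conj (Cmod_ge_0 z) Hz)). nra. }
assert (Val : forall z, Cmod z <= 1 -> Re (b z) / 2 - eta <= Re (b' z) /\
  Rabs (sq (b' z) (v' z) - sq (b z) (v z))%R <= 1000 * (eps * eps) + 70 * M * eta /\
  Cmod (Re (b z) * (v' z - v z)) <= 1 / 100).
{ intros z Hz. destruct (Bd z Hz) as [B1 [B2 [B3 [B4 [B5 B6]]]]].
  destruct (Hs z Hz) as [S1 S2]. apply Rabs_le_between in S2.
  destruct (App z Hz) as [A1 [A2 _]].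
  apply (approximate_step_values _ _ _ _ (eps * z ^ f) eps M eta); try assumption; try lra.
  now apply X2. }
set (x := fun z => RtoC (4 * eps * INR m)%R * z ^ (2 * m + N)).
assert (Nx : forall z, Cmod (x z) = (4 * eps * INR m * Cmod z ^ (2 * m + N))%R).
{ intros z. unfold x. rewrite Cmod_mult, Cmod_R, Cmod_pow, Rabs_right; [easy|].
  apply Rle_ge. repeat apply Rmult_le_pos; lra. }
assert (Xlow : forall z, 1 - / (2 * INR f) <= Cmod z <= 1 -> 2 * eps * INR m <= Cmod (x z)).
{ intros z Hz. rewrite Nx.
  assert (B := bernoulli_half (Cmod z) f ltac:(unfold f; lia) Hz).
  assert (B' : / 2 <= Cmod z ^ (2 * m + N)).
  { eapply Rle_trans; [exact B|]. apply Rpow_le_pow; [|unfold f; lia].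
    split; [apply Cmod_ge_0|lra]. }
  assert (0 <= 4 * eps * INR m) by (repeat apply Rmult_le_pos; lra).
  replace (2 * eps * INR m)%R with (4 * eps * INR m * / 2)%R by field.
  now apply Rmult_le_compat_l. }
assert (Dominate : forall z, Cmod z <= 1 -> Cmod (x z) * b0 - (M + K) <= Cmod (b1' z)).
{ intros z Hz. destruct (Bd z Hz) as [_ [B2 _]].
  destruct (App z Hz) as [_ [_ [A3 _]]]. fold (x z) in A3.
  assert (Dz := Dir z Hz).
  apply Cmod_near_ge in A3.
  assert (Y := Cmod_minus_ge (x z * dir1 (b z) (v z)) (b1 z)).
  rewrite <- (Cmod_opp (x z * _ - _)) in Y.
  replace (- (x z * dir1 (b z) (v z) - b1 z)) with (b1 z - x z * dir1 (b z) (v z)) in Y by ring.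
  rewrite Cmod_mult in Y.
  assert (U := pow_range (Cmod z) m (conj (Cmod_ge_0 z) Hz)).
  assert (Cmod (x z) * b0 <= Cmod (x z) * Cmod (dir1 (b z) (v z))).
  { apply Rmult_le_compat_l; [apply Cmod_ge_0|exact Dz]. }
  assert (K * Cmod z ^ m <= K) by nra. lra. }
assert (Small : forall z, Cmod z <= R' -> Cmod (b' z - b z) <= t' /\ Cmod (b1' z - b1 z) <= t' /\
       Cmod (v' z - v z) <= t' /\ Cmod (v1' z - v1 z) <= t').
{ intros z Hz. assert (Hz1 : Cmod z <= 1) by lra.
  destruct (Bd z Hz1) as [B1 [B2 [B3 [B4 [B5 B6]]]]].
  destruct (App z Hz1) as [A1 [A2 [A3 A4]]]. fold (x z) in A3, A4.
  assert (U : Cmod z ^ m <= R' ^ m) by (apply pow_incr; split; [apply Cmod_ge_0|exact Hz]).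
  assert (U0 := pow_range (Cmod z) m (conj (Cmod_ge_0 z) Hz1)).
  assert (Sm : (K + 4 * M) * ((INR m + 1) * R' ^ m) <= t' / 2).
  { apply Rmult_le_compat_l with (r := (K + 4 * M)%R) in Hn1; [|lra].
    replace ((K + 4 * M) * (t' / (2 * (K + 4 * M))))%R with (t' / 2)%R in Hn1 by (field; lra).
    exact Hn1. }
  assert (Sm' : (K + 4 * M) * ((INR m + 1) * Cmod z ^ m) <= t' / 2).
  { eapply Rle_trans; [|exact Sm]. apply Rmult_le_compat_l; [lra|].
    apply Rmult_le_compat_l; lra. }
  assert (Xs : Cmod (x z) <= 4 * INR m * Cmod z ^ m).
  { rewrite Nx. assert (Y := Rpow_le_pow (Cmod z) (2 * m + N) m
      (conj (Cmod_ge_0 z) Hz1) ltac:(lia)).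
    assert (Y0 := pow_range (Cmod z) (2 * m + N) (conj (Cmod_ge_0 z) Hz1)).
    apply Rmult_le_compat; [|lra| |exact Y].
    - repeat apply Rmult_le_pos; lra.
    - nra. }
  assert (Zs : Cmod (2 * (eps * z ^ f)) <= Cmod z ^ m).
  { rewrite !Cmod_mult, !Cmod_R, !Rabs_right, Cmod_pow by lra.
    assert (Y := Rpow_le_pow (Cmod z) f m (conj (Cmod_ge_0 z) Hz1) ltac:(unfold f; lia)).
    assert (Y0 := pow_range (Cmod z) f (conj (Cmod_ge_0 z) Hz1)). nra. }
  set (r := (Cmod z ^ m)%R) in *.
  assert (Q0 : 0 <= INR m * r) by (apply Rmult_le_pos; lra).
  assert (Q1 : 0 <= K * r) by (apply Rmult_le_pos; lra).
  assert (Q2 : 0 <= M * r) by (apply Rmult_le_pos; lra).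
  assert (Q3 : 0 <= K * (INR m * r)) by (apply Rmult_le_pos; lra).
  assert (Q4 : 0 <= M * (INR m * r)) by (apply Rmult_le_pos; lra).
  repeat split.
  - replace (b' z - b z) with ((b' z - (b z - 2 * (eps * z ^ f) * dir1 (b z) (v z)))
      - 2 * (eps * z ^ f) * dir1 (b z) (v z)) by ring.
    eapply Rle_trans; [apply Cmod_minus_le; [exact A1|apply Cmod_mult_le; [exact Zs|exact B5]]|].
    lra.
  - replace (b1' z - b1 z) with ((b1' z - (b1 z - x z * dir1 (b z) (v z)))
      - x z * dir1 (b z) (v z)) by ring.
    eapply Rle_trans; [apply Cmod_minus_le; [exact A3|apply Cmod_mult_le; [exact Xs|exact B5]]|].
    lra.
  - replace (v' z - v z) with ((v' z - (v z + 2 * (eps * z ^ f) * dir2 (b z) (v z)))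
      + 2 * (eps * z ^ f) * dir2 (b z) (v z)) by ring.
    eapply Rle_trans; [apply Cmod_plus_le; [exact A2|apply Cmod_mult_le; [exact Zs|exact B6]]|].
    lra.
  - replace (v1' z - v1 z) with ((v1' z - (v1 z + x z * dir2 (b z) (v z)))
      + x z * dir2 (b z) (v z)) by ring.
    eapply Rle_trans; [apply Cmod_plus_le; [exact A4|apply Cmod_mult_le; [exact Xs|exact B6]]|].
    lra. }
assert (If1 : 1 <= INR f) by (apply (le_INR 1); unfold f; lia).
assert (If2 : INR f <= 4 * INR m).
{ unfold f. replace 4%R with (INR 4) by (simpl; lra). rewrite <- mult_INR. apply le_INR; lia. }
assert (If3 : INR m <= INR f) by (apply le_INR; unfold f; lia).
exists b', b1', v', v1'. split; [|split].
- split; [exact Pb'|split; [exact Pv'|split; [|split]]].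
  + exists (b0 / 4)%R. split; [lra|]. intros z Hz.
    destruct (Val z Hz) as [W1 [W2 _]]. destruct (Hs z Hz) as [S1 S2]. split; [lra|].
    apply Rabs_le_between in S2. apply Rabs_le_between in W2. apply Rabs_le. lra.
  + exists (Rmin (mu / 2) (Rmin 1 (b0 / (2 * M)))). split.
    { repeat apply Rmin_glb_lt; try lra. apply Rdiv_lt_0_compat; lra. }
    intros z Hz. destruct (Rle_lt_dec (Cmod z) (1 - d)) as [Hzd|Hzd].
    * eapply Rle_trans; [apply Rmin_l|].
      destruct (Small z ltac:(lra)) as [_ [S1 [_ S2]]].
      apply Cmod_near_ge in S1. apply Cmod_near_ge in S2.
      specialize (Hsp z Hz). lra.
    * destruct (Rle_lt_dec (Cmod z ^ m) sg) as [Hr|Hr].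
      -- (* The old velocity is transversal to the new direction. *)
         eapply Rle_trans; [apply Rmin_r|]. eapply Rle_trans; [apply Rmin_r|].
         destruct (Bd z Hz) as [B1 [B2 [B3 [B4 [B5 B6]]]]].
         destruct (App z Hz) as [_ [_ [A3 A4]]]. fold (x z) in A3, A4.
         assert (DL := HL z Hz). assert (Dm := Hdom z ltac:(lra)). assert (Dz := Dir z Hz).
         set (F := dir1 (b z) (v z)) in *. set (G := dir2 (b z) (v z)) in *.
         set (E1 := b1' z - (b1 z - x z * F)) in *. set (E2 := v1' z - (v1 z + x z * G)) in *.
         assert (U0 := pow_range (Cmod z) m (conj (Cmod_ge_0 z) Hz)).
         assert (Ks : K * Cmod z ^ m <= K * sg) by (apply Rmult_le_compat_l; lra).
         assert (LHS : Cmod (F * v1' z + G * b1' z) <= M * (Cmod (b1' z) + Cmod (v1' z))).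
         { eapply Rle_trans.
           - apply Cmod_plus_le; apply Cmod_mult_le; [exact B5|apply Rle_refl|exact B6|apply Rle_refl].
           - lra. }
         assert (RHS : Cmod F * 1 <= Cmod (F * v1 z + G * b1 z)).
         { eapply Rle_trans; [|apply Cmod_plus_ge]. rewrite !Cmod_mult.
           assert (P1 : Cmod F * (L * Cmod (b1 z) + 1) <= Cmod F * Cmod (v1 z))
             by (apply Rmult_le_compat_l; [apply Cmod_ge_0|exact Dm]).
           assert (P2 : Cmod G * Cmod (b1 z) <= L * Cmod F * Cmod (b1 z))
             by (apply Rmult_le_compat_r; [apply Cmod_ge_0|exact DL]).
           lra. }
         assert (ER : Cmod (F * E2 + G * E1) <= 2 * M * (K * sg)).
         { eapply Rle_trans.
           - apply Cmod_plus_le; apply Cmod_mult_le; [exact B5|exact A4|exact B6|exact A3].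
           - assert (M * (K * Cmod z ^ m) <= M * (K * sg)) by (apply Rmult_le_compat_l; lra).
             lra. }
         assert (Q := Cmod_plus_ge (F * v1 z + G * b1 z) (F * E2 + G * E1)).
         replace (F * v1 z + G * b1 z + (F * E2 + G * E1)) with (F * v1' z + G * b1' z) in Q
           by (unfold E1, E2; ring).
         apply Rmult_le_reg_l with M; [lra|].
         replace (M * (b0 / (2 * M)))%R with (b0 / 2)%R by (field; lra). lra.
      -- eapply Rle_trans; [apply Rmin_r|]. eapply Rle_trans; [apply Rmin_l|].
         assert (Y := Dominate z Hz). rewrite Nx in Y.
         assert (Z := Cmod_ge_0 (v1' z)).
         assert (H2 : / 2 <= Cmod z) by lra.
         assert (PN : (/ 2) ^ N <= Cmod z ^ N) by (apply pow_incr; lra).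
         assert (PP : sg * sg * (/ 2) ^ N <= Cmod z ^ (2 * m + N)).
         { replace (2 * m + N)%nat with (m + m + N)%nat by lia. rewrite !pow_add.
           apply Rmult_le_compat; [nra|lra|nra|exact PN]. }
         assert (PPP : 4 * eps * b0 * INR m * (sg * sg * (/ 2) ^ N)
            <= 4 * eps * b0 * INR m * Cmod z ^ (2 * m + N)).
         { apply Rmult_le_compat_l; [repeat apply Rmult_le_pos; lra|exact PP]. }
         lra.
  + exists (/ (2 * INR f))%R, 1%R. split; [apply Rinv_0_lt_compat; lra|].
    split; [lra|]. intros z Hz.
    assert (Y := Dominate z (proj2 Hz)). assert (X := Xlow z Hz).
    assert (2 * eps * INR m * b0 <= Cmod (x z) * b0) by (apply Rmult_le_compat_r; lra).
    lra.
- intros z Hz. destruct (Small z ltac:(lra)) as [S1 [S2 [S3 S4]]]. repeat split; lra.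
- assert (Hif : 0 < / INR f) by (apply Rinv_0_lt_compat; lra).
  assert (Hif1 : / INR f <= 1) by (rewrite <- Rinv_1; apply Rinv_le_contravar; lra).
  assert (I2f : (/ (2 * INR f) = / INR f / 2)%R) by (field; lra).
  assert (I4f : (/ (4 * INR f) = / INR f / 4)%R) by (field; lra).
  (* On this annulus |z|^f >= 1/2, so |x| >= 2 eps m, and the product is at least |x|^2 / 8 >= A^2.
     The width 1/(4f) is of order 1/m and A is of order eps m, so the cost of crossing does not
     depend on m. *)
  exists (eps * INR m / 2)%R, (1 - / (2 * INR f))%R, (1 - / (4 * INR f))%R.
  rewrite I4f. rewrite I2f in *.
  assert (Lt : / INR f / 2 < 1 - Rad).
  { assert (Hf9 : 1 <= (1 - Rad) * INR f).
    { eapply Rle_trans; [exact Hn9|]. apply Rmult_le_compat_l; lra. }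
    apply Rmult_le_compat_r with (r := (/ INR f)%R) in Hf9; [|lra].
    rewrite Rmult_assoc, Rinv_r in Hf9 by lra. lra. }
  repeat split; try lra.
  + repeat apply Rmult_lt_0_compat; lra.
  + replace (eps * INR m / 2 * (1 - / INR f / 4 - (1 - / INR f / 2)))%R with
      (eps / 8 * (INR m / INR f))%R by (field; lra).
    assert (Q : / 4 <= INR m / INR f).
    { apply Rmult_le_reg_r with (INR f); [lra|].
      unfold Rdiv. rewrite Rmult_assoc, Rinv_l; lra. }
    assert (eps / 8 * / 4 <= eps / 8 * (INR m / INR f)) by (apply Rmult_le_compat_l; lra).
    lra.
  + intros z Hz. assert (Hz1 : Cmod z <= 1) by lra.
    destruct (Bd z Hz1) as [B1 [B2 [B3 [B4 [B5 B6]]]]].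
    destruct (App z Hz1) as [A1 [A2 [A3 A4]]]. fold (x z) in A3, A4.
    destruct (Val z Hz1) as [_ [_ W3]]. destruct (Hs z Hz1) as [S1 S2].
    apply Rabs_le_between in S2.
    assert (U0 := pow_range (Cmod z) m (conj (Cmod_ge_0 z) Hz1)).
    assert (Kr : K * Cmod z ^ m <= K) by nra.
    assert (Pr := dir_product_ge (b z) (v z) (v' z) ltac:(lra) ltac:(lra) W3).
    assert (Hv' : Cmod (v' z) <= V).
    { eapply Rle_trans; [eapply Cmod_near_le; [exact A2|]|].
      - apply Cmod_plus_le; [exact B3|].
        apply Cmod_mult_le with (x := 1%R); [|exact B6].
        assert (Y := X2 z Hz1). rewrite Cmod_mult, Cmod_R, Rabs_right; lra.
      - assert (M * eta >= eta) by nra. unfold V. lra. }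
    assert (Q := approximate_step_product (dir1 (b z) (v z)) (dir2 (b z) (v z)) (x z)
      (b1' z) (v' z) (v1' z) M V Cc B5 B6 Hv').
    assert (Q1 : Cmod (b1' z + x z * dir1 (b z) (v z)) <= Cc).
    { replace (b1' z + x z * dir1 (b z) (v z)) with
        (b1 z + (b1' z - (b1 z - x z * dir1 (b z) (v z)))) by ring.
      apply Cmod_plus_le; lra. }
    assert (Q2 : Cmod (v1' z - x z * dir2 (b z) (v z)) <= Cc).
    { replace (v1' z - x z * dir2 (b z) (v z)) with
        (v1 z + (v1' z - (v1 z + x z * dir2 (b z) (v z)))) by ring.
      apply Cmod_plus_le; lra. }
    specialize (Q Q1 Q2 Pr). fold K1 K2 in Q.
    unfold gauss_speed_product. eapply Rle_trans; [|exact Q].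
    assert (XL := Xlow z ltac:(lra)).
    set (y := Cmod (x z)) in *.
    assert (G1 := Rle_abs K1). assert (G2 := Rle_abs K2).
    assert (G3 := Rabs_pos K1). assert (G4 := Rabs_pos K2).
    assert (G5 : 8 * (Rabs K1 + Rabs K2) + 1 <= y) by lra.
    assert (G6 : y * (8 * (Rabs K1 + Rabs K2) + 1) <= y * y) by (apply Rmult_le_compat_l; lra).
    assert (G7 : y * K1 <= y * Rabs K1) by (apply Rmult_le_compat_l; lra).
    assert (G8 : 1 * Rabs K2 <= y * Rabs K2) by (apply Rmult_le_compat_r; lra).
    assert (G9 : (2 * eps * INR m) * (2 * eps * INR m) <= y * y).
    { assert (0 <= 2 * eps * INR m) by (repeat apply Rmult_le_pos; lra). nra. }
    assert (G10 : 0 <= y * Rabs K1) by (apply Rmult_le_pos; lra).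
    lra.
Qed.

(** [gam_sq] bounds Re b * gam, hence gam by a constant over b0. This supplies the ratio L for
    [transversal_step]. *)
Lemma dir2_le_dir1 b v b0 V : 0 < b0 <= Re b -> 2 <= sq b v <= 4 -> Cmod v <= V ->
  Cmod (dir2 b v) <= (/ (b0 * b0) + V * V) * Cmod (dir1 b v).
Proof.
intros Hb Hs Hv. assert (G := gam_sq b v). assert (B := sq_bounds _ _ Hs).
assert (D : Cmod (dir1 b v) = (Re b * Cmod (spar b v))%R).
{ unfold dir1. rewrite Cmod_mult, Cmod_conj, Cmod_R, Rabs_right by lra. reflexivity. }
unfold dir2. eapply Rle_trans.
- apply Cmod_minus_le; [|apply Cmod_mult_le; [|apply Rle_refl]].
  + rewrite Cmod_mult, Cmod_R. apply Rle_refl.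
  + apply Cmod_mult_le; exact Hv.
- rewrite Rmult_plus_distr_r. apply Rplus_le_compat_r. rewrite D.
  rewrite <- Rmult_assoc. apply Rmult_le_compat_r; [lra|].
  assert (G0 : 0 <= gam b v) by nra.
  rewrite Rabs_right by lra.
  assert (P : 0 < b0 * b0) by nra.
  apply Rmult_le_reg_l with (b0 * b0)%R; [exact P|].
  replace (b0 * b0 * (/ (b0 * b0) * Re b))%R with (Re b) by (field; lra).
  assert (b0 * gam b v <= Re b * gam b v) by (apply Rmult_le_compat_r; lra).
  assert (b0 * gam b v <= 1) by lra.
  assert (b0 * (b0 * gam b v) <= b0 * 1) by (apply Rmult_le_compat_l; lra).
  lra.
Qed.

Lemma full_step e e' eps b b1 v v1 (Rad t : R) :
  good_pair e b b1 v v1 -> 0 < eps <= 1 / 1000 -> 0 <= e ->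
  e + 1000 * (eps * eps) < e' -> e' <= 1 -> Rad < 1 -> 0 < t ->
  exists b' b1' v' v1', good_pair e' b' b1' v' v1' /\
    (forall z, Cmod z <= Rad -> Cmod (b' z - b z) <= t /\ Cmod (b1' z - b1 z) <= t /\
       Cmod (v' z - v z) <= t /\ Cmod (v1' z - v1 z) <= t) /\
    exists A R1 R2, Rad < R1 /\ / 2 <= R1 /\ R1 < R2 /\ R2 < 1 /\ 0 < A /\
      eps / 32 <= A * (R2 - R1) /\
      forall z, R1 <= Cmod z <= R2 -> A * A <= Cmod (gauss_speed_product b1' v' v1' z).
Proof.
intros Hg Heps He Hee He' HR Ht.
assert (P2 : 0 < eps * eps) by (apply Rmult_lt_0_compat; lra).
(* The slack left by the quadratic loss is divided equally between the two steps. *)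
set (em := ((e + (e' - 1000 * (eps * eps))) / 2)%R).
assert (Hem : e < em /\ em + 1000 * (eps * eps) < e') by (unfold em; lra).
destruct Hg as [Pb [Pv [[b0 [Hb0 Hs]] Hrest]]].
destruct (polynomial_bounds _ _ Pv) as [M [PM [HM _]]].
(* L must be known before w is; M + 1 will bound w because w stays within 1 of v. *)
set (L := (/ (b0 * b0) + (M + 1) * (M + 1))%R).
assert (HL : 0 <= L).
{ assert (0 < / (b0 * b0)) by (apply Rinv_0_lt_compat; nra). unfold L. nra. }
destruct (transversal_step e em b b1 v v1 Rad (Rmin (t / 2) 1) L) as
  [w [w1 [Pw [Cw [Sw [Vw [Dw Hw]]]]]]]; try assumption; try lra.
{ exact (conj Pb (conj Pv (conj (ex_intro _ b0 (conj Hb0 Hs)) Hrest))). }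
{ apply Rmin_glb_lt; lra. }
destruct (main_step em e' eps b b1 w w1 Rad (t / 2) L) as
  [b' [b1' [v' [v1' [Hg' [Hch Hann]]]]]]; try assumption; try lra.
{ intros z Hz. destruct (Hs z Hz) as [S1 _].
  destruct Cw as [c0 [_ Cw]]. destruct (Cw z Hz) as [_ S2]. apply Rabs_le_between in S2.
  apply dir2_le_dir1; [lra|lra|].
  eapply Rle_trans; [eapply Cmod_near_le; [apply Vw, Hz|apply HM, Hz]|].
  assert (X := Rmin_r (t / 2) 1). lra. }
exists b', b1', v', v1'. split; [exact Hg'|]. split; [|exact Hann].
intros z Hz. destruct (Hch z Hz) as [C1 [C2 [C3 C4]]].
assert (X := Rmin_l (t / 2) 1).
assert (D1 := Vw z ltac:(lra)). assert (D2 := Dw z Hz).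
repeat split; try lra.
- replace (v' z - v z) with ((v' z - w z) + (w z - v z)) by ring.
  eapply Rle_trans; [apply Cmod_plus_le; [exact C3|exact D1]|lra].
- replace (v1' z - v1 z) with ((v1' z - w1 z) + (w1 z - v1 z)) by ring.
  eapply Rle_trans; [apply Cmod_plus_le; [exact C4|exact D2]|lra].
Qed.

(** * The sequence of stages *)

Record stage := Stage {
  st_b : C -> C; st_b1 : C -> C; st_v : C -> C; st_v1 : C -> C; st_w : C -> C;
  st_rad : R; st_tol : R }.

Definition level (k : nat) : R := (1 - / (INR k + 2))%R.
(** Harmonic, so the sum diverges, while the loss 1000 amplitude^2 = 1 / (1000 (k + 2)^2) is below
    the increment 1 / ((k + 2) (k + 3)) of [level]. *)
Definition amplitude (k : nat) : R := (/ (1000 * (INR k + 2)))%R.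

(** Each limiting derivative will differ from that of the stage by at most [2 * st_tol], so the
    factor 8 leaves a positive speed in the limit. *)
Definition stage_ok (k : nat) (s : stage) : Prop :=
  good_pair (level k) (st_b s) (st_b1 s) (st_v s) (st_v1 s) /\
  (st_w s 0 = 0 /\ forall z, is_cderive (st_w s) z (st_v s z * st_b1 s z)) /\
  1 - / (INR k + 1) <= st_rad s < 1 /\ 0 <= st_rad s /\
  0 < st_tol s <= 1 /\
  forall z, Cmod z <= 1 -> 8 * st_tol s <= Cmod (st_b1 s z) + Cmod (st_v1 s z).

(** The bound on the annulus is asked of all values near those of the new stage: later stages
    together move them by at most twice the new tolerance, so the bound reaches the limit. *)
Definition stage_next (k : nat) (s s' : stage) : Prop :=
  st_tol s' <= st_tol s / 2 /\
  (forall z, Cmod z <= st_rad s ->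
    Cmod (st_b s' z - st_b s z) <= st_tol s /\ Cmod (st_b1 s' z - st_b1 s z) <= st_tol s /\
    Cmod (st_v s' z - st_v s z) <= st_tol s /\ Cmod (st_v1 s' z - st_v1 s z) <= st_tol s /\
    Cmod (st_w s' z - st_w s z) <= st_tol s /\
    Cmod (st_v s' z * st_b1 s' z - st_v s z * st_b1 s z) <= st_tol s) /\
  exists A R1, st_rad s < R1 /\ / 2 <= R1 /\ R1 < st_rad s' /\ 0 < A /\
    amplitude k / 32 <= A * (st_rad s' - R1) /\
    forall z beta nu nu1, R1 <= Cmod z <= st_rad s' ->
      Cmod (beta - st_b1 s' z) <= 2 * st_tol s' ->
      Cmod (nu - st_v s' z) <= 2 * st_tol s' ->
      Cmod (nu1 - st_v1 s' z) <= 2 * st_tol s' ->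
      A * A / 2 <= Cmod (beta * (nu1 - nu * nu * beta)).

Lemma amplitude_range k : 0 < amplitude k <= 1 / 1000.
Proof.
unfold amplitude. assert (P := pos_INR k). split.
- apply Rinv_0_lt_compat; lra.
- replace (1 / 1000)%R with (/ 1000)%R by field. apply Rinv_le_contravar; lra.
Qed.

Lemma level_step k : level k + 1000 * (amplitude k * amplitude k) < level (S k).
Proof.
unfold level, amplitude. rewrite S_INR. assert (P := pos_INR k).
set (n := INR k) in *.
replace (1000 * (/ (1000 * (n + 2)) * / (1000 * (n + 2))))%R with
  (/ 1000 * (/ (n + 2) * / (n + 2)))%R by (field; lra).
assert (E : (/ (n + 1 + 2))%R = (/ (n + 2) - / (n + 2) * / (n + 3))%R) by (field; lra).
rewrite E. assert (I1 : 0 < / (n + 2)) by (apply Rinv_0_lt_compat; lra).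
assert (I2 : / (n + 2) <= 2 * / (n + 3)).
{ apply Rmult_le_reg_r with ((n + 2) * (n + 3))%R; [nra|].
  replace (/ (n + 2) * ((n + 2) * (n + 3)))%R with (n + 3)%R by (field; lra).
  replace (2 * / (n + 3) * ((n + 2) * (n + 3)))%R with (2 * (n + 2))%R by (field; lra). lra. }
nra.
Qed.

Lemma level_range k : 0 <= level k <= 1.
Proof.
unfold level. assert (P := pos_INR k).
assert (0 < / (INR k + 2)) by (apply Rinv_0_lt_compat; lra).
assert (/ (INR k + 2) <= / 2) by (apply Rinv_le_contravar; lra). lra.
Qed.

Lemma speed_product_stable M beta nu nu1 beta' nu' nu1' tol : 1 <= M -> 0 <= tol <= 1 ->
  Cmod beta <= M -> Cmod nu <= M -> Cmod nu1 <= M ->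
  Cmod (beta' - beta) <= tol -> Cmod (nu' - nu) <= tol -> Cmod (nu1' - nu1) <= tol ->
  Cmod (beta' * (nu1' - nu' * nu' * beta') - beta * (nu1 - nu * nu * beta))
    <= 20 * (M * M * M) * tol.
Proof.
intros HM Ht Hb Hn Hn1 H1 H2 H3.
assert (Hb' : Cmod beta' <= 2 * M).
{ eapply Rle_trans; [eapply Cmod_near_le; [exact H1|exact Hb]|lra]. }
assert (Hn' : Cmod nu' <= 2 * M).
{ eapply Rle_trans; [eapply Cmod_near_le; [exact H2|exact Hn]|lra]. }
assert (Hn1' : Cmod nu1' <= 2 * M).
{ eapply Rle_trans; [eapply Cmod_near_le; [exact H3|exact Hn1]|lra]. }
replace (beta' * (nu1' - nu' * nu' * beta') - beta * (nu1 - nu * nu * beta)) with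
  ((beta' - beta) * nu1' + beta * (nu1' - nu1)
   - ((nu' - nu) * (nu' + nu) * (beta' * beta')
      + nu * nu * ((beta' - beta) * (beta' + beta)))) by ring.
eapply Rle_trans.
- apply Cmod_minus_le; [apply Cmod_plus_le|apply Cmod_plus_le].
  + apply Cmod_mult_le; [exact H1|exact Hn1'].
  + apply Cmod_mult_le; [exact Hb|exact H3].
  + apply Cmod_mult_le; [apply Cmod_mult_le; [exact H2|apply Cmod_plus_le; eassumption]|].
    apply Cmod_mult_le; exact Hb'.
  + apply Cmod_mult_le; [apply Cmod_mult_le; exact Hn|].
    apply Cmod_mult_le; [exact H1|apply Cmod_plus_le; eassumption].
- assert (M * 1 <= M * M) by (apply Rmult_le_compat_l; lra).
  assert (M * M * 1 <= M * M * M) by (apply Rmult_le_compat_l; nra).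
  assert (0 <= M * M * M) by nra.
  assert (tol * M <= tol * (M * M * M)) by (apply Rmult_le_compat_l; lra).
  assert (0 <= tol * (M * M * M)) by (apply Rmult_le_pos; lra).
  lra.
Qed.

Lemma stage_extend k s : stage_ok k s ->
  exists s', stage_ok (S k) s' /\ stage_next k s s'.
Proof.
intros [Hg [[Hw0 Hw] [HR [HR0 [Ht Hsp]]]]].
destruct s as [b b1 v v1 w Rad t]. simpl in *.
set (rho := ((1 + Rmax Rad (1 - / (INR (S k) + 1))) / 2)%R).
assert (HSk : 0 < / (INR (S k) + 1)).
{ apply Rinv_0_lt_compat. assert (X := pos_INR (S k)). lra. }
assert (Hrho : Rad < rho < 1 /\ 1 - / (INR (S k) + 1) < rho).
{ assert (X := Rmax_l Rad (1 - / (INR (S k) + 1))).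
  assert (Y := Rmax_r Rad (1 - / (INR (S k) + 1))).
  assert (Z : Rmax Rad (1 - / (INR (S k) + 1)) < 1) by (apply Rmax_lub_lt; lra).
  unfold rho. lra. }
clearbody rho.
assert (Hg' := Hg). destruct Hg' as [Pb [Pv _]].
destruct (polynomial_bounds _ _ Pb) as [M [PM [_ HM]]].
destruct (polynomial_bounds _ _ Pv) as [M' [PM' [HM' _]]].
(* Small enough for v * b1 to change by at most t; the mean value inequality then gives the same
   bound for w. *)
set (tau := (t / (2 * (M + M' + 1)))%R).
assert (Htau : 0 < tau) by (apply Rdiv_lt_0_compat; lra).
assert (Etau : (tau * (2 * (M + M' + 1)) = t)%R) by (unfold tau; field; lra).
assert (Htau1 : tau <= t / 2) by nra.
assert (Amp := amplitude_range k). assert (Lv := level_range k).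
assert (Lv' := level_range (S k)).
destruct (full_step (level k) (level (S k)) (amplitude k) b b1 v v1 rho tau)
  as [b' [b1' [v' [v1' [G' [Hch [A [R1 [R2 [HR1 [HR1' [HR12 [HR2 [HA [HAR Hann]]]]]]]]]]]]]]];
  try assumption; try lra.
{ apply level_step. }
assert (G := G'). destruct G as [Pb' [Pv' [_ [[mu [Hmu Hsp']] _]]]].
destruct (polynomial_derive _ _ Pb') as [b2 Pb1'].
destruct (polynomial_primitive _ _ (polynomial_mult _ _ _ _ Pv' Pb1')) as [w' [Hw0' Hw']].
destruct (polynomial_bounds _ _ Pb') as [N [PN [_ HN]]].
destruct (polynomial_bounds _ _ Pv') as [N' [PN' [HN' HN1']]].
set (Q := (1 + N + N')%R). assert (HQ : 1 <= Q) by (unfold Q; lra).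
assert (HQ3 : 1 <= Q * Q * Q).
{ assert (1 <= Q * Q) by nra. nra. }
(* In turn: halving of the tolerance, the margin of the speed, and the annulus bound, by
   [speed_product_stable] with tolerance 2 t'. *)
set (t' := Rmin (t / 2) (Rmin (mu / 8) (A * A / (80 * (Q * Q * Q))))).
assert (HAA : 0 < A * A) by (apply Rmult_lt_0_compat; lra).
assert (Ht' : 0 < t').
{ repeat apply Rmin_glb_lt; try lra. apply Rdiv_lt_0_compat; lra. }
assert (Ht1 : t' <= t / 2) by apply Rmin_l.
assert (Ht2 : t' <= mu / 8) by (eapply Rle_trans; [apply Rmin_r|apply Rmin_l]).
assert (Ht3 : 40 * (Q * Q * Q) * t' <= A * A / 2).
{ assert (X : t' <= A * A / (80 * (Q * Q * Q)))
    by (eapply Rle_trans; [apply Rmin_r|apply Rmin_r]).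
  apply Rmult_le_compat_l with (r := (40 * (Q * Q * Q))%R) in X; [|lra].
  replace (40 * (Q * Q * Q) * (A * A / (80 * (Q * Q * Q))))%R with (A * A / 2)%R in X
    by (field; intros E0; rewrite E0 in HQ; lra).
  exact X. }
clearbody t'.
assert (Dw : forall z, Cmod z <= rho -> Cmod (v' z * b1' z - v z * b1 z) <= t).
{ intros z Hz. destruct (Hch z Hz) as [_ [C2 [C3 _]]].
  replace (v' z * b1' z - v z * b1 z) with
    ((v' z - v z) * ((b1' z - b1 z) + b1 z) + v z * (b1' z - b1 z)) by ring.
  specialize (HM z ltac:(lra)). specialize (HM' z ltac:(lra)).
  eapply Rle_trans.
  - apply Cmod_plus_le; apply Cmod_mult_le; [exact C3| |exact HM'|exact C2].
    apply Cmod_plus_le; [exact C2|exact HM].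
  - assert (tau * tau <= tau * 1) by (apply Rmult_le_compat_l; lra). nra. }
(* The new radius is the outer one of the annulus, so later stages change the data there only within
   the new tolerance. *)
exists (Stage b' b1' v' v1' w' R2 t'). split.
- split; [exact G'|]. split; [split; [exact Hw0'|exact Hw']|].
  cbn [st_b st_b1 st_v st_v1 st_w st_rad st_tol].
  repeat split; try lra.
  intros z Hz. specialize (Hsp' z Hz). lra.
- split; [cbn [st_b st_b1 st_v st_v1 st_w st_rad st_tol]; lra|].
  split; cbn [st_b st_b1 st_v st_v1 st_w st_rad st_tol].
  + intros z Hz. destruct (Hch z ltac:(lra)) as [C1 [C2 [C3 C4]]].
    repeat split; try lra.
    * assert (X := mean_value_inequality (fun u => w' u + - w u)
        (fun u => v' u * b1' u + - (1) * (v u * b1 u)) rho t 0 z).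
      assert (Y : Cmod (w' (0 + z) + - w (0 + z) - (w' 0 + - w 0)) <= t * Cmod z).
      { apply X.
        - intros u _. apply is_cderive_plus; [apply Hw'|].
          apply is_cderive_ext with (fun u => - (1) * w u); [intros; ring|].
          apply is_cderive_scal, Hw.
        - intros u Hu. replace (v' u * b1' u + - (1) * (v u * b1 u)) with
            (v' u * b1' u - v u * b1 u) by ring.
          apply Dw; lra.
        - rewrite Cmod_0; lra.
        - replace (0 + z) with z by ring. lra. }
      rewrite Hw0, Hw0' in Y. replace (0 + z) with z in Y by ring.
      replace (w' z - w z) with (w' z + - w z - (0 + - 0)) by ring.
      assert (t * Cmod z <= t * 1) by (apply Rmult_le_compat_l; lra). lra.
    * apply Dw; lra.
  + exists A, R1. repeat split; try lra.
    intros z beta nu nu1 Hz D1 D2 D3. specialize (Hann z Hz).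
    assert (Hz1 : Cmod z <= 1) by lra.
    specialize (HN z Hz1). specialize (HN' z Hz1). specialize (HN1' z Hz1).
    assert (St := speed_product_stable Q (b1' z) (v' z) (v1' z) beta nu nu1 (2 * t') HQ
      ltac:(lra) ltac:(unfold Q; lra) ltac:(unfold Q; lra) ltac:(unfold Q; lra) D1 D2 D3).
    apply Cmod_near_ge in St. unfold gauss_speed_product in Hann. lra.
Qed.

Lemma initial_stage : exists s, stage_ok 0 s.
Proof.
(* At b = 1, v = 3/8 one has s = 7/4 and |s|^2 = 49/16, near 3; the term z / 100 makes the
   derivative of b nonzero. *)
assert (Pb : polynomial (fun z => 1 + (1 / 100)%R * z) (fun z => 0 + (0 * z + (1 / 100)%R * 1))).
{ apply polynomial_plus; [constructor|]. apply polynomial_mult; constructor. }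
assert (Pv : polynomial (fun _ => RtoC (3 / 8)%R) (fun _ => 0)) by constructor.
destruct (polynomial_derive _ _ Pb) as [b2 Pb1].
destruct (polynomial_primitive _ _ (polynomial_mult _ _ _ _ Pv Pb1)) as [w [Hw0 Hw]].
assert (Nb : forall z, Cmod (0 + (0 * z + (1 / 100)%R * 1)) = (1 / 100)%R).
{ intros z. replace (0 + (0 * z + (1 / 100)%R * 1)) with (RtoC (1 / 100)%R) by ring.
  rewrite Cmod_R, Rabs_right; lra. }
exists (Stage (fun z => 1 + (1 / 100)%R * z) (fun z => 0 + (0 * z + (1 / 100)%R * 1))
  (fun _ => RtoC (3 / 8)%R) (fun _ => 0) w 0 (1 / 1000)).
unfold stage_ok; cbn [st_b st_b1 st_v st_v1 st_w st_rad st_tol].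
split; [|split; [split; [exact Hw0|exact Hw]|]].
- split; [exact Pb|split; [exact Pv|split; [|split]]].
  + exists (1 / 2)%R. split; [lra|]. intros z Hz.
    assert (X := re_le_Cmod z). apply Rabs_le_between in X.
    assert (Y : Re (1 + (1 / 100)%R * z) = (1 + 1 / 100 * Re z)%R).
    { destruct z; simpl. ring. }
    rewrite Y. split; [lra|].
    unfold sq, spar. rewrite Y, <- RtoC_mult, <- RtoC_mult, <- RtoC_plus, Cmod_R.
    rewrite (Rabs_right (1 + 2 * (1 + 1 / 100 * Re z) * (3 / 8))) by lra. unfold level; simpl (INR 0).
    apply Rabs_le. nra.
  + exists (1 / 100)%R. split; [lra|]. intros z Hz. rewrite Nb, Cmod_0. lra.
  + exists (1 / 2)%R, (1 / 100)%R. repeat split; try lra.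
    intros z Hz. rewrite Nb. lra.
- simpl. repeat split; try lra.
  intros z Hz. rewrite Nb, Cmod_0. lra.
Qed.

Lemma stage_sequence : exists s : nat -> stage,
  (forall k, stage_ok k (s k)) /\ forall k, stage_next k (s k) (s (S k)).
Proof.
destruct (constructive_indefinite_description _ initial_stage) as [s0 H0].
set (next := fun k (s : {s | stage_ok k s}) =>
  constructive_indefinite_description _ (stage_extend k (proj1_sig s) (proj2_sig s))).
set (seq := fix seq (k : nat) : {s | stage_ok k s} :=
  match k with
  | O => exist _ s0 H0
  | S k => exist _ (proj1_sig (next k (seq k))) (proj1 (proj2_sig (next k (seq k))))
  end).
exists (fun k => proj1_sig (seq k)). split.
- intros k. apply proj2_sig.
- intros k. simpl. exact (proj2 (proj2_sig (next k (seq k)))).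
Qed.

(** * The limit front *)

(** Crossing the annulus k costs at least amplitude k / 32. Inner radii of at least 1/2 ensure that
    widths do not decrease when |z| is replaced by |z|^2. *)
Definition thick_annuli (rho : C -> R) : Prop :=
  exists R1 R2 A : nat -> R,
    (forall k, / 2 <= R1 k /\ R1 k < R2 k /\ R2 k <= R1 (S k) /\ R2 k < 1 /\ 0 < A k /\
       amplitude k / 32 <= A k * (R2 k - R1 k) /\
       forall z, R1 k <= Cmod z <= R2 k -> A k <= rho z) /\
    forall r, r < 1 -> exists k, r < R1 k.

Lemma limit_data : exists b b1 v v1 w : C -> C,
  (forall z, Cmod z < 1 ->
    is_cderive b z (b1 z) /\ is_cderive v z (v1 z) /\ is_cderive w z (v z * b1 z) /\
    0 < Re (b z) /\ 0 < gam (b z) (v z) /\ 0 < Cmod (b1 z) + Cmod (v1 z)) /\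
  thick_annuli (fun z => sqrt (2 * Cmod (gauss_speed_product b1 v v1 z))).
Proof.
destruct stage_sequence as [s [Hok Hnext]].
set (Rad := fun k => st_rad (s k)). set (t := fun k => st_tol (s k)).
assert (Rm : forall j, Rad j <= Rad (S j)).
{ intros j. destruct (Hnext j) as [_ [_ [A [R1 X]]]]. unfold Rad. lra. }
assert (Rc : forall r, r < 1 -> exists j, r < Rad j).
{ intros r Hr. destruct (eventually_le_INR_mult (1 - r) 1 ltac:(lra)) as [j Hj].
  exists j. specialize (Hj j (le_n _)). destruct (Hok j) as [_ [_ [[X _] _]]].
  unfold Rad. assert (P := pos_INR j).
  assert (Y : / (INR j + 1) < 1 - r).
  { apply Rmult_lt_reg_r with (INR j + 1)%R; [lra|]. rewrite Rinv_l; lra. }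
  lra. }
assert (Th : forall j, 0 <= t (S j) <= t j / 2).
{ intros j. destruct (Hnext j) as [X _]. destruct (Hok (S j)) as [_ [_ [_ [_ [Y _]]]]].
  unfold t. lra. }
assert (T0 : 0 <= t O <= 1).
{ destruct (Hok O) as [_ [_ [_ [_ [Y _]]]]]. unfold t. lra. }
destruct (locally_uniform_limit Rad t Rm Th T0 (fun k => st_b (s k))) as [b Hb].
{ intros j z Hz. now apply (Hnext j). }
destruct (locally_uniform_limit Rad t Rm Th T0 (fun k => st_b1 (s k))) as [b1 Hb1].
{ intros j z Hz. now apply (Hnext j). }
destruct (locally_uniform_limit Rad t Rm Th T0 (fun k => st_v (s k))) as [v Hv].
{ intros j z Hz. now apply (Hnext j). }
destruct (locally_uniform_limit Rad t Rm Th T0 (fun k => st_v1 (s k))) as [v1 Hv1].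
{ intros j z Hz. now apply (Hnext j). }
destruct (locally_uniform_limit Rad t Rm Th T0 (fun k => st_w (s k))) as [w Hw].
{ intros j z Hz. now apply (Hnext j). }
destruct (locally_uniform_limit Rad t Rm Th T0
  (fun k z => st_v (s k) z * st_b1 (s k) z)) as [w1 Hw1].
{ intros j z Hz. now apply (Hnext j). }
assert (Tp := t_pos t Th T0).
assert (Late : forall z, Cmod z < 1 -> forall eps, 0 < eps -> exists j,
  Cmod z <= Rad j /\ 2 * t j <= eps).
{ intros z Hz eps He. destruct (Rc _ Hz) as [j1 Hj1].
  destruct (t_small t Th T0 eps He) as [j0 Hj0].
  exists (max j0 j1). split; [|apply Hj0; lia].
  eapply Rle_trans; [apply Rlt_le, Hj1|apply (Rad_le Rad Rm); lia]. }
(* The rate that [is_cderive_limit] requires is known for the limit [w1] of the products; it remains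
   to identify it pointwise with the product of the limits. *)
assert (Ew : forall z, Cmod z < 1 -> w1 z = v z * b1 z).
{ intros z Hz. set (B := (Cmod (b1 z) + Cmod (v z) + 3)%R).
  assert (P1 := Cmod_ge_0 (b1 z)). assert (P2 := Cmod_ge_0 (v z)).
  destruct (Rle_lt_dec (Cmod (w1 z - v z * b1 z)) 0) as [H0|H0].
  { assert (H := Cmod_eq_0 _ (Rle_antisym _ _ H0 (Cmod_ge_0 _))).
    replace (w1 z) with ((w1 z - v z * b1 z) + v z * b1 z) by ring. rewrite H. ring. }
  exfalso. set (c := Cmod (w1 z - v z * b1 z)) in *.
  destruct (Late z Hz (Rmin 1 (c / (2 * B)))) as [j [Hj Htj]].
  { apply Rmin_glb_lt; [lra|]. apply Rdiv_lt_0_compat; unfold B; lra. }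
  assert (Q1 := Rmin_l 1 (c / (2 * B))). assert (Q2 := Rmin_r 1 (c / (2 * B))).
  assert (D1 := Hw1 j z Hj). assert (D2 := Hv j z Hj). assert (D3 := Hb1 j z Hj).
  cbv beta in D1, D2, D3.
  assert (E : c <= 2 * t j * B).
  { unfold c.
    replace (w1 z - v z * b1 z) with ((w1 z - st_v (s j) z * st_b1 (s j) z)
      - ((v z - st_v (s j) z) * b1 z + v z * (b1 z - st_b1 (s j) z)
         - (v z - st_v (s j) z) * (b1 z - st_b1 (s j) z))) by ring.
    eapply Rle_trans.
    - apply Cmod_minus_le; [exact D1|]. apply Cmod_minus_le; [apply Cmod_plus_le|].
      + apply Cmod_mult_le; [exact D2|apply Rle_refl].
      + apply Cmod_mult_le; [apply Rle_refl|exact D3].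
      + apply Cmod_mult_le; [exact D2|exact D3].
    - specialize (Tp j). unfold B.
      assert (2 * t j * (2 * t j) <= 2 * t j * 1) by (apply Rmult_le_compat_l; lra). lra. }
  assert (F : 2 * t j * B <= c / 2).
  { eapply Rle_trans; [apply Rmult_le_compat_r; [unfold B; lra|exact (Rle_trans _ _ _ Htj Q2)]|].
    right. field. unfold B; lra. }
  lra. }
exists b, b1, v, v1, w. split.
- intros z Hz. split; [|split; [|split]].
  + apply (is_cderive_limit Rad t Rm Rc Th T0 (fun k => st_b (s k)) (fun k => st_b1 (s k)));
      try assumption.
    intros j u. apply polynomial_is_cderive. now destruct (Hok j) as [[X _] _].
  + apply (is_cderive_limit Rad t Rm Rc Th T0 (fun k => st_v (s k)) (fun k => st_v1 (s k)));
      try assumption.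
    intros j u. apply polynomial_is_cderive. now destruct (Hok j) as [[_ [X _]] _].
  + rewrite <- Ew by exact Hz.
    apply (is_cderive_limit Rad t Rm Rc Th T0 (fun k => st_w (s k))
      (fun k z => st_v (s k) z * st_b1 (s k) z)); try assumption.
    intros j u. now destruct (Hok j) as [_ [[_ X] _]].
  (* Only the weak inequality passes to the limit, as the lower bounds of Re b are not uniform in
     the stage. *)
  + assert (Bpos : 0 <= Re (b z)).
    { apply Rnot_lt_le. intros Hlt.
      destruct (Late z Hz (- Re (b z) / 2)%R ltac:(lra)) as [j [Hj Htj]].
      destruct (Hok j) as [[_ [_ [[b0 [Hb0 Hs]] _]]] _].
      destruct (Hs z ltac:(lra)) as [S1 _].
      assert (D := Hb j z Hj). cbv beta in D.
      assert (D' := Rle_trans _ _ _ (re_le_Cmod _) D). apply Rabs_le_between in D'.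
      unfold Cminus in D'. rewrite re_plus, re_opp in D'. lra. }
    assert (Sq : 3 / 2 <= sq (b z) (v z)).
    { set (M := (1 + Cmod (b z) + Cmod (v z))%R).
      assert (P1 := Cmod_ge_0 (b z)). assert (P2 := Cmod_ge_0 (v z)).
      assert (HM : 1 <= M) by (unfold M; lra).
      destruct (Late z Hz (/ (140 * M))%R) as [j [Hj Htj]].
      { apply Rinv_0_lt_compat; lra. }
      assert (Htj' : 140 * M * (2 * t j) <= 1).
      { apply Rmult_le_compat_l with (r := (140 * M)%R) in Htj; [|lra].
        rewrite Rinv_r in Htj by lra. exact Htj. }
      destruct (Hok j) as [[_ [_ [[b0 [Hb0 Hs]] _]]] _].
      destruct (Hs z ltac:(lra)) as [_ S2]. assert (Lv := level_range j).
      apply Rabs_le_between in S2.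
      assert (D1 := Hb j z Hj). assert (D2 := Hv j z Hj). cbv beta in D1, D2.
      specialize (Tp j).
      assert (T1 : 2 * t j <= 1) by nra.
      assert (X := sq_perturb (st_b (s j) z) (st_v (s j) z) (b z - st_b (s j) z)
        (v z - st_v (s j) z) M (2 * t j) HM).
      assert (N1 : Cmod (st_b (s j) z) <= 2 * M).
      { replace (st_b (s j) z) with (b z - (b z - st_b (s j) z)) by ring.
        eapply Rle_trans; [apply Cmod_minus_le; [apply Rle_refl|exact D1]|]. unfold M; lra. }
      assert (N2 : Cmod (st_v (s j) z) <= 2 * M).
      { replace (st_v (s j) z) with (v z - (v z - st_v (s j) z)) by ring.
        eapply Rle_trans; [apply Cmod_minus_le; [apply Rle_refl|exact D2]|]. unfold M; lra. }
      specialize (X N1 N2 ltac:(lra) D1 D2 ltac:(nra)).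
      replace (st_b (s j) z + (b z - st_b (s j) z)) with (b z) in X by ring.
      replace (st_v (s j) z + (v z - st_v (s j) z)) with (v z) in X by ring.
      apply Rabs_le_between in X. nra. }
    assert (G := gam_sq (b z) (v z)).
    (* If Re b were 0, [gam_sq] would give |s|^2 = 1, against [Sq]. *)
    assert (B1 : 0 < Re (b z)).
    { destruct (Rle_lt_or_eq_dec _ _ Bpos) as [H|H]; [exact H|].
      rewrite <- H, Rmult_0_l in G. lra. }
    split; [exact B1|]. split.
    { apply Rnot_le_lt. intros H.
      assert (Re (b z) * gam (b z) (v z) <= Re (b z) * 0) by (apply Rmult_le_compat_l; lra).
      lra. }
    destruct (Rc _ Hz) as [j Hj].
    destruct (Hok j) as [_ [_ [_ [_ [Y X]]]]]. specialize (X z ltac:(lra)).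
    assert (D1 := Hb1 j z ltac:(lra)). assert (D2 := Hv1 j z ltac:(lra)). cbv beta in D1, D2.
    apply Cmod_near_ge in D1. apply Cmod_near_ge in D2. unfold t in D1, D2. lra.
- destruct (choice (fun k (p : R * R) =>
    st_rad (s k) < snd p /\ / 2 <= snd p /\ snd p < st_rad (s (S k)) /\ 0 < fst p /\
    amplitude k / 32 <= fst p * (st_rad (s (S k)) - snd p) /\
    forall z, snd p <= Cmod z <= st_rad (s (S k)) ->
      fst p <= sqrt (2 * Cmod (gauss_speed_product b1 v v1 z)))) as [p Hp].
  { intros k. destruct (Hnext k) as [_ [_ [A [R1 [X1 [X2 [X3 [X4 [X5 X6]]]]]]]]].
    exists (A, R1). cbn [fst snd]. repeat (split; [assumption|]).
    intros z Hz. rewrite <- (sqrt_square A) by lra. apply sqrt_le_1_alt.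
    specialize (X6 z (b1 z) (v z) (v1 z) Hz).
    unfold gauss_speed_product.
    assert (Y : A * A / 2 <= Cmod (b1 z * (v1 z - v z * v z * b1 z))).
    { apply X6; [apply (Hb1 (S k))|apply (Hv (S k))|apply (Hv1 (S k))]; unfold Rad; lra. }
    lra. }
  exists (fun k => snd (p k)), (fun k => st_rad (s (S k))), (fun k => fst (p k)). split.
  + intros k. destruct (Hp k) as [X1 [X2 [X3 [X4 [X5 X6]]]]].
    destruct (Hp (S k)) as [Y1 _]. destruct (Hok (S k)) as [_ [_ [Z _]]].
    repeat split; try assumption; lra.
  + intros r Hr. destruct (Rc r Hr) as [k Hk]. exists k.
    destruct (Hp k) as [X1 _]. unfold Rad in Hk. lra.
Qed.

(** * Completeness *)

Open Scope R_scope.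

Lemma Cabs_Cmod (z : C) : Cabs z = Cmod z.
Proof. unfold Cabs, Cnorm2, Cmod. f_equal. simpl. ring. Qed.

Lemma Cnorm2_Cmod (z : C) : Cnorm2 z = Cmod z * Cmod z.
Proof. rewrite Cmod_sqr. reflexivity. Qed.

(** The positive part of a parabola, a continuous substitute for the indicator of [a, b], so that
    the change of variables along a curve applies. *)
Definition bump (a b u : R) : R := ((u - a) * (b - u) + Rabs ((u - a) * (b - u))) / 2.

Lemma bump_ge a b u : (u - a) * (b - u) <= bump a b u.
Proof. unfold bump. assert (X := Rle_abs ((u - a) * (b - u))). lra. Qed.

Lemma bump_nonneg a b u : 0 <= bump a b u.
Proof.
unfold bump. assert (X := Rle_abs (- ((u - a) * (b - u)))). rewrite Rabs_Ropp in X. lra.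
Qed.

Lemma bump_le a b u : bump a b u <= (b - a) * (b - a) / 4.
Proof.
assert (X := Rle_0_sqr (2 * u - a - b)). assert (Y := Rle_0_sqr (b - a)).
unfold Rsqr in X, Y. unfold bump, Rabs. destruct (Rcase_abs _); lra.
Qed.

Lemma bump_outside a b u : a < b -> u <= a \/ b <= u -> bump a b u = 0.
Proof.
intros Hab H. unfold bump. rewrite Rabs_left1; [lra|]. destruct H; nra.
Qed.

Lemma bump_continuous a b u : continuous (bump a b) u.
Proof.
unfold bump.
assert (P : continuous (fun u => (u - a) * (b - u)) u).
{ apply (ex_derive_continuous (fun u => (u - a) * (b - u))). auto_derive; trivial. }
apply (continuous_mult (K := R_AbsRing) (fun u => (u - a) * (b - u) + Rabs ((u - a) * (b - u)))).
- apply (continuous_plus (V := R_NormedModule) (fun u => (u - a) * (b - u))); [exact P|].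
  now apply continuous_Rabs_comp.
- apply continuous_const.
Qed.

Lemma ex_RInt_of_continuous (f : R -> R) a b :
  (forall u, continuous f u) -> ex_RInt f a b.
Proof. intros H. apply (ex_RInt_continuous (V := R_CompleteNormedModule)). auto. Qed.

Lemma RInt_bump_ge a b s0 s1 : s0 <= a -> a < b -> b <= s1 ->
  (b - a) * (b - a) * (b - a) / 6 <= RInt (bump a b) s0 s1.
Proof.
intros H0 H1 H2.
assert (Ex : forall p q, ex_RInt (bump a b) p q)
  by (intros; apply ex_RInt_of_continuous, bump_continuous).
rewrite <- (RInt_Chasles (bump a b) s0 a s1) by apply Ex.
rewrite <- (RInt_Chasles (bump a b) a b s1) by apply Ex.
assert (P1 : 0 <= RInt (bump a b) s0 a)
  by (apply RInt_ge_0; [exact H0|apply Ex|intros; apply bump_nonneg]).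
assert (P2 : 0 <= RInt (bump a b) b s1)
  by (apply RInt_ge_0; [exact H2|apply Ex|intros; apply bump_nonneg]).
assert (I : is_RInt (fun u => (u - a) * (b - u)) a b ((b - a) * (b - a) * (b - a) / 6)).
{ replace ((b - a) * (b - a) * (b - a) / 6) with
   (minus ((fun u => - (u * u * u) / 3 + (a + b) * (u * u) / 2 - a * b * u) b)
          ((fun u => - (u * u * u) / 3 + (a + b) * (u * u) / 2 - a * b * u) a))
    by (unfold minus, plus, opp; simpl; field).
  apply (is_RInt_derive (V := R_CompleteNormedModule)
    (fun u => - (u * u * u) / 3 + (a + b) * (u * u) / 2 - a * b * u)).
  - intros u _. auto_derive; [trivial|field].
  - intros u _. apply (ex_derive_continuous (fun u => (u - a) * (b - u))).
    auto_derive; trivial. }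
assert (P3 : (b - a) * (b - a) * (b - a) / 6 <= RInt (bump a b) a b).
{ apply (is_RInt_le _ (bump a b) a b _ _ (Rlt_le _ _ H1) I).
  - apply (RInt_correct (V := R_CompleteNormedModule)), Ex.
  - intros u _. apply bump_ge. }
unfold plus; simpl. lra.
Qed.

Fixpoint bump_sum (kap a b : nat -> R) (n : nat) (u : R) : R :=
  match n with
  | O => 0
  | S n => bump_sum kap a b n u + kap n * bump (a n) (b n) u
  end.

Lemma bump_sum_continuous kap a b n u : continuous (bump_sum kap a b n) u.
Proof.
induction n as [|n IH]; simpl.
- apply continuous_const.
- apply (continuous_plus (V := R_NormedModule) (bump_sum kap a b n)); [exact IH|].
  apply (continuous_mult (K := R_AbsRing) (fun _ => kap n)); [apply continuous_const|].
  apply bump_continuous.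
Qed.

Lemma bump_sum_vanish kap a b n u : (forall i, a i < b i /\ b i <= a (S i)) ->
  a n <= u -> bump_sum kap a b n u = 0.
Proof.
intros H. induction n as [|n IH]; simpl; intros Hu; [reflexivity|].
destruct (H n) as [H1 H2].
rewrite IH by lra. rewrite bump_outside by lra. ring.
Qed.

Lemma bump_sum_le (kap a b : nat -> R) (n : nat) (u B : R) :
  (forall i, a i < b i /\ b i <= a (S i)) -> 0 <= B ->
  (forall i, a i < u < b i -> kap i * bump (a i) (b i) u <= B) ->
  bump_sum kap a b n u <= B.
Proof.
intros H HB Hu. induction n as [|n IH]; simpl; [exact HB|].
destruct (H n) as [H1 H2].
destruct (Rle_lt_dec u (a n)) as [L|L].
- rewrite (bump_outside (a n)) by lra. lra.
- rewrite bump_sum_vanish by (try assumption; lra).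
  destruct (Rlt_le_dec u (b n)) as [L'|L'].
  + specialize (Hu n (conj L L')). lra.
  + rewrite bump_outside by lra. lra.
Qed.

Fixpoint amp_sum (k n : nat) : R :=
  match n with O => 0 | S n => amp_sum k n + amplitude (n + k) end.

(** ln (x + 3) - ln (x + 2) <= 1 / (x + 2), so the partial sums dominate a logarithm. *)
Lemma amp_sum_diverges k M : exists n, M <= amp_sum k n.
Proof.
assert (H : forall n, (ln (INR (n + k) + 2) - ln (INR k + 2)) / 1000 <= amp_sum k n).
{ induction n as [|n IH]; simpl amp_sum.
  - simpl (0 + k)%nat. lra.
  - simpl (S n + k)%nat. rewrite S_INR. unfold amplitude.
    assert (P := pos_INR (n + k)). set (x := INR (n + k)) in *.
    assert (E : ln (x + 1 + 2) <= ln (x + 2) + / (x + 2)).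
    { rewrite <- (ln_exp (/ (x + 2))), <- ln_mult by (try apply exp_pos; lra).
      apply ln_le; [lra|].
      assert (Q := exp_ineq1_le (/ (x + 2))).
      apply Rmult_le_compat_l with (r := x + 2) in Q; [|lra].
      rewrite Rmult_plus_distr_l, Rinv_r in Q by lra. lra. }
    replace (/ (1000 * (x + 2))) with (/ (x + 2) / 1000) by (field; lra). lra. }
destruct (large_INR (exp (1000 * M + ln (INR k + 2)))) as [n Hn].
exists n. eapply Rle_trans; [|apply H].
assert (L : 1000 * M + ln (INR k + 2) <= ln (INR (n + k) + 2)).
{ rewrite <- (ln_exp (1000 * M + _)). apply ln_le; [apply exp_pos|].
  specialize (Hn n (le_n _)). rewrite plus_INR. assert (P := pos_INR k). lra. }
lra.
Qed.

Lemma RInt_bump_sum_ge (kap a b : nat -> R) k n s0 s1 :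
  (forall i, a i < b i /\ b i <= a (S i)) -> (forall i, 0 <= kap i) -> s0 <= a O ->
  (forall i, (i < n)%nat -> b i <= s1) ->
  (forall i, amplitude (i + k) / 96 <= kap i * ((b i - a i) * (b i - a i) * (b i - a i) / 6)) ->
  amp_sum k n / 96 <= RInt (bump_sum kap a b n) s0 s1.
Proof.
intros H Hk H0 H1 Ha.
assert (Am : forall i, a O <= a i).
{ induction i as [|i IH]; [lra|]. destruct (H i); lra. }
induction n as [|n IH]; simpl.
- rewrite (RInt_const (V := R_CompleteNormedModule)). unfold scal; simpl; unfold mult; simpl.
  lra.
- assert (E : RInt (fun u => bump_sum kap a b n u + kap n * bump (a n) (b n) u) s0 s1 =
    RInt (bump_sum kap a b n) s0 s1 + kap n * RInt (bump (a n) (b n)) s0 s1).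
  { rewrite (RInt_plus (V := R_CompleteNormedModule) (bump_sum kap a b n)
      (fun u => kap n * bump (a n) (b n) u)).
    - rewrite (RInt_scal (V := R_CompleteNormedModule) (bump (a n) (b n))); [reflexivity|].
      apply ex_RInt_of_continuous, bump_continuous.
    - apply ex_RInt_of_continuous, bump_sum_continuous.
    - apply ex_RInt_of_continuous. intros u.
      apply (continuous_mult (K := R_AbsRing) (fun _ => kap n)); [apply continuous_const|].
      apply bump_continuous. }
  rewrite E. destruct (H n) as [N1 N2].
  assert (X := RInt_bump_ge (a n) (b n) s0 s1 ltac:(specialize (Am n); lra) N1 (H1 n ltac:(lia))).
  apply Rmult_le_compat_l with (r := kap n) in X; [|apply Hk].
  specialize (Ha n). specialize (IH ltac:(intros; apply H1; lia)). lra.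
Qed.

(** A calibration: phi(|z|^2) d(|z|^2) is dominated by rho |dz|, and its integral along a curve
    depends only on the end points, so no crossing times have to be found. Unlike |z|, |z|^2 is
    differentiable at 0 too. *)
Lemma length_lower_bound (rho : Cx -> R) x y x' y' phi :
  C1_curve_D1 x y x' y' -> (forall u, continuous phi u) ->
  (forall z : C, Cmod z < 1 -> 2 * Cmod z * phi (Cmod z * Cmod z) <= rho z /\
     0 <= phi (Cmod z * Cmod z)) ->
  forall t (pr : Riemann_integrable (length_density rho x y x' y') 0 t), 0 <= t < 1 ->
  RInt phi (x 0 * x 0 + y 0 * y 0) (x t * x t + y t * y t) <= RiemannInt pr.
Proof.
intros Hc Hphi Hrho t pr Ht.
rewrite <- (RInt_Reals _ _ _ pr).
set (g := fun s => x s * x s + y s * y s).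
set (dg := fun s => 2 * (x s * x' s + y s * y' s)).
assert (I : is_RInt (fun s => dg s * phi (g s)) 0 t (RInt phi (g 0) (g t))).
{ apply (is_RInt_comp (V := R_CompleteNormedModule) phi g dg 0 t).
  - intros; apply Hphi.
  - intros s Hs. rewrite Rmin_left, Rmax_right in Hs by lra.
    destruct (Hc s ltac:(lra)) as [_ [D1 [D2 [C1 C2]]]].
    assert (Cx0 : continuity_pt x s) by (apply derivable_continuous_pt; exists (x' s); exact D1).
    assert (Cy0 : continuity_pt y s) by (apply derivable_continuous_pt; exists (y' s); exact D2).
    split.
    + apply is_derive_Reals. unfold g, dg.
      replace (2 * (x s * x' s + y s * y' s)) with
        ((x' s * x s + x s * x' s) + (y' s * y s + y s * y' s)) by ring.
      apply (derivable_pt_lim_plus (fun s => x s * x s) (fun s => y s * y s));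
        now apply derivable_pt_lim_mult.
    + apply continuity_pt_filterlim. unfold dg.
      apply continuity_pt_mult; [apply continuity_pt_const; intros ? ?; reflexivity|].
      apply continuity_pt_plus; now apply continuity_pt_mult. }
apply (is_RInt_le _ (length_density rho x y x' y') 0 t _ _ ltac:(lra) I).
- apply (RInt_correct (V := R_CompleteNormedModule)). now apply ex_RInt_Reals_1.
- intros s Hs. destruct (Hc s ltac:(lra)) as [Hin _].
  unfold in_D1 in Hin. rewrite Cabs_Cmod in Hin.
  destruct (Hrho _ Hin) as [Hr Hp].
  assert (E : Cmod (x s, y s) * Cmod (x s, y s) = g s) by now rewrite Cmod_sqr.
  rewrite E in Hr, Hp.
  unfold length_density, dg.
  set (V := (x' s, y' s) : C).
  assert (EV : sqrt (x' s * x' s + y' s * y' s) = Cmod V)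
    by (unfold Cmod, V; simpl; f_equal; ring).
  rewrite EV.
  assert (CS : x s * x' s + y s * y' s <= Cmod (x s, y s) * Cmod V).
  { assert (X := Re_le_Cmod (Cconj (x s, y s) * V)%C).
    rewrite Cmod_mult, Cmod_conj in X. unfold V in *. simpl in X. lra. }
  assert (P0 := Cmod_ge_0 V).
  assert (A1 : 2 * (x s * x' s + y s * y' s) * phi (g s)
      <= 2 * (Cmod (x s, y s) * Cmod V) * phi (g s))
    by (apply Rmult_le_compat_r; lra).
  assert (A2 : 2 * Cmod (x s, y s) * phi (g s) * Cmod V <= rho (x s, y s) * Cmod V)
    by (apply Rmult_le_compat_r; lra).
  lra.
Qed.

Lemma complete_of_thick_annuli (rho : Cx -> R) :
  (forall z, in_D1 z -> 0 < rho z) -> thick_annuli rho ->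
  complete_conformal_metric_D1 rho.
Proof.
intros Hpos [R1 [R2 [A [HA Hcov]]]]. split; [exact Hpos|].
intros x y x' y' Hc Hdiv M.
destruct (Hc 0 ltac:(lra)) as [Hin0 _]. unfold in_D1 in Hin0. rewrite Cabs_Cmod in Hin0.
(* Annuli are counted from one that lies outside the initial point, so all of the first n are
   crossed once the curve is beyond [R2 (n + k)]. *)
destruct (Hcov _ Hin0) as [k Hk].
destruct (amp_sum_diverges k (96 * M)) as [n Hn].
set (a := fun i => R1 (i + k)%nat * R1 (i + k)%nat).
set (b := fun i => R2 (i + k)%nat * R2 (i + k)%nat).
(* By [bump_le] the scaled bump is at most A / 2, hence at most rho / 2 on its annulus; its integral
   is at least A (b - a) / 3, a third of the cost of crossing. *)
set (kap := fun i => 2 * A (i + k)%nat / ((b i - a i) * (b i - a i))).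
assert (Hab : forall i, a i < b i /\ b i <= a (S i)).
{ intros i. destruct (HA (i + k)%nat) as [X1 [X2 [X3 _]]].
  change (S i + k)%nat with (S (i + k)). unfold a, b.
  change (S i + k)%nat with (S (i + k)). nra. }
assert (Hkap : forall i, 0 <= kap i).
{ intros i. destruct (HA (i + k)%nat) as [_ [_ [_ [_ [X _]]]]]. destruct (Hab i).
  apply Rlt_le, Rdiv_lt_0_compat; nra. }
set (phi := bump_sum kap a b n).
destruct (Hdiv (R2 (n + k)%nat)) as [t0 [Ht0 Hfar]].
{ now destruct (HA (n + k)%nat) as [_ [_ [_ [X _]]]]. }
exists t0. split; [exact Ht0|]. intros t pr Ht.
eapply Rle_trans; [|apply (length_lower_bound rho x y x' y' phi Hc)].
- apply Rle_trans with (amp_sum k n / 96); [lra|].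
  apply RInt_bump_sum_ge; try assumption.
  + unfold a; simpl. assert (E : x 0 * x 0 + y 0 * y 0 = Cmod (x 0, y 0) * Cmod (x 0, y 0))
      by now rewrite Cmod_sqr.
    rewrite E. assert (P := Cmod_ge_0 (x 0, y 0)). nra.
  + intros i Hi. specialize (Hfar t Ht). rewrite Cabs_Cmod in Hfar.
    assert (E : x t * x t + y t * y t = Cmod (x t, y t) * Cmod (x t, y t))
      by now rewrite Cmod_sqr.
    rewrite E. unfold b.
    assert (Mono : forall j, (i + k <= j)%nat -> R2 (i + k)%nat <= R2 j).
    { induction 1 as [|j _ IH]; [lra|]. destruct (HA j) as [_ [_ [X3 _]]].
      destruct (HA (S j)) as [_ [X4 _]]. lra. }
    specialize (Mono (n + k)%nat ltac:(lia)).
    destruct (HA (i + k)%nat) as [Y1 [Y2 _]]. nra.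
  + intros i. destruct (HA (i + k)%nat) as [Y1 [Y2 [_ [_ [Y4 [Y5 _]]]]]].
    destruct (Hab i) as [Z1 _]. unfold kap.
    replace (2 * A (i + k)%nat / ((b i - a i) * (b i - a i)) *
      ((b i - a i) * (b i - a i) * (b i - a i) / 6)) with
      (A (i + k)%nat * (b i - a i) / 3) by (field; lra).
    assert (W : R2 (i + k)%nat - R1 (i + k)%nat <= b i - a i) by (unfold a, b; nra).
    apply Rmult_le_compat_l with (r := A (i + k)%nat) in W; [|lra]. lra.
- intros u. apply bump_sum_continuous.
- intros z Hz. assert (P := Cmod_ge_0 z).
  assert (Q0 : 0 <= phi (Cmod z * Cmod z)).
  { unfold phi. clear - Hkap. induction n as [|m IH]; simpl; [lra|].
    assert (X := bump_nonneg (a m) (b m) (Cmod z * Cmod z)). specialize (Hkap m). nra. }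
  split; [|exact Q0].
  assert (Hrz : 0 < rho z) by (apply Hpos; unfold in_D1; now rewrite Cabs_Cmod).
  assert (B : phi (Cmod z * Cmod z) <= rho z / 2).
  { apply bump_sum_le; [exact Hab|lra|]. intros i Hi.
    destruct (HA (i + k)%nat) as [Y1 [Y2 [_ [_ [Y4 [_ Y6]]]]]].
    assert (Y : A (i + k)%nat <= rho z).
    { apply Y6. unfold a, b in Hi. split; nra. }
    destruct (Hab i) as [Z1 _].
    assert (L := bump_le (a i) (b i) (Cmod z * Cmod z)).
    apply Rmult_le_compat_l with (r := kap i) in L; [|apply Hkap].
    replace (kap i * ((b i - a i) * (b i - a i) / 4)) with (A (i + k)%nat / 2) in L
      by (unfold kap; field; lra).
    lra. }
  nra.
- lra.
Qed.

Open Scope C_scope.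

(** * From the right half-plane to an arbitrary disk *)

Lemma thick_annuli_le (rho rho' : C -> R) :
  (forall z, Cmod z < 1 -> rho z <= rho' z) -> thick_annuli rho -> thick_annuli rho'.
Proof.
intros H [R1 [R2 [A [HA Hc]]]]. exists R1, R2, A. split; [|exact Hc].
intros k. destruct (HA k) as [X1 [X2 [X3 [X4 [X5 [X6 X7]]]]]].
repeat (split; [assumption|]). intros z Hz.
eapply Rle_trans; [now apply X7|apply H; lra].
Qed.

Lemma has_cderiv_of_is_cderive f z l : is_cderive f z l -> has_cderiv f z l.
Proof.
intros H eps Heps. destruct (proj1 (is_cderiveP f z l) H eps Heps) as [d [Hd Hdd]].
exists d. split; [exact Hd|]. intros h [_ Hh]. rewrite !Cabs_Cmod in *. exact (Hdd h Hh).
Qed.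

(** |a + c|^2 - |a - c|^2 = 4 Re (a conj(c)): the Cayley transform in homogeneous coordinates. *)
Lemma complex_pair_pos (a c : C) : 0 < Re (a * Cconj c) ->
  c <> 0 /\ Cmod (a - c) < Cmod (a + c).
Proof.
intros H. split.
- intros ->. rewrite <- (re_conj (a * Cconj 0)), Cmult_conj, Cconj_conj, Cmult_0_r in H.
  simpl in H; lra.
- assert (E1 := Cmod_sqr (a - c)). assert (E2 := Cmod_sqr (a + c)).
  assert (P1 := Cmod_ge_0 (a - c)). assert (P2 := Cmod_ge_0 (a + c)).
  destruct a as [x y], c as [x' y']. simpl in E1, E2, H.
  apply Rnot_le_lt. intros L. nra.
Qed.

Lemma ratio_CP1_infty (a c : C) : c = 0 -> ratio_CP1 a c = None.
Proof.
intros ->. unfold ratio_CP1. destruct (Req_EM_T _ _) as [_|N]; [reflexivity|].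
exfalso; apply N. unfold Cnorm2; simpl. ring.
Qed.

Lemma ratio_CP1_finite (a c : C) : c <> 0 -> ratio_CP1 a c = Some (a / c).
Proof.
intros Hc. unfold ratio_CP1. destruct (Req_EM_T _ _) as [E|_].
- exfalso. rewrite Cnorm2_Cmod in E. apply Hc, Cmod_eq_0.
  assert (P := Cmod_ge_0 c). nra.
- f_equal. unfold Defs.Cdiv, Coquelicot.Complex.Cdiv.
  assert (E : Defs.Cinv c = Coquelicot.Complex.Cinv c).
  { unfold Defs.Cinv, Coquelicot.Complex.Cinv, Cnorm2. simpl. now rewrite !Rmult_1_r. }
  rewrite E. reflexivity.
Qed.

Lemma RtoC_neq (x y : R) : x <> y -> RtoC x <> RtoC y.
Proof. intros H K. apply H. now apply (f_equal fst) in K. Qed.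

(** u + |u| bisects the angle between u and the positive axis, so its square is a positive multiple
    of u. It vanishes only for negative u, where i serves. The diagonal matrix of sg and 1/sg then
    turns the right half-plane towards u. *)
Lemma square_root_direction (u : C) : u <> 0 ->
  exists (sg : C) (kap : R), sg <> 0 /\ 0 < kap /\ sg * sg = kap * u.
Proof.
intros Hu. assert (Hm : 0 < Cmod u) by now apply Cmod_gt_0.
destruct (Req_dec (Cmod (u + Cmod u)) 0) as [H|H].
- apply Cmod_eq_0 in H.
  assert (E : u = - RtoC (Cmod u)).
  { replace u with ((u + Cmod u) - Cmod u) at 1 by ring. rewrite H. ring. }
  exists Ci, (/ Cmod u)%R. split; [|split].
  + intros K. apply (f_equal snd) in K. simpl in K. lra.
  + now apply Rinv_0_lt_compat.
  + rewrite E at 2. rewrite RtoC_inv by lra.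
    replace (/ Cmod u * - Cmod u) with (- (1)) by (field; apply RtoC_neq; lra).
    unfold Ci, Cmult, Copp, RtoC; simpl. f_equal; ring.
- assert (N : u + Cmod u <> 0) by (intros K; apply H; now rewrite K, Cmod_0).
  assert (E : (u + Cmod u) * (u + Cmod u) = (2 * (Cmod u + Re u))%R * u).
  { assert (X : RtoC (Cmod u) * Cmod u = u * Cconj u).
    { rewrite <- RtoC_mult. rewrite <- Cmod2_conj. f_equal; simpl; ring. }
    replace ((u + Cmod u) * (u + Cmod u)) with (u * u + 2 * u * Cmod u + RtoC (Cmod u) * Cmod u)
      by ring.
    rewrite X. rewrite RtoC_mult, RtoC_plus, re_alt. field. }
  exists (u + Cmod u), (2 * (Cmod u + Re u))%R. split; [exact N|]. split; [|exact E].
  assert (P := re_le_Cmod u). apply Rabs_le_between in P.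
  destruct (Req_dec (Cmod u + Re u) 0) as [Z|Z]; [|lra].
  exfalso. rewrite Z, Rmult_0_r, Cmult_0_l in E. apply H.
  apply (f_equal Cmod) in E. rewrite Cmod_mult, Cmod_0 in E. nra.
Qed.

(** Testing the half-plane on pairs by Re (a conj(c)) avoids any division before the matrix acts.
    The maps are c0 + rho (a - c) / (a + c), c0 + rho (a + c) / (c - a) and c0 + sg^2 a / c; the
    factor k brings the determinant of the first two to 1. *)
Lemma disk_mobius (Dsk : CP1 -> Prop) : open_disk_CP1 Dsk ->
  exists p q r s : C, p * s - q * r = 1 /\
    forall a c : C, 0 < Re (a * Cconj c) -> Dsk (ratio_CP1 (p * a + q * c) (r * a + s * c)).
Proof.
intros [c0 rho Hrho|c0 rho Hrho|c0 u Hu].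
- set (k := (/ sqrt (2 * rho))%R).
  assert (Sp : 0 < sqrt (2 * rho)) by (apply sqrt_lt_R0; lra).
  assert (Hk : 0 < k) by now apply Rinv_0_lt_compat.
  assert (Hk2 : RtoC k * k * (2 * rho)%R = 1).
  { rewrite <- !RtoC_mult. f_equal. unfold k.
    assert (E := sqrt_sqrt (2 * rho) ltac:(lra)).
    set (S := sqrt (2 * rho)) in *. rewrite <- E. field. lra. }
  exists (k * (c0 + rho)), (k * (c0 - rho)), (RtoC k), (RtoC k). split.
  { rewrite <- Hk2, RtoC_mult. replace (RtoC 2) with (1 + 1) by (rewrite <- RtoC_plus; f_equal; lra). ring. }
  intros a c Hac. destruct (complex_pair_pos _ _ Hac) as [_ L].
  assert (P := Cmod_ge_0 (a - c)).
  assert (N : a + c <> 0) by (apply Cmod_gt_0; lra).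
  assert (Nk : RtoC k <> 0) by (apply RtoC_neq; lra).
  assert (Nd : k * a + k * c <> 0).
  { replace (k * a + k * c) with (k * (a + c)) by ring. now apply Cmult_neq_0. }
  rewrite ratio_CP1_finite by exact Nd. rewrite Cabs_Cmod.
  change (Cmod ((k * (c0 + rho) * a + k * (c0 - rho) * c) / (k * a + k * c) - c0) < rho).
  replace ((k * (c0 + rho) * a + k * (c0 - rho) * c) / (k * a + k * c) - c0) with
    (rho * ((a - c) / (a + c))) by (field; auto).
  rewrite Cmod_mult, Cmod_div, Cmod_R, Rabs_right by (try assumption; lra).
  apply Rmult_lt_reg_r with (Cmod (a + c)); [lra|].
  unfold Rdiv. rewrite Rmult_assoc, (Rmult_assoc (Cmod _)), Rinv_l, Rmult_1_r by lra.
  now apply Rmult_lt_compat_l.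
- set (k := (/ sqrt (2 * rho))%R).
  assert (Sp : 0 < sqrt (2 * rho)) by (apply sqrt_lt_R0; lra).
  assert (Hk : 0 < k) by now apply Rinv_0_lt_compat.
  assert (Hk2 : RtoC k * k * (2 * rho)%R = 1).
  { rewrite <- !RtoC_mult. f_equal. unfold k.
    assert (E := sqrt_sqrt (2 * rho) ltac:(lra)).
    set (S := sqrt (2 * rho)) in *. rewrite <- E. field. lra. }
  exists (k * (rho - c0)), (k * (c0 + rho)), (- RtoC k), (RtoC k). split.
  { rewrite <- Hk2, RtoC_mult. replace (RtoC 2) with (1 + 1) by (rewrite <- RtoC_plus; f_equal; lra). ring. }
  intros a c Hac. destruct (complex_pair_pos _ _ Hac) as [_ L].
  assert (Nk : RtoC k <> 0) by (apply RtoC_neq; lra).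
  destruct (Ceq_dec (c - a) 0) as [E|N].
  { rewrite ratio_CP1_infty; [exact I|].
    replace (- k * a + k * c) with (k * (c - a)) by ring. rewrite E. ring. }
  assert (Nd : - k * a + k * c <> 0).
  { replace (- k * a + k * c) with (k * (c - a)) by ring. now apply Cmult_neq_0. }
  rewrite ratio_CP1_finite by exact Nd. rewrite Cabs_Cmod.
  change (rho < Cmod ((k * (rho - c0) * a + k * (c0 + rho) * c) / (- k * a + k * c) - c0)).
  replace ((k * (rho - c0) * a + k * (c0 + rho) * c) / (- k * a + k * c) - c0) with
    (rho * ((a + c) / (c - a))) by (field; auto).
  assert (P : 0 < Cmod (c - a)) by now apply Cmod_gt_0.
  rewrite Cmod_mult, Cmod_div, Cmod_R, Rabs_right by (try assumption; lra).
  assert (E : Cmod (a - c) = Cmod (c - a)) by (rewrite <- Cmod_opp; f_equal; ring).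
  apply Rmult_lt_reg_r with (Cmod (c - a)); [lra|].
  unfold Rdiv. rewrite (Rmult_assoc rho), (Rmult_assoc (Cmod _)), Rinv_l, Rmult_1_r by lra.
  apply Rmult_lt_compat_l; lra.
- destruct (square_root_direction u Hu) as [sg [kap [Hs [Hk E]]]].
  exists sg, (c0 / sg), 0, (/ sg). split; [field; exact Hs|].
  intros a c Hac. destruct (complex_pair_pos _ _ Hac) as [Nc _].
  assert (Nd : 0 * a + / sg * c <> 0).
  { replace (0 * a + / sg * c) with (/ sg * c) by ring.
    apply Cmult_neq_0; [|exact Nc]. intros K.
    apply (RtoC_neq 1 0); [lra|]. rewrite <- (Coquelicot.Complex.Cinv_r sg Hs), K. ring. }
  rewrite ratio_CP1_finite by exact Nd.
  change (0 < Re (((sg * a + c0 / sg * c) / (0 * a + / sg * c) - c0) * Cconj u)).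
  assert (Ncc : Cconj c <> 0).
  { intros K. apply Nc, Cmod_eq_0. rewrite <- Cmod_conj, K. apply Cmod_0. }
  replace (((sg * a + c0 / sg * c) / (0 * a + / sg * c) - c0) * Cconj u) with
    ((sg * sg) * (a / c) * Cconj u) by (field; split; assumption).
  rewrite E.
  replace (kap * u * (a / c) * Cconj u) with
    (kap * (u * Cconj u) * (a * Cconj c) / (c * Cconj c)) by (field; split; assumption).
  rewrite <- !Cmod2_conj.
  assert (Pu : 0 < Cmod u) by now apply Cmod_gt_0.
  assert (Pc : 0 < Cmod c) by now apply Cmod_gt_0.
  assert (Qu : 0 < Cmod u ^ 2) by now apply pow_lt.
  assert (Qc : 0 < Cmod c ^ 2) by now apply pow_lt.
  unfold Coquelicot.Complex.Cdiv.
  rewrite <- RtoC_inv, <- RtoC_mult, re_scal_r, re_scal_l by lra.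
  apply Rmult_lt_0_compat; [|now apply Rinv_0_lt_compat].
  apply Rmult_lt_0_compat; [|exact Hac]. now apply Rmult_lt_0_compat.
Qed.

Lemma half_plane_front : exists A B C0 D A1 B1 C1 D1 : C -> C,
  (forall z, Cmod z < 1 ->
    (is_cderive A z (A1 z) /\ is_cderive B z (B1 z) /\
     is_cderive C0 z (C1 z) /\ is_cderive D z (D1 z)) /\
    A z * D z - B z * C0 z = 1 /\
    D z * A1 z - B z * C1 z = 0 /\ A z * D1 z - C0 z * B1 z = 0 /\
    ~ (A z * C1 z - C0 z * A1 z = 0 /\ D z * B1 z - B z * D1 z = 0) /\
    0 < Re (A z * Cconj (C0 z)) /\ 0 < Re (B z * Cconj (D z))) /\
  thick_annuli (fun z => sqrt (2 *
    Cmod ((A z * C1 z - C0 z * A1 z) * (D z * B1 z - B z * D1 z)))).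
Proof.
destruct limit_data as [b [b1 [v [v1 [w [H Hann]]]]]].
set (E := fun z => cexp (w z)). set (F := fun z => cexp (- w z)).
assert (EF : forall z, F z * E z = 1) by (intros z; apply cexp_opp_l).
set (k := fun z => v1 z - v z * v z * b1 z).
(* Since w' = v b', each column has a derivative proportional to the other column: (A', C') to (b,
   1) and (B', D') to (1 + b v, v). This is the Legendrian condition. *)
exists (fun z => F z * (1 + b z * v z)), (fun z => E z * b z),
  (fun z => F z * v z), E,
  (fun z => F z * (b z * k z)), (fun z => E z * (b1 z + b z * (v z * b1 z))),
  (fun z => F z * k z), (fun z => E z * (v z * b1 z)).
assert (Om : forall z, F z * (1 + b z * v z) * (F z * k z) - F z * v z * (F z * (b z * k z))
   = F z * F z * k z) by (intros; ring).
assert (Th : forall z, E z * (E z * (b1 z + b z * (v z * b1 z))) - E z * b z * (E z * (v z * b1 z))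
   = E z * E z * b1 z) by (intros; ring).
split.
- intros z Hz. destruct (H z Hz) as [Db [Dv [Dw [Hb [Hg Hsp]]]]].
  assert (DE : is_cderive E z (E z * (v z * b1 z))).
  { eapply is_cderive_eq; [apply (is_cderive_comp cexp w); [apply is_cderive_cexp|exact Dw]|].
    unfold E; ring. }
  assert (DF : is_cderive F z (- (F z * (v z * b1 z)))).
  { eapply is_cderive_eq.
    - apply (is_cderive_comp cexp (fun u => - w u)); [apply is_cderive_cexp|].
      apply is_cderive_ext with (fun u => - (1) * w u); [intros; ring|].
      apply is_cderive_scal, Dw.
    - unfold F; ring. }
  assert (EFz := EF z).
  assert (NE : E z <> 0) by (intros K; rewrite K in EFz; apply (RtoC_neq 1 0); [lra|];
    rewrite <- EFz; ring).
  assert (NF : F z <> 0) by (intros K; rewrite K in EFz; apply (RtoC_neq 1 0); [lra|];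
    rewrite <- EFz; ring).
  split; [split; [|split; [|split]]|split; [|split; [|split; [|split; [|split]]]]].
  + eapply is_cderive_eq.
    * apply is_cderive_mult; [exact DF|].
      apply is_cderive_plus; [apply is_cderive_const|apply is_cderive_mult; [exact Db|exact Dv]].
    * unfold k; cbv beta; ring.
  + eapply is_cderive_eq; [apply is_cderive_mult; [exact DE|exact Db]|ring].
  + eapply is_cderive_eq; [apply is_cderive_mult; [exact DF|exact Dv]|unfold k; ring].
  + exact DE.
  + replace (F z * (1 + b z * v z) * E z - E z * b z * (F z * v z)) with (F z * E z) by ring.
    exact EFz.
  + ring.
  + ring.
  + rewrite Om, Th. intros [K1 K2].
    assert (B0 : b1 z = 0).
    { transitivity (E z * E z * b1 z * (F z * F z)); [|rewrite K2; ring].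
      transitivity (b1 z * (F z * E z) * (F z * E z)); [rewrite EFz|]; ring. }
    assert (V0 : v1 z = 0).
    { transitivity ((F z * F z * k z) * (E z * E z) + v z * v z * b1 z);
        [|rewrite K1, B0; ring].
      transitivity (k z * (F z * E z) * (F z * E z) + v z * v z * b1 z); [|ring].
      rewrite EFz. unfold k. ring. }
    rewrite B0, V0, Cmod_0 in Hsp. lra.
  + assert (X : F z * (1 + b z * v z) * Cconj (F z * v z) =
      RtoC (Cmod (F z) ^ 2)%R * ((1 + b z * v z) * Cconj (v z))).
    { rewrite Cmod2_conj, Cmult_conj. ring. }
    rewrite X, re_scal_l.
    assert (Y : Re ((1 + b z * v z) * Cconj (v z)) = gam (b z) (v z)).
    { destruct (b z) as [x0 y0], (v z) as [x y]. unfold gam; simpl. ring. }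
    rewrite Y. apply Rmult_lt_0_compat; [|exact Hg].
    apply pow_lt. now apply Cmod_gt_0.
  + assert (X : E z * b z * Cconj (E z) = RtoC (Cmod (E z) ^ 2)%R * b z).
    { rewrite Cmod2_conj. ring. }
    rewrite X, re_scal_l. apply Rmult_lt_0_compat; [|exact Hb].
    apply pow_lt. now apply Cmod_gt_0.
- eapply thick_annuli_le; [|exact Hann]. intros z _. cbv beta. right. do 3 f_equal.
  rewrite Om, Th. unfold gauss_speed_product.
  replace (F z * F z * k z * (E z * E z * b1 z)) with
    ((F z * E z) * (F z * E z) * (b1 z * k z)) by ring.
  rewrite EF. unfold k. ring.
Qed.

Theorem mainTheorem1 :
  forall Dsk : CP1 -> Prop, open_disk_CP1 Dsk ->
  exists A B C D A' B' C' D' : Cx -> Cx,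
    holo_legendrian_immersion A B C D A' B' C' D' /\
    weakly_complete A B C D A' B' C' D' /\
    (forall z, in_D1 z -> Dsk (ratio_CP1 (A z) (C z))) /\
    (forall z, in_D1 z -> Dsk (ratio_CP1 (B z) (D z))).
Proof.
intros Dsk HD. destruct (disk_mobius Dsk HD) as [p [q [r [s [Hdet HM]]]]].
destruct half_plane_front as [A [B [Cc [D [A1 [B1 [C1 [D1 [H Hann]]]]]]]]].
assert (HinD : forall z, in_D1 z -> Cmod z < 1).
{ intros z Hz. unfold in_D1 in Hz. now rewrite Cabs_Cmod in Hz. }
set (mob := fun (x y : C) (f g : C -> C) (z : C) => x * f z + y * g z).
assert (Dm : forall x y f g f1 g1 z, is_cderive f z f1 -> is_cderive g z g1 ->
  is_cderive (fun u => x * f u + y * g u) z (x * f1 + y * g1)).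
{ intros. apply is_cderive_plus; now apply is_cderive_scal. }
(* Up to sign, omega and theta are determinants of a column and its derivative, so a constant matrix
   on the left multiplies them by its determinant. *)
assert (Om : forall z : C,
  (omega_of (mob p q A Cc) (mob r s A Cc) (mob p q A1 C1) (mob r s A1 C1) z : C) = A z * C1 z - Cc z * A1 z).
{ intros z.
  transitivity ((p * s - q * r) * (A z * C1 z - Cc z * A1 z)); [|rewrite Hdet; ring].
  unfold mob. change (omega_of _ _ _ _ z) with
    ((p * A z + q * Cc z) * (r * A1 z + s * C1 z) - (r * A z + s * Cc z) * (p * A1 z + q * C1 z)).
  ring. }
assert (Th : forall z : C,
  (theta_of (mob p q B D) (mob r s B D) (mob p q B1 D1) (mob r s B1 D1) z : C) = D z * B1 z - B z * D1 z).
{ intros z.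
  transitivity ((p * s - q * r) * (D z * B1 z - B z * D1 z)); [|rewrite Hdet; ring].
  unfold mob. change (theta_of _ _ _ _ z) with
    ((r * B z + s * D z) * (p * B1 z + q * D1 z) - (p * B z + q * D z) * (r * B1 z + s * D1 z)).
  ring. }
exists (mob p q A Cc), (mob p q B D), (mob r s A Cc), (mob r s B D),
  (mob p q A1 C1), (mob p q B1 D1), (mob r s A1 C1), (mob r s B1 D1).
split; [|split; [|split]].
- repeat split.
  + intros z Hz. apply has_cderiv_of_is_cderive, Dm; apply (H z (HinD z Hz)).
  + intros z Hz. apply has_cderiv_of_is_cderive, Dm; apply (H z (HinD z Hz)).
  + intros z Hz. apply has_cderiv_of_is_cderive, Dm; apply (H z (HinD z Hz)).
  + intros z Hz. apply has_cderiv_of_is_cderive, Dm; apply (H z (HinD z Hz)).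
  + intros z Hz. destruct (H z (HinD z Hz)) as [_ [X _]].
    change ((p * A z + q * Cc z) * (r * B z + s * D z)
      - (p * B z + q * D z) * (r * A z + s * Cc z) = 1).
    transitivity ((p * s - q * r) * (A z * D z - B z * Cc z)); [ring|].
    rewrite Hdet, X. ring.
  + intros z Hz. destruct (H z (HinD z Hz)) as [_ [_ [X _]]].
    change ((r * B z + s * D z) * (p * A1 z + q * C1 z)
      - (p * B z + q * D z) * (r * A1 z + s * C1 z) = 0).
    transitivity ((p * s - q * r) * (D z * A1 z - B z * C1 z)); [ring|].
    rewrite X. ring.
  + intros z Hz. destruct (H z (HinD z Hz)) as [_ [_ [_ [X _]]]].
    change ((p * A z + q * Cc z) * (r * B1 z + s * D1 z)
      - (r * A z + s * Cc z) * (p * B1 z + q * D1 z) = 0).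
    transitivity ((p * s - q * r) * (A z * D1 z - Cc z * B1 z)); [ring|].
    rewrite X. ring.
  + intros z Hz [K1 [K2 [K3 K4]]].
    destruct (H z (HinD z Hz)) as [_ [_ [_ [_ [X _]]]]]. apply X.
    rewrite <- Om, <- Th. unfold omega_of, theta_of. rewrite K1, K2, K3, K4.
    split.
    * change (mob p q A Cc z * 0 - mob r s A Cc z * 0 = 0). ring.
    * change (mob r s B D z * 0 - mob p q B D z * 0 = 0). ring.
- assert (Rho : forall z, Cmod z < 1 ->
    sqrt (2 * Cmod ((A z * C1 z - Cc z * A1 z) * (D z * B1 z - B z * D1 z))) <=
    sqrt (Cnorm2 (A z * C1 z - Cc z * A1 z) + Cnorm2 (D z * B1 z - B z * D1 z))).
  { intros z _. apply sqrt_le_1_alt. rewrite !Cnorm2_Cmod, Cmod_mult.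
    set (x := Cmod (A z * _ - _)). set (y := Cmod (D z * _ - _)).
    assert (X := Rle_0_sqr (x - y)). unfold Rsqr in X. lra. }
  unfold weakly_complete. apply complete_of_thick_annuli.
  + intros z Hz. rewrite Om, Th, !Cnorm2_Cmod. apply sqrt_lt_R0.
    destruct (H z (HinD z Hz)) as [_ [_ [_ [_ [X _]]]]].
    assert (P1 := Cmod_ge_0 (A z * C1 z - Cc z * A1 z)).
    assert (P2 := Cmod_ge_0 (D z * B1 z - B z * D1 z)).
    destruct (Req_dec (Cmod (A z * C1 z - Cc z * A1 z)) 0) as [E1|E1]; [|nra].
    destruct (Req_dec (Cmod (D z * B1 z - B z * D1 z)) 0) as [E2|E2]; [|nra].
    exfalso. apply X. split; now apply Cmod_eq_0.
  + eapply thick_annuli_le; [|exact Hann]. intros z Hz. cbv beta.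
    rewrite Om, Th. now apply Rho.
- intros z Hz. apply HM. now destruct (H z (HinD z Hz)) as [_ [_ [_ [_ [_ [X _]]]]]].
- intros z Hz. apply HM. now destruct (H z (HinD z Hz)) as [_ [_ [_ [_ [_ [_ X]]]]]].
Qed.
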